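(* Let $K\subset\mathbb{R}^N$ be a convex body symmetric with respect to the origin (with no regularity assumption), and let $\Omega\subset\mathbb{R}^N$ be a convex body. Then $$\frac{1}{N(N+2)}(R_\Omega^K)^2\ \le\ \frac{T^K(\Omega)}{|\Omega|}\ \le\ \frac13 (R_\Omega^K)^2$$ and $$\frac{\pi^2}{4}(R_\Omega^K)^{-2}\ \le\ \lambda_1^K(\Omega)\ \le\ \lambda_1(B)\,(R_\Omega^K)^{-2}.$$
   Context: A convex body is a compact convex subset of $\mathbb{R}^N$ with nonempty interior. The support function of $K$ is $h_K(x)=\max\{x\cdot y : y\in K\}$; when $K$ is symmetric with respect to the origin, $h_K$ is a norm. The $K$-torsional rigidity and $K$-principal frequency of $\Omega$ are $$T^K(\Omega)=\max_{u\in W_0^{1,2}(\Omega)\setminus\{0\}}\frac{\left(\int_\Omega u\,dx\right)^2}{\int_\Omega h_K^2(\nabla u)\,dx},\qquad \lambda_1^K(\Omega)=\min_{u\in W_0^{1,2}(\Omega)\setminus\{0\}}\frac{\int_\Omega h_K^2(\nabla u)\,dx}{\int_\Omega u^2\,dx},$$ where, for a convex body $\Omega$, $W_0^{1,2}(\Omega)$ is the Sobolev space $W^{1,2}_0$ of the interior of $\Omega$. $|\Omega|$ is Lebesgue measure. $B$ is the Euclidean unit ball of $\mathbb{R}^N$ and $\lambda_1(B)$ is the first Dirichlet eigenvalue of $-\Delta$ on $B$. The anisotropic inradius $R_\Omega^K$ is the largest $t$ such that $x+tK\subseteq\Omega$ for some $x\in\Omega$. *)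

(* Defs.v *)
From HB Require Import structures.
From mathcomp Require Import all_boot all_order all_algebra.
From mathcomp Require Import all_classical all_reals all_analysis.

Set Implicit Arguments.
Unset Strict Implicit.
Unset Printing Implicit Defensive.

Import Order.TTheory GRing.Theory Num.Theory.
Import numFieldNormedType.Exports.

Local Open Scope classical_set_scope.
Local Open Scope ring_scope.

Definition rV_display : measure_display.
Proof. exact: default_measure_display. Qed.

Section measurable_rV.
Variables (R : realType) (n : nat).

Definition rV_coord (i : 'I_n) (x : 'rV[R]_n) : measurableTypeR R := x ord0 i.

Let rV_set0 : g_sigma_preimage rV_coord set0.
Proof. exact: sigma_algebra0. Qed.

Let rV_setC A : g_sigma_preimage rV_coord A -> g_sigma_preimage rV_coord (~` A).
Proof. exact: sigma_algebraC. Qed.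

Let rV_bigcup (F : _^nat) : (forall i, g_sigma_preimage rV_coord (F i)) ->
  g_sigma_preimage rV_coord (\bigcup_i (F i)).
Proof. exact: sigma_algebra_bigcup. Qed.

(* The sigma-algebra generated by the coordinates, i.e. the Borel sets of R^n. *)
HB.instance Definition _ := @isMeasurable.Build rV_display
  'rV[R]_n (g_sigma_preimage rV_coord) rV_set0 rV_setC rV_bigcup.

Lemma measurable_rV_coord i : measurable_fun setT (rV_coord i).
Proof.
move=> _ Y mY; rewrite setTI; apply: sub_sigma_algebra => /=.
rewrite -bigcup_seq/=; exists i => /=; first by rewrite mem_index_enum.
by exists Y => //; rewrite setTI.
Qed.

Lemma measurable_rV d (T : measurableType d) (f : T -> 'rV[R]_n) :
  (forall i, measurable_fun setT (rV_coord i \o f)) -> measurable_fun setT f.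
Proof.
move=> mf; apply: (@measurability _ _ _ _ _ _
  (\big[setU/set0]_(i < n) preimage_set_system setT (rV_coord i) measurable)) => //.
move=> _ [Z + <-]; rewrite -bigcup_seq => -[i _ [Y mY <-]].
rewrite !setTI -comp_preimage.
by have := mf i measurableT Y mY; rewrite setTI.
Qed.

End measurable_rV.

Section lebesgue_rV.
Variable R : realType.

Section step.
Variable n : nat.

Definition rV_cons (p : measurableTypeR R * 'rV[R]_n) : 'rV[R]_n.+1 :=
  \row_i (if unlift ord0 i is Some j then p.2 ord0 j else p.1).

Definition rV_uncons (v : 'rV[R]_n.+1) : measurableTypeR R * 'rV[R]_n :=
  (v ord0 ord0, \row_j v ord0 (lift ord0 j)).

Lemma rV_consK : cancel rV_cons rV_uncons.
Proof.
move=> [x v]; rewrite /rV_uncons /rV_cons !mxE unlift_none /=.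
by congr pair; apply/rowP => j; rewrite !mxE liftK.
Qed.

Lemma measurable_rV_cons : measurable_fun setT rV_cons.
Proof.
apply: measurable_rV => i.
case: (unliftP ord0 i) => [j|] ->.
- rewrite (_ : _ \o _ = rV_coord j \o snd).
    apply: measurableT_comp; first exact: measurable_rV_coord.
    exact: measurable_snd.
  by apply/funext => p; rewrite /rV_coord /= mxE liftK.
- rewrite (_ : _ \o _ = fst); first exact: measurable_fst.
  by apply/funext => p; rewrite /rV_coord /= mxE unlift_none.
Qed.

Lemma measurable_rV_uncons : measurable_fun setT rV_uncons.
Proof.
apply/measurable_fun_pair; first exact: (measurable_rV_coord ord0).
apply: measurable_rV => i.
rewrite (_ : _ \o _ = rV_coord (lift ord0 i)); first exact: measurable_rV_coord.
by apply/funext => p; rewrite /rV_coord /= mxE.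
Qed.

Variable mu : {sigma_finite_measure set 'rV[R]_n -> \bar R}.

Definition lebesgue_rV_step : set 'rV[R]_n.+1 -> \bar R :=
  pushforward (@lebesgue_measure R \x mu)%E rV_cons.

Let mu_pf : {measure set 'rV[R]_n.+1 -> \bar R} :=
  measure_function_pushforward__canonical__measure_function_Measure
    (@lebesgue_measure R \x mu)%E measurable_rV_cons.

HB.instance Definition _ := isMeasure.Build _ _ _ lebesgue_rV_step
  (measure0 mu_pf) (measure_ge0 mu_pf) (@measure_semi_sigma_additive _ _ _ mu_pf).

Let lebesgue_rV_step_sigma_finite : sigma_finite setT lebesgue_rV_step.
Proof.
have /sigma_finiteP[F [TF ndF Foo]] := sigma_finiteT (@lebesgue_measure R).
have /sigma_finiteP[G [TG ndG Goo]] := sigma_finiteT mu.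
exists (fun k => rV_uncons @^-1` (F k `*` G k)).
  apply/esym; rewrite -subTset => v _.
  have [k _ Fk] : (\bigcup_k F k) (rV_uncons v).1 by rewrite -TF.
  have [l _ Gl] : (\bigcup_k G k) (rV_uncons v).2 by rewrite -TG.
  exists (maxn k l) => //; split.
  - by move: Fk; exact/subsetPset/ndF/leq_maxl.
  - by move: Gl; exact/subsetPset/ndG/leq_maxr.
move=> k; have [mFk Fk] := Foo k; have [mGk Gk] := Goo k.
have mFGk : measurable (F k `*` G k) by exact: measurableX.
split.
  by rewrite -[X in measurable X]setTI; exact: measurable_rV_uncons.
rewrite /lebesgue_rV_step /pushforward -comp_preimage.
rewrite (_ : _ \o _ = id); last by apply/funext => p; exact: rV_consK.
by rewrite preimage_id product_measure1E// lte_mul_pinfty// ge0_fin_numE.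
Qed.

HB.instance Definition _ := Measure_isSigmaFinite.Build _ _ _
  lebesgue_rV_step lebesgue_rV_step_sigma_finite.

End step.

(* On R^0 the Dirac mass; on R^(n+1) = R * R^n the product measure. *)
Fixpoint lebesgue_rV n : {sigma_finite_measure set 'rV[R]_n -> \bar R} :=
  match n with
  | 0 => dirac (0 : 'rV[R]_0)
  | n'.+1 => lebesgue_rV_step (lebesgue_rV n')
  end.

Lemma lebesgue_rV_box n (a b : 'rV[R]_n) : (forall i, a ord0 i <= b ord0 i) ->
  lebesgue_rV n [set x | forall i, a ord0 i <= x ord0 i <= b ord0 i] =
  (\prod_i (b ord0 i - a ord0 i))%:E.
Proof.
elim: n a b => [|n IH] a b ab.
  by rewrite /= diracE big_ord0 mem_set// => -[].
pose a' := (rV_uncons a).2; pose b' := (rV_uncons b).2.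
rewrite /= /lebesgue_rV_step /pushforward.
have -> : @rV_cons n @^-1` [set x | forall i, a ord0 i <= x ord0 i <= b ord0 i] =
    ([set` `[a ord0 ord0, b ord0 ord0]] : set (measurableTypeR R)) `*`
    [set x : 'rV[R]_n | forall i, a' ord0 i <= x ord0 i <= b' ord0 i].
  apply/seteqP; split=> [[x v] /= H|[x v] /= [H1 H2] i].
    split=> [|i]; first by have := H ord0; rewrite mxE unlift_none in_itv.
    by have := H (lift ord0 i); rewrite !mxE liftK.
  rewrite mxE; case: (unliftP ord0 i) => [j|] ->; rewrite ?in_itv// in H1 *.
  by have := H2 j; rewrite !mxE.
rewrite product_measure1E//; last first.
  rewrite (_ : [set _ | _] = \bigcap_(i in [set: 'I_n])
      (rV_coord i @^-1` [set` `[a' ord0 i, b' ord0 i]])); last first.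
    apply/seteqP; split=> x /= H i; first by move=> _; rewrite /= in_itv/=; exact: H.
    by have := H i I; rewrite /= in_itv.
  apply: fin_bigcap_measurable => // i _.
  by rewrite -[X in measurable X]setTI; exact: measurable_rV_coord.
rewrite IH => [|i]; last by rewrite !mxE.
rewrite big_ord_recl EFinM.
congr (_ * _)%E; last first.
  by congr EFin; apply: eq_bigr => i _; rewrite !mxE.
apply: etrans (lebesgue_measure_itv _) _; rewrite /= lte_fin.
have := ab ord0; rewrite le_eqVlt => /predU1P[->|->]; last by rewrite EFinB.
by rewrite ltxx subrr.
Qed.

End lebesgue_rV.

Section convex_bodies.
Variables (R : realType) (N : nat).
Implicit Types (K Omega : set 'rV[R]_N) (x y : 'rV[R]_N).

Definition dotv x y : R := \sum_(i < N) x ord0 i * y ord0 i.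

Definition convex_body K : Prop :=
  [/\ compact K, convex_set (K : set (convex_lmodType 'rV[R]_N)) & K^° !=set0].

Definition origin_symmetric K : Prop := forall x, K x -> K (- x).

Definition support_function K x : R := sup [set dotv x y | y in K].

Definition inradius K Omega : R :=
  sup [set t : R | exists2 x, Omega x & [set x + t *: y | y in K] `<=` Omega].

(* The norm of the library on 'rV[R]_N is the sup norm, hence dotv here. *)
Definition euclidean_ball : set 'rV[R]_N := [set x | dotv x x <= 1].

End convex_bodies.
Arguments euclidean_ball : clear implicits.

Section sobolev.
Variables (R : realType) (N : nat).
Implicit Types (O : set 'rV[R]_N) (u phi : 'rV[R]_N -> R).
Implicit Types (g : 'rV[R]_N -> 'rV[R]_N).

Local Notation mu := (@lebesgue_rV R N).

Definition partial (i : 'I_N) phi : 'rV[R]_N -> R :=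
  fun x => 'D_(delta_mx ord0 i) phi x.

Fixpoint class_C (k : nat) phi : Prop :=
  continuous phi /\
  match k with
  | 0 => True
  | k'.+1 => forall i : 'I_N,
      (forall x, derivable phi x (delta_mx ord0 i)) /\ class_C k' (partial i phi)
  end.

(* C_c^oo(O), each function being extended by 0 outside O *)
Definition test_function O phi : Prop :=
  (forall k, class_C k phi) /\
  exists2 C : set 'rV[R]_N, compact C & C `<=` O /\ forall x, ~ C x -> phi x = 0.

Definition L2 O u : Prop :=
  measurable_fun O u /\ (\int[mu]_(x in O) ((u x) ^+ 2)%:E < +oo)%E.

Definition L2_cvg O (u_ : nat -> 'rV[R]_N -> R) u : Prop :=
  (\int[mu]_(x in O) ((u_ n x - u x) ^+ 2)%:E)%E @[n --> \oo] --> 0%E.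

(* An element of W^{1,2}(O) is a function u together with a representative g of
   its weak gradient, which is determined by u up to null sets. *)
Definition W12 O u g : Prop :=
  L2 O u /\
  forall i : 'I_N, L2 O (fun x => g x ord0 i) /\
    forall phi, test_function O phi ->
      \int[mu]_(x in O) (u x * partial i phi x) =
      - \int[mu]_(x in O) (g x ord0 i * phi x).

(* W_0^{1,2}(O): the closure of C_c^oo(O) in W^{1,2}(O) *)
Definition W012 O u g : Prop :=
  W12 O u g /\
  exists phi_ : nat -> 'rV[R]_N -> R,
    [/\ forall n, test_function O (phi_ n),
        L2_cvg O phi_ u &
        forall i : 'I_N, L2_cvg O (fun n => partial i (phi_ n))
                                  (fun x => g x ord0 i)].

Definition ae_zero O u : Prop := {ae mu, forall x, O x -> u x = 0}.

(* W_0^{1,2} of the interior of Omega, minus 0 *)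
Definition admissible (Omega : set 'rV[R]_N) u g : Prop :=
  W012 (Omega^°) u g /\ ~ ae_zero (Omega^°) u.

(* The integrals over a convex body Omega are taken over its interior, where the
   elements of W_0^{1,2} live; its boundary is a null set. The maximum in T^K and
   the minimum in lambda_1^K are rendered by the supremum and the infimum. *)
Definition torsional_rigidity (K Omega : set 'rV[R]_N) : \bar R :=
  ereal_sup [set t | exists u g, admissible Omega u g /\
    t = ((\int[mu]_(x in Omega^°) u x) ^+ 2 /
         \int[mu]_(x in Omega^°) (support_function K (g x)) ^+ 2)%:E].

Definition principal_frequency (K Omega : set 'rV[R]_N) : \bar R :=
  ereal_inf [set t | exists u g, admissible Omega u g /\
    t = (\int[mu]_(x in Omega^°) (support_function K (g x)) ^+ 2 /
         \int[mu]_(x in Omega^°) (u x) ^+ 2)%:E].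

(* Weak formulation of: - Delta u = l u in the interior of Omega, u = 0 on the
   boundary, u <> 0. *)
Definition dirichlet_eigenvalue (Omega : set 'rV[R]_N) (l : R) : Prop :=
  exists u g, admissible Omega u g /\
    forall v h, W012 (Omega^°) v h ->
      \int[mu]_(x in Omega^°) dotv (g x) (h x) =
      l * \int[mu]_(x in Omega^°) (u x * v x).

Definition first_dirichlet_eigenvalue (Omega : set 'rV[R]_N) : \bar R :=
  ereal_inf [set l%:E | l in dirichlet_eigenvalue Omega].

End sobolev.

(* Main.v *)
(* Upper bound of T^K and lower bound of lambda^K: a polytope slightly smaller than
   Omega splits into the cells of points having the same nearest facet for the
   norm of unit ball K. If y in K attains h_K at the normal of the i-th facet, then
   |D_y u| <= h_K (grad u), and moving along y is moving straight towards the i-th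
   facet, at depth at most the inradius r. A translate of the cell by a small
   multiple of y leaves the cell across that facet only, so that a field V which is
   >= 0 on the cell and <= 0 beyond the facet has a nonpositive integral of D_y V.
   Choosing V = al + be u + ka u^2, with coefficients depending on the depth only,
   turns a one-dimensional calibration on (0, r) into the inequality on Omega: no
   divergence theorem on polytopes and no Fubini along lines is used.

   Lower bound of T^K and upper bound of lambda^K: the test functions are phi (J),
   J the gauge of an inner polytope, smoothed by replacing J with a log-sum-exp.
   Then h_K (grad u) <= |phi' (J)| / r approximately, and homogeneity of J alone
   gives the identity that replaces integration in polar coordinates: the integral
   of N q (J) + J q' (J) over {J <= 1} vanishes if q 1 = 0. For T^K the profile is
   (1 - s^2) / 2. For lambda^K it is the radial solution F (z s^2) of - Delta w = z w,
   z the first zero of F. That z <= l for every Dirichlet eigenvalue l of the ball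
   is Barta's argument: as long as F > 0 on [0, lam], testing with grad w / w for
   w = F (lam |x|^2) gives lam * int u^2 <= int |grad u|^2. *)

Require Import Defs.
From mathcomp Require Import all_boot all_order all_algebra.
From mathcomp Require Import all_classical all_reals all_analysis.
From mathcomp Require Import measurable_realfun ring lra zify.

Set Implicit Arguments.
Unset Strict Implicit.
Unset Printing Implicit Defensive.

Import Order.TTheory GRing.Theory Num.Theory.
Import numFieldNormedType.Exports.
Local Open Scope classical_set_scope.
Local Open Scope ring_scope.

(** * Lebesgue measure on R^N *)

Section borel_rV.
Variables (R : realType) (n : nat).
Implicit Types (A B U : set 'rV[R]_n) (f : 'rV[R]_n -> R).

(** The calibrations come from the extremals of the one-dimensional problem on (0, r), with value 0
    at the facet and slope 0 at depth r: sin (pi s / (2 r)) for the frequency, r s - s^2 / 2 for the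
    torsion. [V] is tuned so that the gap in the pointwise inequality is the square of an expression
    that vanishes on the extremal. Its leading coefficient then solves a Riccati equation and blows
    up at depth 0; this is harmless for test functions, which vanish up to a positive depth.
    [W012_approx] passes to the closure, using only that h_K is Lipschitz, and h_K is never
    differentiated: a fixed vector of K replaces it on each cell, its sublinearity suffices for the
    test functions. The constant 1 / (N (N + 2)) arises because the mean of J^2 over {J <= 1} is N /
    (N + 2). No eigenfunction of the ball is constructed: the existence of the zero z is itself
    derived from that of an eigenvalue, and without eigenvalues the infimum would be +oo. *)

Definition boxes : set (set 'rV[R]_n) :=
  [set A : set (matrix R 1 n) | exists a b : 'rV[R]_n,
    A = [set x | forall i, a ord0 i <= x ord0 i <= b ord0 i]].

Lemma measurable_box (a b : 'rV[R]_n) :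
  measurable [set x : 'rV[R]_n | forall i, a ord0 i <= x ord0 i <= b ord0 i].
Proof.
rewrite (_ : [set _ | _] = \bigcap_(i in [set: 'I_n])
    (@rV_coord R n i @^-1` [set` `[a ord0 i, b ord0 i]])); last first.
  apply/seteqP; split=> x /= H i; first by move=> _; rewrite /= in_itv/=; exact: H.
  by have := H i I; rewrite /= in_itv.
apply: fin_bigcap_measurable => // i _.
by rewrite -[X in measurable X]setTI; exact: measurable_rV_coord.
Qed.

Lemma coord_le_norm (z : 'rV[R]_n) j : `|z ord0 j| <= `|z|.
Proof.
rewrite [leRHS]/Num.norm /= mx_normrE.
exact: (le_bigmax _ (fun ij : 'I_1 * 'I_n => `|z ij.1 ij.2|) (ord0, j)).
Qed.

(** A half-space z_i >= x is the increasing union of the boxes with side [x, k] in direction i and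
    [- k, k] in the others. Boxes are stable under intersection and have known measure, which is
    what uniqueness of measures asks for. *)
Lemma measurable_rVE : @measurable _ 'rV[R]_n = <<s boxes >>.
Proof.
apply/seteqP; split; last first.
  apply: smallest_sub; first exact: sigma_algebra_measurable.
  by move=> _ [a [b ->]]; exact: measurable_box.
apply: smallest_sub; first exact: smallest_sigma_algebra.
rewrite -bigcup_seq => A [i _] [Y mY <-]; rewrite setTI.
have : @measurable_fun _ _ (g_sigma_algebraType boxes) (measurableTypeR R) setT
    (@rV_coord R n i).
  apply: (measurability _ (RGenCInfty.measurableE R)) => //.
  move=> _ [_ [x ->] <-]; rewrite setTI.
  rewrite (_ : _ @^-1` _ = \bigcup_(k in @setT nat)
      [set z : 'rV[R]_n | forall j, (if j == i then x else - k%:R) <= z ord0 j <= k%:R]).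
    apply: (@bigcupT_measurable _ (g_sigma_algebraType boxes)) => k.
    apply: sub_sigma_algebra.
    exists (\row_j (if j == i then x else - k%:R)), (\row_j k%:R).
    by apply/seteqP; split => z /= H j; have := H j; rewrite !mxE.
  apply/seteqP; split => z /=; rewrite /rV_coord in_itv/= andbT.
    move=> xz; exists (Num.bound `|z|) => // j.
    have zj : `|z ord0 j| <= `|z| by exact: coord_le_norm.
    have zk : `|z| < (Num.bound `|z|)%:R.
      exact: archi_boundP.
    have : `|z ord0 j| <= (Num.bound `|z|)%:R by apply/ltW/(le_lt_trans zj).
    by rewrite ler_norml; case: eqP => [->|_ //]; rewrite xz => /andP[].
  by move=> [k _] /(_ i); rewrite eqxx => /andP[].
by move=> /(_ measurableT Y mY); rewrite setTI.
Qed.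

Lemma norm_rV_le (z : 'rV[R]_n) (M : R) : 0 <= M ->
  (forall j, `|z ord0 j| <= M) -> `|z| <= M.
Proof.
move=> M0 H; rewrite /Num.norm /= mx_normrE; apply/bigmax_leP; split => // -[i j] _ /=.
by rewrite (ord1 i).
Qed.

(** The sigma-algebra comes from the coordinates, not from the topology, so an open set is written
    as the countable union of the cubes of rational centre and radius 1 / (k + 1) that it
    contains. *)
Lemma open_measurable_rV U : open U -> measurable U.
Proof.
move=> oU.
pose box (p : 'rV[rat]_n * nat) : set 'rV[R]_n :=
  [set x | forall i, (ratr (p.1 ord0 i) - p.2.+1%:R^-1 : R) <= x ord0 i
     <= ratr (p.1 ord0 i) + p.2.+1%:R^-1].
have mbox p : measurable (box p).
  have := measurable_box (\row_i (ratr (p.1 ord0 i) - p.2.+1%:R^-1))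
    (\row_i (ratr (p.1 ord0 i) + p.2.+1%:R^-1)).
  congr (measurable _); apply/seteqP; split => x /= H i; have := H i; by rewrite !mxE.
rewrite (_ : U = \bigcup_p (if `[< box p `<=` U >] then box p else set0)).
  apply: countable_bigcupT_measurable => // p.
  by case: ifP => _ //; exact: mbox.
apply/seteqP; split; last first.
  by move=> x [p _]; case: asboolP => // pU /pU.
move=> x Ux.
have /nbhs_ballP[e /= e0 eU] : nbhs x U by apply: open_nbhs_nbhs; split.
have e20 : 0 < e / 2 by rewrite divr_gt0.
have [k] := ltr_add_invr e20; rewrite add0r => ke.
have qP (i : 'I_n) : exists q : rat,
    x ord0 i - k.+1%:R^-1 < ratr q < x ord0 i + k.+1%:R^-1.
  have : x ord0 i - k.+1%:R^-1 < x ord0 i + k.+1%:R^-1.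
    by rewrite ltrD2l (@lt_trans _ _ 0)// ?oppr_lt0 invr_gt0.
  by move=> /rat_in_itvoo[q]; rewrite in_itv/= => ?; exists q.
have [q qE] := choice qP.
exists (\row_i q i, k) => //; rewrite asboolT.
  move=> i; rewrite !mxE /=; have /andP[h1 h2] := qE i; by rewrite lerBlDr (ltW h2) -lerBlDr (ltW h1).
move=> y /= yb; apply: eU; rewrite -ball_normE /=.
apply: (@le_lt_trans _ _ (2 * k.+1%:R^-1)); last by rewrite mulrC -ltr_pdivlMr.
apply: norm_rV_le => [|j]; first by rewrite mulr_ge0.
have := yb j; have := qE j; rewrite !mxE /= ler_norml.
move: (ratr _) (k.+1%:R^-1) => s c /andP[? ?] /andP[? ?].
by apply/andP; split; lra.
Qed.

Lemma closed_measurable_rV A : closed A -> measurable A.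
Proof. by rewrite -openC -[A in measurable A]setCK => /open_measurable_rV; exact: measurableC. Qed.

Lemma continuous_measurable_rV f : continuous f -> measurable_fun setT f.
Proof.
move=> cf; apply: (measurability _ (RGenOpens.measurableE R)) => //.
move=> _ [_ [a [b ->]] <-]; rewrite setTI.
by apply: open_measurable_rV; move/continuousP: cf; apply; exact: interval_open.
Qed.

End borel_rV.

Section lebesgue_rV_affine.
Variables (R : realType) (n : nat).
Local Notation mu := (@lebesgue_rV R n).
Implicit Types (A B : set 'rV[R]_n).

Definition cube (M : R) : set 'rV[R]_n := [set x | forall i, - M <= x ord0 i <= M].

Lemma cubeE M : cube M = [set x | forall i : 'I_n,
  (\row_(k < n) (- M)) ord0 i <= x ord0 i <= (\row_(k < n) M) ord0 i].
Proof. by apply/seteqP; split => x /= H i; have := H i; rewrite !mxE. Qed.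

Lemma measurable_cube M : measurable (cube M).
Proof. by rewrite cubeE; exact: measurable_box. Qed.

Lemma cube_lty (M : R) : (mu (cube M) < +oo)%E.
Proof.
wlog M0 : M / 0 <= M.
  move=> H; apply: (@le_lt_trans _ _ (mu (cube `|M|))); last exact: H.
  apply: le_measure; rewrite ?inE; [exact: measurable_cube..|move=> x xM i].
  by have := xM i; rewrite -!ler_norml => /le_trans; apply; exact: ler_norm.
rewrite cubeE (@lebesgue_rV_box R n) ?ltry// => i; rewrite !mxE; lra.
Qed.

Lemma cubeP (x : 'rV[R]_n) M : `|x| <= M -> cube M x.
Proof. by move=> xM i; rewrite -ler_norml (le_trans (coord_le_norm _ _)). Qed.

Lemma bounded_lebesgue_rV_lty A : measurable A -> bounded_set A -> (mu A < +oo)%E.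
Proof.
move=> mA [M [Mr HM]].
apply: (@le_lt_trans _ _ (mu (cube (M + 1)))); last exact: cube_lty.
apply: le_measure; rewrite ?inE//; first exact: measurable_cube.
by move=> x Ax; apply: cubeP; apply: HM => //; rewrite ltrDl.
Qed.

Lemma measurable_affine (v : 'rV[R]_n) (t : R) :
  measurable_fun setT (fun x : 'rV[R]_n => v + t *: x).
Proof.
apply: measurable_rV => i.
rewrite (_ : _ \o _ = fun x => v ord0 i + t * rV_coord i x); last first.
  by apply/funext => x; rewrite /rV_coord /= !mxE.
apply: measurable_funD => //; apply: measurable_funM => //.
exact: measurable_rV_coord.
Qed.

(** Both sides are measures in A; they agree on the boxes, and the cubes of radius k exhaust the
    space with finite measure. *)
Lemma lebesgue_rV_affine (v : 'rV[R]_n) (t : R) A : 0 < t -> measurable A ->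
  mu ((fun x => v + t *: x) @^-1` A) = ((t ^- n)%:E * mu A)%E.
Proof.
move=> t0 mA.
have tn0 : 0 <= t ^- n by rewrite invr_ge0 exprn_ge0// ltW.
pose m1 := measure_function_pushforward__canonical__measure_function_Measure
    mu (measurable_affine v t).
pose m2 : {measure set 'rV[R]_n -> \bar R} := mscale (NngNum tn0) mu.
change (m1 A = m2 A).
apply: (measure_unique (@boxes R n)
    (fun k => cube k%:R)) => //.
- exact: measurable_rVE.
- move=> _ _ [a1 [b1 ->]] [a2 [b2 ->]].
  exists (\row_i Num.max (a1 ord0 i) (a2 ord0 i)), (\row_i Num.min (b1 ord0 i) (b2 ord0 i)).
  apply/seteqP; split => [x /= [H1 H2] i|x /= H].
    by rewrite !mxE ge_max le_min; have /andP[-> ->] := H1 i; have /andP[-> ->] := H2 i.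
  by split => i; have := H i; rewrite !mxE ge_max le_min => /andP[/andP[? ?] /andP[? ?]];
    apply/andP; split.
- by move=> k; exists (\row_i (- k%:R)), (\row_i k%:R); rewrite cubeE.
- apply/seteqP; split => // z _; exists (Num.bound `|z|) => //.
  apply: cubeP; rewrite ltW//.
  exact: archi_boundP.
- move=> _ [a [b ->]]; pose box (c d : 'rV[R]_n) := [set x : 'rV[R]_n | forall i, c ord0 i <= x ord0 i <= d ord0 i].
  rewrite -/(box a b).
  change (mu ((fun x => v + t *: x)%R @^-1` (box a b)) = (t ^- n)%:E * mu (box a b))%E.
  have -> : (fun x => v + t *: x) @^-1` (box a b) =
      box (t^-1 *: (a - v)) (t^-1 *: (b - v)).
    apply/seteqP; split => x /= H i; have := H i; rewrite !mxE.
      by rewrite ler_pdivrMl// ler_pdivlMl// lerBlDl lerBrDl.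
    by rewrite ler_pdivrMl// ler_pdivlMl// lerBlDl lerBrDl.
  (* A box with reversed bounds is empty; the product formula of [lebesgue_rV_box] would be wrong
     for it. *)
  have [ab|] := pselect (forall i, a ord0 i <= b ord0 i); last first.
    move=> /existsNP[i /negP]; rewrite -ltNge => ba.
    have box0 (c d : 'rV[R]_n) : d ord0 i < c ord0 i ->
        box c d = set0.
      move=> dc; apply/seteqP; split => // x /= /(_ i) /andP[H1 H2].
      by have := le_trans H1 H2; rewrite leNgt dc.
    by rewrite !box0 ?measure0 ?mule0// !mxE ltr_pM2l ?invr_gt0// ltrD2r.
  rewrite !lebesgue_rV_box// => [|i]; last first.
    by rewrite !mxE ler_pM2l ?invr_gt0// lerD2r.
  rewrite -EFinM; congr EFin.
  have -> : t ^- n = \prod_(i < n) t^-1 by rewrite prodr_const card_ord exprVn.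
  rewrite -big_split /=; apply: eq_bigr => i _; rewrite !mxE; ring.
- move=> k; rewrite /m1 /= /pushforward.
  apply: bounded_lebesgue_rV_lty.
    by rewrite -[X in measurable X]setTI; apply: measurable_affine => //; exact: measurable_cube.
  exists (t^-1 * (`|v| + k%:R)); split=> [|M HM x /= H]; first exact: num_real.
  apply: (le_trans _ (ltW HM)); rewrite ler_pdivlMl//.
  rewrite -[X in X * _](gtr0_norm t0) -normrZ.
  have -> : t *: x = (v + t *: x) - v by rewrite addrAC subrr add0r.
  rewrite (le_trans (ler_normB _ _))// addrC lerD2l.
  by apply: norm_rV_le => // j; have := H j; rewrite -ler_norml.
Qed.

Lemma measurable_affine_preimage (v : 'rV[R]_n) (t : R) A : measurable A ->
  measurable ((fun x => v + t *: x) @^-1` A).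
Proof. by move=> mA; rewrite -[X in measurable X]setTI; exact: measurable_affine. Qed.

Lemma ge0_integral_affine (v : 'rV[R]_n) (t : R) A (f : 'rV[R]_n -> \bar R) :
  0 < t -> measurable A -> measurable_fun A f -> (forall x, A x -> 0 <= f x)%E ->
  (\int[mu]_(x in (fun x => v + t *: x)%R @^-1` A) f (v + t *: x)%R
   = (t ^- n)%:E * \int[mu]_(x in A) f x)%E.
Proof.
move=> t0 mA mf f0.
have tn0 : 0 <= t ^- n by rewrite invr_ge0 exprn_ge0// ltW.
rewrite -(@ge0_integral_pushforward _ _ _ _ _ _ (measurable_affine v t) mu A f)//; last first.
  by move=> x; rewrite inE; exact: f0.
rewrite (eq_measure_integral (mscale (NngNum tn0) mu)).
- by rewrite ge0_integral_mscale.
- exact: measurable_affine.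
- by move=> ? B mB _; exact: lebesgue_rV_affine.
Qed.

Lemma integral_affine (v : 'rV[R]_n) (t : R) A (f : 'rV[R]_n -> R) :
  0 < t -> measurable A -> mu.-integrable A (EFin \o f) ->
  (\int[mu]_(x in (fun x => v + t *: x)%R @^-1` A) f (v + t *: x)%R
   = t ^- n * \int[mu]_(x in A) f x)%R.
Proof.
move=> t0 mA If.
have tn0 : 0 <= t ^- n by rewrite invr_ge0 exprn_ge0// ltW.
have mEf := measurable_int _ If.
rewrite /Rintegral integralE [in RHS]integralE.
have e1 := @ge0_integral_affine v t A _ t0 mA (measurable_funepos mEf)
  (fun x _ => funepos_ge0 _ x).
have e2 := @ge0_integral_affine v t A _ t0 mA (measurable_funeneg mEf)
  (fun x _ => funeneg_ge0 _ x).
transitivity (fine ((t ^- n)%:E * \int[mu]_(x in A) (EFin \o f)^\+ x -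
    (t ^- n)%:E * \int[mu]_(x in A) (EFin \o f)^\- x)%E).
  by congr fine; congr (_ - _)%E; [rewrite -e1|rewrite -e2]; apply: eq_integral => x _; rewrite ?funeposE ?funenegE.
have f1 := integral_funepos_lt_pinfty mA If; have f2 := integral_funeneg_lt_pinfty mA If.
have g1 : (\int[mu]_(x in A) (EFin \o f)^\+ x)%E \is a fin_num.
  by rewrite ge0_fin_numE// integral_ge0// => x _; exact: funepos_ge0.
have g2 : (\int[mu]_(x in A) (EFin \o f)^\- x)%E \is a fin_num.
  by rewrite ge0_fin_numE// integral_ge0// => x _; exact: funeneg_ge0.
have key (c : R) (p q : \bar R) : p \is a fin_num -> q \is a fin_num ->
    fine (c%:E * p - c%:E * q)%E = c * fine (p - q)%E.
  by case: p => // p; case: q => // q _ _ /=; rewrite mulrBr.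
exact: key.
Qed.

End lebesgue_rV_affine.

(** * Integrals of bounded measurable functions *)

Section bounded_integrals.
Context d (T : measurableType d) (R : realType) (mu : {measure set T -> \bar R}).
Implicit Types (A : set T) (f g : T -> R).

(** A ring of functions, all integrable when A is measurable of finite measure ([bm_integrable]):
    integrability of the polynomial expressions below becomes a matter of syntax. *)
Definition bounded_measurable A f :=
  measurable_fun A f /\ exists M, forall x, A x -> `|f x| <= M.

Lemma bmD A f g : bounded_measurable A f -> bounded_measurable A g ->
  bounded_measurable A (fun x => f x + g x).
Proof.
move=> [mf [M HM]] [mg [L HL]]; split; first exact: measurable_funD.
exists (M + L) => x Ax; rewrite (le_trans (ler_normD _ _))// lerD//; [exact: HM|exact: HL].
Qed.

Lemma bmM A f g : bounded_measurable A f -> bounded_measurable A g ->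
  bounded_measurable A (fun x => f x * g x).
Proof.
move=> [mf [M HM]] [mg [L HL]]; split; first exact: measurable_funM.
exists (M * L) => x Ax; rewrite normrM ler_pM//; [exact: HM|exact: HL].
Qed.

Lemma bm_cst A (k : R) : bounded_measurable A (fun=> k).
Proof. by split => //; exists `|k|. Qed.

Lemma bmN A f : bounded_measurable A f -> bounded_measurable A (fun x => - f x).
Proof.
move=> [mf [M HM]]; split; first exact: measurableT_comp.
by exists M => x Ax; rewrite normrN; exact: HM.
Qed.

Lemma bmB A f g : bounded_measurable A f -> bounded_measurable A g ->
  bounded_measurable A (fun x => f x - g x).
Proof. by move=> bf bg; apply: bmD => //; exact: bmN. Qed.

Lemma bmX A f k : bounded_measurable A f -> bounded_measurable A (fun x => f x ^+ k).
Proof.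
move=> bf; elim: k => [|k IH]; first exact: bm_cst.
by under eq_fun do rewrite exprS; exact: bmM.
Qed.

Lemma bm_sum A (I : Type) (s : seq I) (F : I -> T -> R) :
  (forall i, bounded_measurable A (F i)) ->
  bounded_measurable A (fun x => \sum_(i <- s) F i x).
Proof.
move=> bF; elim: s => [|i s IH].
  by under eq_fun do rewrite big_nil; exact: bm_cst.
by under eq_fun do rewrite big_cons; exact: bmD.
Qed.

Lemma bmS A B f : measurable B -> A `<=` B -> bounded_measurable B f ->
  bounded_measurable A f.
Proof.
move=> mB AB [mf [M HM]]; split; first exact: measurable_funS mf.
by exists M => x /AB; exact: HM.
Qed.

Lemma bm_integrable A f : measurable A -> (mu A < +oo)%E ->
  bounded_measurable A f -> mu.-integrable A (EFin \o f).
Proof.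
move=> mA fA [mf [M HM]]; apply: measurable_bounded_integrable => //.
exists M; split => [|L ML x Ax]; first exact: num_real.
exact: le_trans (HM x Ax) (ltW ML).
Qed.

Lemma RintegralN A f : measurable A -> mu.-integrable A (EFin \o f) ->
  \int[mu]_(x in A) (- f x) = - \int[mu]_(x in A) f x.
Proof.
move=> mA If; rewrite -mulN1r -RintegralZl//.
by apply: eq_Rintegral => x _; rewrite mulN1r.
Qed.

Lemma bounded_cvg_Rintegral A (f_ : nat -> T -> R) f (M : R) :
  measurable A -> (mu A < +oo)%E -> (forall n, measurable_fun A (f_ n)) ->
  (forall x, A x -> (f_ n x @[n --> \oo]) --> f x) ->
  (forall n x, A x -> `|f_ n x| <= M) ->
  (\int[mu]_(x in A) f_ n x @[n --> \oo]) --> \int[mu]_(x in A) f x.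
Proof.
move=> mA fA mf_ f_f f_M.
have mf : measurable_fun A f by exact: measurable_fun_cvg f_f.
have iM : mu.-integrable A (EFin \o cst M).
  apply: bm_integrable => //; exact: bm_cst.
have [||||i0 _ H] := @dominated_convergence _ T R mu A mA (fun n => EFin \o f_ n)
  (EFin \o f) (EFin \o cst M) _ _ _ iM.
- by move=> n; apply/measurable_EFinP.
- exact/measurable_EFinP.
- by apply: aeW => x Ax; apply: cvg_EFin; [exact: nearW|exact: f_f].
- by apply: aeW => x n Ax; rewrite /= lee_fin f_M.
rewrite /Rintegral; apply: fine_cvg.
rewrite fineK; first exact: H.
exact: integrable_fin_num.
Qed.

End bounded_integrals.

(** Continuity fails only at 0, where the inverse takes the default value 0. Measurability on the
    whole line is wanted because the coefficients 1 / s and c cot (c s) are composed with depths of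
    any sign. *)
Lemma measurable_inv (R : realType) : measurable_fun [set: R] (fun x : R => x^-1).
Proof.
have m0 : measurable [set 0 : R] by exact: measurable_set1.
rewrite -(setUv [set 0 : R]); apply/(measurable_funU _ m0 (measurableC m0)).
split; first exact: measurable_fun_set1.
apply: open_continuous_measurable_fun; first exact/closed_openC/closed_eq.
by move=> x; rewrite inE => /eqP x0; exact: inv_continuous.
Qed.

(** Turns a derivative into a limit along a sequence, the form that dominated convergence and
    measurability of limits take. *)
Lemma cvg_difference_quotient (R : realType) (g : R -> R) (l : R) (h : nat -> R) :
  (forall m, h m != 0) -> h m @[m --> \oo] --> 0 -> is_derive (0 : R) 1 g l ->
  (h m)^-1 * (g (h m) - g 0) @[m --> \oo] --> l.
Proof.
move=> h0 hc D.
have := @ex_derive _ _ _ _ _ _ _ D; have := @derive_val _ _ _ _ _ _ _ D.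
move=> Dv Dx.
have := Dx; rewrite /derivable; rewrite -Dv => /cvg_ex[/= l' Hl].
rewrite /derive (cvg_lim _ Hl)//.
have hcvg : h m @[m --> \oo] --> (0 : R)^'.
  move=> P HP; have HP' : \forall m \near \oo, h m != 0 -> P (h m) := hc _ HP.
  change (\forall m \near \oo, P (h m)).
  by apply: filterS HP' => m; apply.
have := cvg_comp _ _ hcvg Hl.
apply: cvg_trans; apply: near_eq_cvg; apply: nearW => m /=.
by rewrite /= addr0 [_ *: 1]mulr1.
Qed.

(** * Integrals and translations *)

Section flow.
Variables (R : realType) (n : nat).
Local Notation mu := (@lebesgue_rV R n).
Implicit Types (A : set 'rV[R]_n) (V dV : 'rV[R]_n -> R) (y : 'rV[R]_n).

Lemma translate_Rintegral A y V : measurable A ->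
  mu.-integrable ((fun x => - y + 1 *: x) @^-1` A) (EFin \o V) ->
  \int[mu]_(x in A) V (x + y) = \int[mu]_(x in (fun x => - y + 1 *: x) @^-1` A) V x.
Proof.
move=> mA iV.
have mA' := @measurable_affine_preimage R n (- y) 1 A mA.
have := @integral_affine R n y 1 _ V ltr01 mA' iV.
rewrite expr1n invr1 mul1r => <-.
rewrite (_ : _ @^-1` (_ @^-1` A) = A).
  by apply: eq_Rintegral => x _; rewrite scale1r addrC.
by apply/seteqP; split => x /=; rewrite !scale1r addKr.
Qed.

(** The left side is the integral of V over A + y. The part over the intersection of A and A + y
    cancels; what remains is V >= 0 on A minus A + y against V <= 0 on A + y minus A. *)
Lemma Rintegral_shift_le A y V : measurable A -> (mu A < +oo)%E ->
  bounded_measurable A V -> measurable_fun setT V ->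
  (exists M, forall x, A x -> `|V (x + y)| <= M) ->
  (forall x, A x -> ~ A (x - y) -> 0 <= V x) ->
  (forall x, ~ A x -> A (x - y) -> V x <= 0) ->
  \int[mu]_(x in A) V (x + y) <= \int[mu]_(x in A) V x.
Proof.
move=> mA fA bV mV [M HM] Vp Vn.
pose A' := (fun x => - y + 1 *: x) @^-1` A.
have A'E x : A' x = A (x - y) by rewrite /A' /= scale1r addrC.
have mA' : measurable A' by exact: measurable_affine_preimage.
have fA' : (mu A' < +oo)%E.
  by rewrite /A' (lebesgue_rV_affine _ ltr01 mA) expr1n invr1 mul1e.
have bV' : bounded_measurable A' V.
  split; first exact: measurable_funTS.
  by exists M => x; rewrite A'E => /HM; rewrite subrK.
have mI : measurable (A `&` A') by exact: measurableI.
have mD : measurable (A `\` A') by exact: measurableD.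
have mD' : measurable (A' `\` A) by exact: measurableD.
have split_int B C : measurable B -> measurable C -> (mu B < +oo)%E ->
    bounded_measurable B V ->
    \int[mu]_(x in B) V x = \int[mu]_(x in B `&` C) V x + \int[mu]_(x in B `\` C) V x.
  move=> mB mC fB bB; rewrite -[in LHS](setUIDK B C) Rintegral_setU//.
  - exact: measurableI.
  - exact: measurableD.
  - by rewrite setUIDK; exact: bm_integrable.
  - by apply/disj_setPS => x [[_ Cx] [_ nCx]]; exact: nCx.
rewrite translate_Rintegral//; last exact: bm_integrable.
rewrite -/A' (split_int A' A)// (split_int A A')// setIC lerD2l.
apply: (@le_trans _ _ 0).
  rewrite -oppr_ge0 -RintegralN//; last first.
    apply: bm_integrable => //; last exact: bmS bV'.
    by apply: le_lt_trans fA'; apply: le_measure; rewrite ?inE.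
  by apply: Rintegral_ge0 => x [A'x nAx]; rewrite oppr_ge0 Vn// -A'E.
by apply: Rintegral_ge0 => x [Ax nA'x]; rewrite Vp// -A'E.
Qed.

(** By [Rintegral_shift_le] the difference quotients along y have nonpositive integrals; the mean
    value theorem bounds them by M, and dominated convergence yields dV. Differentiability and
    bounds are asked only on the segments of length h0 that leave A, since V may be singular
    elsewhere. *)
Lemma flow_Rintegral_le0 A y (h0 M : R) V dV : measurable A -> (mu A < +oo)%E ->
  0 < h0 -> measurable_fun setT V ->
  (forall x (t : R), A x -> 0 <= t <= h0 -> `|V (x + t *: y)| <= M) ->
  (forall x (t : R), A x -> 0 <= t <= h0 -> `|dV (x + t *: y)| <= M) ->
  (forall x (t : R), A x -> 0 <= t <= h0 -> is_derive t 1 (fun s : R => V (x + s *: y)) (dV (x + t *: y))) ->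
  (forall x (t : R), A x -> 0 < t <= h0 -> ~ A (x - t *: y) -> 0 <= V x) ->
  (forall x (t : R), ~ A x -> 0 < t <= h0 -> A (x - t *: y) -> V x <= 0) ->
  mu.-integrable A (EFin \o dV) /\ \int[mu]_(x in A) dV x <= 0.
Proof.
move=> mA fA h00 mV VM dVM dVE Vp Vn.
have V0M x : A x -> `|V x| <= M.
  by move=> Ax; have := VM x 0 Ax; rewrite scale0r addr0 lexx ltW//; exact.
pose h m : R := h0 / m.+1%:R.
have h_gt0 m : 0 < h m by rewrite divr_gt0.
have h_le m : h m <= h0 by rewrite ler_pdivrMr ?ltr0n// ler_peMr ?ler1n ?(ltW h00).
have h0n m : 0 < h m <= h0 by rewrite h_gt0 h_le.
have mVs m : measurable_fun setT (fun x : 'rV[R]_n => V (x + h m *: y)).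
  rewrite (_ : (fun x => _) = V \o (fun x => (h m *: y) + 1 *: x)); last first.
    by apply/funext => x /=; rewrite scale1r addrC.
  by apply: measurableT_comp => //; exact: measurable_affine.
have hc : h m @[m --> \oo] --> (0 : R).
  have := @cvgM _ _ _ _ (cst h0) harmonic h0 0 (cvg_cst _) (@cvg_harmonic R).
  by rewrite mulr0; exact.
pose q m (x : 'rV[R]_n) := (h m)^-1 * (V (x + h m *: y) - V x).
have mq m : measurable_fun A (q m).
  apply: measurable_funTS; apply: measurable_funM => //.
  exact: measurable_funB.
have qM m x : A x -> `|q m x| <= M.
  move=> Ax.
  have [|||c] := @MVT_segment R (fun s : R => V (x + s *: y)) (fun t : R => dV (x + t *: y)) 0 (h m).
  - exact: ltW.
  - move=> t; rewrite in_itv/= => /andP[t0 th]; apply: dVE => //.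
    by rewrite ltW//= (le_trans (ltW th)).
  - apply: derivable_within_continuous => t; rewrite in_itv/= => /andP[t0 th].
    by apply: (@ex_derive _ _ _ _ _ _ _ (dVE x t Ax _)); rewrite t0 (le_trans th).
  rewrite in_itv/= => /andP[c0 ch]; rewrite scale0r addr0 subr0 => E.
  rewrite /q E mulrC mulfK ?gt_eqF//; apply: dVM => //.
  by rewrite c0 (le_trans ch).
have qd x : A x -> q m x @[m --> \oo] --> dV x.
  move=> Ax; have := dVE x 0 Ax; rewrite lexx ltW// => /(_ isT) D.
  rewrite scale0r addr0 in D.
  have := cvg_difference_quotient (fun m => lt0r_neq0 (h_gt0 m)) hc D.
  by rewrite scale0r addr0.
split.
  apply: bm_integrable => //; split; first exact: measurable_fun_cvg mq qd.
  by exists M => x Ax; have := dVM x 0 Ax; rewrite scale0r addr0 lexx ltW//; exact.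
have := bounded_cvg_Rintegral mA fA mq qd qM.
move=> /cvgr_to_le; apply; apply: nearW => m; rewrite /q.
have bV : bounded_measurable A V by split; [exact: measurable_funTS|exists M].
have bVs : bounded_measurable A (fun x : 'rV[R]_n => V (x + h m *: y)).
  split; first exact: measurable_funTS.
  by exists M => x Ax; apply: VM => //; rewrite ltW//= h_le.
rewrite RintegralZl//; last by apply: bm_integrable => //; exact: bmB.
rewrite RintegralB//; [|exact: bm_integrable..].
rewrite pmulr_rle0 ?invr_gt0// subr_le0; apply: Rintegral_shift_le => //.
- by exists M => x Ax; apply: VM => //; rewrite ltW//= h_le.
- by move=> x Ax; apply: Vp.
- by move=> x Ax; apply: Vn.
Qed.
End flow.

(** * Functions of class C^k and test functions *)

Section lines.
Variables (R : realType) (V : normedModType R).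
Implicit Types (u : V -> R) (x v : V).

(** Gives directional derivatives access to the one-variable chain rule and mean value theorem. *)
Lemma is_derive_lineP u x v (l : R) :
  is_derive x v u l <-> is_derive (0 : R) 1 (fun h => u (h *: v + x)) l.
Proof.
have E : (fun h : R => h^-1 *: (((fun h => u (h *: v + x)) \o shift 0) (h *: 1)
    - u (0 *: v + x))) = (fun h => h^-1 *: ((u \o shift x) (h *: v) - u x)).
  by apply/funext => h /=; rewrite addr0 [_ *: 1]mulr1 scale0r add0r.
by split=> -[D1 D2]; constructor; rewrite /derivable /derive ?E// in D1 D2 *;
  rewrite -E.
Qed.

Lemma is_derive_line u x v (t l : R) : is_derive (x + t *: v) v u l ->
  is_derive t 1 (fun s : R => u (x + s *: v)) l.
Proof.
move=> /is_derive_lineP D.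
rewrite (_ : (fun s => _) = (fun h => u (h *: v + (x + t *: v))) \o (fun s => s - t)).
  have D' : is_derive (t - t) (1:R) (fun h => u (h *: v + (x + t *: v))) l by rewrite subrr.
  have := @is_derive1_comp R _ (shift (- t)) t l 1 D' (is_derive_shift _ _ _).
  by rewrite mulr1.
apply/funext => s /=; congr u.
by rewrite addrCA -scalerDl subrK.
Qed.

Lemma is_derive_compr (f : R -> R) u x v (df du : R) :
  is_derive x v u du -> is_derive (u x) 1 f df ->
  is_derive x v (f \o u) (df * du).
Proof.
move=> /is_derive_lineP Du Df; apply/is_derive_lineP.
have Df' : is_derive (u (0 *: v + x)) (1:R) f df by rewrite scale0r add0r.
exact: (@is_derive1_comp _ f (fun h : R => u (h *: v + x)) 0 _ _ Df' Du).
Qed.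

Lemma is_derive_scalev u x v (c l : R) :
  is_derive x v u l -> is_derive x (c *: v) u (c * l).
Proof.
move=> /is_derive_lineP D; apply/is_derive_lineP.
rewrite (_ : (fun s => _) = (fun h => u (h *: v + x)) \o (fun s => s * c)).
  have D' : is_derive (0 * c) (1:R) (fun h => u (h *: v + x)) l by rewrite mul0r.
  have Dc : is_derive (0 : R) (1:R) (fun s : R => s * c) c.
    apply: (is_derive_eq (@is_deriveM _ _ id (cst c) 0 1 1 0 _ _)).
    by rewrite /= !scale0r add0r [_ *: 1]mulr1.
  by rewrite mulrC; exact: (@is_derive1_comp _ _ (fun s => s * c) 0 _ _ D' Dc).
by apply/funext => s /=; rewrite scalerA.
Qed.

(** The increment along h (v + w) is split at x + h v: its first part gives D_v u, and its second
    part is h times D_w u at an intermediate point, which converges by continuity of D_w u. *)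
Lemma derivable_addv u v w : (forall x, derivable u x v) -> (forall x, derivable u x w) ->
  continuous (fun x => 'D_w u x) ->
  forall x, is_derive x (v + w) u ('D_v u x + 'D_w u x).
Proof.
move=> dv dw cw x.
suff H : h^-1 *: (u (h *: (v + w) + x) - u x) @[h --> 0^'] --> 'D_v u x + 'D_w u x.
  by constructor; [apply/cvg_ex; eexists; exact: H|exact: cvg_lim H].
have H1 : h^-1 *: (u (h *: v + x) - u x) @[h --> 0^'] --> 'D_v u x by exact: dv.
have H2 : h^-1 *: (u (h *: (v + w) + x) - u (h *: v + x)) @[h --> (0:R)^'] --> 'D_w u x.
  apply/cvgrPdist_le => e e0.
  have /cvgrPdist_le/(_ e e0)/nbhs_ballP[d /= d0 dP] := cw x.
  (* The intermediate point is within |h| (|v| + |w|) of x; the 1 keeps the divisor positive when v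
     = w = 0. *)
  have M0 : 0 < `|v| + `|w| + 1 by rewrite ltr_wpDl// addr_ge0.
  near=> h.
  have h0 : h != 0 by near: h; exact: nbhs_dnbhs_neq.
  have hd : `|h| < d / (`|v| + `|w| + 1).
    near: h; apply: dnbhs0_lt; exact: divr_gt0.
  pose g s := u ((h *: v + x) + s *: w).
  have Dg (s : R) : is_derive s 1 g ('D_w u ((h *: v + x) + s *: w)).
    by apply: is_derive_line; exact/derivableP.
  have [c ch E] : exists2 c : R, `|c| <= `|h| & g h - g 0 = 'D_w u ((h *: v + x) + c *: w) * h.
    have cg (a b : R) : {within `[a, b], continuous g}.
      apply: derivable_within_continuous => s _; exact: (@ex_derive _ _ _ _ _ _ _ (Dg s)).
    have [h_lt0|h_gt0|h00] := ltgtP h 0; last by rewrite h00 eqxx in h0.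
      have [c] := @MVT _ g _ h 0 h_lt0 (fun s _ => Dg s) (cg _ _).
      rewrite in_itv/= => /andP[c1 c2] E; exists c.
        by rewrite !ltr0_norm// lerN2 ltW.
      by rewrite -opprB E sub0r mulrN opprK.
    have [c] := @MVT _ g _ 0 h h_gt0 (fun s _ => Dg s) (cg _ _).
    rewrite in_itv/= => /andP[c1 c2] E; exists c.
      by rewrite !gtr0_norm// ltW.
    by rewrite E subr0.
  have -> : u (h *: (v + w) + x) - u (h *: v + x) = g h - g 0.
    by rewrite /g scale0r addr0 scalerDr addrAC.
  rewrite E [_ *: _]mulrC mulfK//; apply: dP; rewrite -ball_normE /=.
  rewrite (addrAC (h *: v)) opprD addrCA subrr addr0 normrN.
  rewrite (le_lt_trans (ler_normD _ _))// !normrZ.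
  rewrite (@le_lt_trans _ _ (`|h| * (`|v| + `|w| + 1)))//.
    rewrite !mulrDr mulr1 -addrA lerD2l (le_trans (ler_wpM2r _ ch))//.
    by rewrite lerDl.
  by rewrite -ltr_pdivlMr.
rewrite [_ + 'D_w u x]addrC; apply: cvg_trans (cvgD H2 H1); apply: near_eq_cvg.
by apply: nearW => h; rewrite fctE -scalerDr addrA subrK.
Unshelve. all: by end_near. Qed.

End lines.

Section class_C_closure.
Variables (R : realType) (N : nat).
Implicit Types (u v : 'rV[R]_N -> R).
Local Notation e_ i := (delta_mx ord0 i : 'rV[R]_N).

Lemma class_C_continuous k u : class_C k u -> continuous u.
Proof. by case: k => [|k] []. Qed.

Lemma class_C_derivable k u i x : class_C k.+1 u -> derivable u x (e_ i).
Proof. by move=> [_ /(_ i)[]]. Qed.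

Lemma class_C_partial k u i : class_C k.+1 u -> class_C k (partial i u).
Proof. by move=> [_ /(_ i)[]]. Qed.

Lemma class_CS k u : class_C k.+1 u -> class_C k u.
Proof.
elim: k u => [u [] //|k IH u [cu H]]; split => // i.
by split=> [x|]; [case: (H i)|apply: IH; case: (H i)].
Qed.

Lemma eq_partial u v i : (forall x, derivable u x (e_ i)) ->
  (forall x, 'D_(e_ i) u x = v x) -> partial i u = v.
Proof. by move=> du uv; apply/funext => x; rewrite /partial. Qed.

Lemma class_C_cst k (c : R) : class_C k (fun _ : 'rV[R]_N => c).
Proof.
elim: k c => [|k IH] c; split => //; try exact: cst_continuous.
move=> i; split => [x|]; first exact: derivable_cst.
by rewrite (@eq_partial _ (fun=> 0)) => // x; exact: derive_cst.
Qed.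

Lemma class_CD k u v : class_C k u -> class_C k v -> class_C k (u + v).
Proof.
elim: k u v => [|k IH] u v [cu Hu] [cv Hv]; split => //;
  try by move=> x; exact: cvgD (cu x) (cv x).
move=> i; have [du Cu] := Hu i; have [dv Cv] := Hv i; split => [x|].
  exact: derivableD.
rewrite (@eq_partial _ (partial i u + partial i v)); first exact: IH.
- by move=> x; exact: derivableD.
- by move=> x; rewrite deriveD.
Qed.

Lemma class_CM k u v : class_C k u -> class_C k v -> class_C k (u * v).
Proof.
elim: k u v => [|k IH] u v; first by move=> [cu _] [cv _]; split => // x; exact: cvgM (cu x) (cv x).
move=> Cu Cv; have Cu' := class_CS Cu; have Cv' := class_CS Cv.
move: Cu Cv => [cu Hu] [cv Hv]; split => [x|i]; first exact: cvgM (cu x) (cv x).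
have [du Cdu] := Hu i; have [dv Cdv] := Hv i; split => [x|].
  exact: derivableM.
rewrite (@eq_partial _ (u * partial i v + v * partial i u)); first by apply: class_CD; exact: IH.
- by move=> x; exact: derivableM.
- by move=> x; rewrite deriveM.
Qed.

Lemma class_C_sum k (I : Type) (s : seq I) (F : I -> 'rV[R]_N -> R) :
  (forall i, class_C k (F i)) -> class_C k (fun x : 'rV[R]_N => \sum_(i <- s) F i x).
Proof.
move=> CF; elim: s => [|i s IH].
  rewrite (_ : (fun _ => _) = fun=> 0); first exact: class_C_cst.
  by apply/funext => x; rewrite big_nil.
rewrite (_ : (fun _ => _) = F i + (fun x : 'rV[R]_N => \sum_(i <- s) F i x)); first exact: class_CD.
by apply/funext => x; rewrite big_cons.
Qed.

Lemma is_derive_coord (j : 'I_N) (x v : 'rV[R]_N) :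
  is_derive x v (fun x : 'rV[R]_N => x ord0 j) (v ord0 j).
Proof.
apply/is_derive_lineP; rewrite (_ : (fun h => _) = (fun h : R => h * v ord0 j + x ord0 j)).
  have := is_deriveD (is_deriveM (is_derive_id (0:R) 1) (is_derive_cst (v ord0 j) (0:R) (1:R)))
     (is_derive_cst (x ord0 j) (0:R) (1:R)).
  by rewrite /= addr0 scale0r add0r [_ *: 1]mulr1.
by apply/funext => h; rewrite !mxE.
Qed.

Lemma class_C_coord k (j : 'I_N) : class_C k (fun x : 'rV[R]_N => x ord0 j).
Proof.
have D i x := is_derive_coord j x (e_ i).
case: k => [|k]; split => //; try exact: coord_continuous.
move=> i; split => [x|]; first exact: (@ex_derive _ _ _ _ _ _ _ (D i x)).
rewrite (@eq_partial _ (fun=> (e_ i) ord0 j)); first exact: class_C_cst.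
- by move=> x; exact: (@ex_derive _ _ _ _ _ _ _ (D i x)).
- by move=> x; exact: (@derive_val _ _ _ _ _ _ _ (D i x)).
Qed.

Lemma class_C_dot k (a c : 'rV[R]_N) : class_C k (fun x : 'rV[R]_N => dotv a (x - c)).
Proof.
rewrite (_ : (fun x => _) =
    (fun x => \sum_(i <- index_enum 'I_N) ((fun=> a ord0 i) * ((fun x => x ord0 i) + (fun=> - c ord0 i)) : 'rV[R]_N -> R) x)).
  apply: class_C_sum => i; apply: class_CM; first exact: class_C_cst.
  apply: class_CD; [exact: class_C_coord|exact: class_C_cst].
by apply/funext => x; apply: eq_bigr => i _; rewrite !mxE.
Qed.

(** The class C^k on D, in the form consumed by the chain rule [class_C_comp]. The domain is there
    for [ln] and the negative powers, smooth on the positive half-line only. *)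
Fixpoint diff_on (D : set R) (k : nat) (f : R -> R) : Prop :=
  match k with
  | 0 => forall z, D z -> {for z, continuous f}
  | k'.+1 => (forall z, D z -> derivable f z 1) /\ diff_on D k' (derive1 f)
  end.

Lemma derivable_continuous (f : R -> R) (z : R) : derivable f z 1 -> {for z, continuous f}.
Proof. by move=> /derivable1_diffP/differentiable_continuous. Qed.

Lemma diff_on_continuous (D : set R) k (f : R -> R) z : diff_on D k f -> D z -> {for z, continuous f}.
Proof.
case: k => [H|k [df _]] Dz; first exact: H.
exact/derivable_continuous/df.
Qed.

Lemma class_C_comp (D : set R) k (f : R -> R) u : class_C k u -> (forall x, D (u x)) -> diff_on D k f ->
  class_C k (f \o u).
Proof.
elim: k f u => [|k IH] f u Cu Du Cf.
  split => // x; apply: continuous_comp; first exact: (class_C_continuous Cu).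
  exact: Cf.
split => [x|i].
  apply: continuous_comp; first exact: (class_C_continuous Cu).
  exact: diff_on_continuous Cf (Du x).
have Dfu x : is_derive x (e_ i) (f \o u) (derive1 f (u x) * partial i u x).
  apply: is_derive_compr; first by apply: derivableP; exact: class_C_derivable Cu.
  rewrite derive1E; apply/derivableP. case: Cf => dfD _. exact: dfD.
split => [x|]; first exact: (@ex_derive _ _ _ _ _ _ _ (Dfu x)).
rewrite (@eq_partial _ ((derive1 f \o u) * partial i u)).
- apply: class_CM; last exact: class_C_partial.
  by apply: IH => //; [exact: class_CS|case: Cf].
- by move=> x; exact: (@ex_derive _ _ _ _ _ _ _ (Dfu x)).
- by move=> x; exact: (@derive_val _ _ _ _ _ _ _ (Dfu x)).
Qed.

Definition grad u x : 'rV[R]_N := \row_i partial i u x.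

(** Induction over the decomposition of y in the standard basis, each sum being handled by
    [derivable_addv]. The property [P] quantifies over all base points because that lemma needs the
    derivatives everywhere. *)
Lemma class_C1_is_derive u (y x : 'rV[R]_N) : class_C 1 u ->
  is_derive x y u (dotv y (grad u x)).
Proof.
move=> Cu.
pose P (z : 'rV[R]_N) := forall x, is_derive x z u (dotv z (grad u x)).
have cP z : continuous (fun x => dotv z (grad u x)).
  rewrite (_ : (fun _ => _) = fun x =>
      \sum_(i <- index_enum 'I_N) ((fun=> z ord0 i) * partial i u : 'rV[R]_N -> R) x).
    apply: (@class_C_continuous 0); apply: class_C_sum => i.
    by apply: class_CM; [exact: class_C_cst|exact: class_C_partial].
  by apply/funext => w; apply: eq_bigr => i _; rewrite mxE.
suff : P y by exact.
rewrite (row_sum_delta y); apply: (big_ind P).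
- move=> z; rewrite (_ : dotv _ _ = 0); first exact: is_derive0.
  by rewrite /dotv big1// => i _; rewrite mxE mul0r.
- move=> z w Pz Pw a.
  have dz b := @ex_derive _ _ _ _ _ _ _ (Pz b).
  have dw b := @ex_derive _ _ _ _ _ _ _ (Pw b).
  have ez b := @derive_val _ _ _ _ _ _ _ (Pz b).
  have ew b := @derive_val _ _ _ _ _ _ _ (Pw b).
  have := @derivable_addv R _ u z w dz dw _ a; rewrite ez ew.
  rewrite (_ : dotv (z + w) _ = dotv z (grad u a) + dotv w (grad u a)); last first.
    by rewrite /dotv -big_split; apply: eq_bigr => i _; rewrite !mxE mulrDl.
  apply; rewrite (_ : (fun x => _) = fun x => dotv w (grad u x)); first exact: cP.
  by apply/funext.
- move=> i _ z.
  rewrite (_ : dotv _ _ = y ord0 i * partial i u z).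
    by apply: is_derive_scalev; apply: derivableP; exact: class_C_derivable Cu.
  rewrite /dotv (bigD1 i)//= big1 ?addr0 => [|j ji]; rewrite !mxE ?eqxx /=; first by rewrite mulr1.
  by rewrite (negbTE ji) mulr0 mul0r.
Qed.

End class_C_closure.

Section test_functions.
Variables (R : realType) (N : nat).
Local Notation mu := (@lebesgue_rV R N).
Implicit Types (O C A : set 'rV[R]_N) (V dV u v phi : 'rV[R]_N -> R) (x y : 'rV[R]_N).

Lemma compact_closed_rV C : compact C -> closed C.
Proof. by apply: compact_closed; exact: norm_hausdorff. Qed.

Lemma test_function_continuous O u : test_function O u -> continuous u.
Proof. by move=> [/(_ 0%N) []]. Qed.

Lemma test_function_bounded O u : test_function O u ->
  exists M, forall x, `|u x| <= M.
Proof.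
move=> tu; have cu := test_function_continuous tu; have [_ [C cC [_ uC]]] := tu.
have /compact_bounded[M [Mr HM]] : compact (u @` C).
  by apply: continuous_compact => //; exact: continuous_subspaceT.
exists (Num.max 0 (M + 1)) => x; rewrite le_max.
have [Cx|nCx] := pselect (C x); last by rewrite uC// normr0 lexx.
by apply/orP; right; apply: HM; [rewrite ltrDl|exists x].
Qed.

Lemma is_derive_zero C u x y : closed C -> (forall z, ~ C z -> u z = 0) -> ~ C x ->
  is_derive x y u 0.
Proof.
move=> cC uC nCx.
have E : \near x, cst 0 x = u x.
  have : nbhs x (~` C) by apply: open_nbhs_nbhs; split => //; exact: closed_openC.
  by apply: filterS => z /uC.
exact: near_eq_is_derive E (is_derive_cst _ _ _).
Qed.

Lemma partial_zero C u x i : closed C -> (forall z, ~ C z -> u z = 0) -> ~ C x ->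
  partial i u x = 0.
Proof.
move=> cC uC nCx; have D := is_derive_zero (delta_mx ord0 i) cC uC nCx.
exact: (@derive_val _ _ _ _ _ _ _ D).
Qed.

Lemma test_function_partial O u i : test_function O u -> test_function O (partial i u).
Proof.
move=> [Cu [C cC [CO uC]]]; split; first by move=> k; exact: class_C_partial (Cu k.+1).
exists C => //; split => // x nCx; apply: partial_zero uC nCx.
exact: compact_closed_rV.
Qed.

Lemma test_functionM O u v : (forall k, class_C k u) -> test_function O v ->
  test_function O (u * v).
Proof.
move=> Cu [Cv [C cC [CO vC]]]; split; first by move=> k; exact: class_CM.
by exists C => //; split => // x /vC; rewrite fctE => ->; rewrite mulr0.
Qed.

Lemma test_function_bm O u A : test_function O u -> bounded_measurable A u.
Proof.
move=> tu; split; last by have [M HM] := test_function_bounded tu; exists M.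
by apply: measurable_funTS; apply: continuous_measurable_rV; exact: test_function_continuous tu.
Qed.

Lemma Rintegral_support C O (f : 'rV[R]_N -> R) : C `<=` O -> (forall x, ~ C x -> f x = 0) ->
  \int[mu]_(x in O) f x = \int[mu]_x f x.
Proof.
move=> CO fC; rewrite Rintegral_mkcond; congr Rintegral; apply/funext => x.
rewrite /patch; case: ifPn => //; rewrite notin_setE => nOx.
by rewrite fC// => /CO.
Qed.

Lemma measurable_is_derive V dV y : measurable_fun setT V ->
  (forall x, is_derive x y V (dV x)) -> measurable_fun setT dV.
Proof.
move=> mV D; pose h m : R := m.+1%:R^-1.
apply: (@measurable_fun_cvg _ _ _ setT
    (fun m x => (h m)^-1 * (V (h m *: y + 1 *: x) - V x))).
  move=> m; apply: measurable_funM => //; apply: measurable_funB => //.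
  apply: (measurableT_comp mV); exact: measurable_affine.
move=> x _; have /is_derive_lineP Dx := D x.
have h0 m : h m != 0 by rewrite invr_eq0.
have := cvg_difference_quotient h0 (@cvg_harmonic R) Dx.
by rewrite scale0r add0r scale1r.
Qed.

(** [flow_Rintegral_le0] is applied to V and to - V on a cube that contains C with a margin of at
    least |y|: no segment of flow time at most 1 joins C to the outside, so both sign conditions
    hold with V = 0. *)
Lemma divergence0 C V dV y M : bounded_set C -> measurable_fun setT V ->
  (forall x, is_derive x y V (dV x)) ->
  (forall x, `|V x| <= M) -> (forall x, `|dV x| <= M) ->
  (forall x, ~ C x -> V x = 0) -> (forall x, ~ C x -> dV x = 0) ->
  \int[mu]_x dV x = 0.
Proof.
move=> [L [Lr CL]] mV dVE VM dVM VC dVC.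
pose A := @cube R N (L + 2 + `|y|).
have CA : C `<=` A.
  move=> x Cx; apply: cubeP; rewrite (le_trans (CL (L + 1) _ x Cx))//; first by rewrite ltrDl.
  by rewrite -addrA lerD2l ler_wpDr// ler1n.
have mA : measurable A by exact: measurable_cube.
have fA : (mu A < +oo)%E by exact: cube_lty.
have bA x t : 0 < t <= 1 -> A x -> ~ A (x - t *: y) -> ~ C x.
  move=> /andP[t0 t1] Ax nA Cx; apply: nA; apply: cubeP.
  rewrite (le_trans (ler_normB _ _))// lerD//.
    rewrite (le_trans (CL (L + 1) _ x Cx))//; first by rewrite ltrDl.
    by rewrite lerD2l ler1n.
  by rewrite normrZ gtr0_norm// ler_piMl.
rewrite -(Rintegral_support CA dVC).
have key (W dW : 'rV[R]_N -> R) : measurable_fun setT W -> (forall x, is_derive x y W (dW x)) ->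
  (forall x, `|W x| <= M) -> (forall x, `|dW x| <= M) -> (forall x, ~ C x -> W x = 0) ->
  \int[mu]_(x in A) dW x <= 0.
  move=> mW dWE WM dWM WC; apply: (proj2 (@flow_Rintegral_le0 R N A y 1 M W dW mA fA ltr01 mW _ _ _ _ _)) => //.
  - by move=> x t _ _; apply: is_derive_line.
  - by move=> x t Ax t1 nA; rewrite WC//; exact: bA t1 Ax nA.
  - by move=> x t nAx _ _; rewrite WC// => /CA.
have iA : mu.-integrable A (EFin \o dV).
  apply: bm_integrable => //; split; last by exists M.
  apply: measurable_funTS.
  exact: measurable_is_derive mV dVE.
apply/eqP; rewrite eq_le key//=; rewrite -oppr_le0 -RintegralN//.
apply: (key (fun x => - V x)) => //.
- exact: measurableT_comp.
- by move=> x; rewrite normrN.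
- by move=> x; rewrite normrN.
- by move=> x /VC ->; rewrite oppr0.
Qed.

Lemma test_divergence0 O u y : test_function O u -> \int[mu]_x dotv y (grad u x) = 0.
Proof.
move=> tu; have [Cu [C cC [CO uC]]] := tu.
have [M HM] := test_function_bounded tu.
have cCl := compact_closed_rV cC.
have tg i := test_function_partial i tu.
have [L HL] := choice (fun i => test_function_bounded (tg i)).
pose K := M + \sum_i `|y ord0 i| * L i.
have M0 : 0 <= M by exact: le_trans (HM 0).
have L0 i : 0 <= `|y ord0 i| * L i by rewrite mulr_ge0// (le_trans _ (HL i 0)).
apply: (@divergence0 C u _ y K).
- exact: compact_bounded.
- by apply: continuous_measurable_rV; exact: test_function_continuous tu.
- by move=> x; apply: class_C1_is_derive; exact: Cu.
- by move=> x; rewrite (le_trans (HM x))// lerDl sumr_ge0.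
- move=> x; rewrite ler_wpDl// (le_trans (ler_norm_sum _ _ _))// ler_sum// => i _.
  by rewrite normrM !mxE ler_wpM2l.
- by [].
- by move=> x nCx; rewrite /dotv big1// => i _; rewrite mxE (partial_zero _ cCl uC nCx) mulr0.
Qed.

Lemma dotv_delta (i : 'I_N) x : dotv (delta_mx ord0 i) x = x ord0 i.
Proof.
rewrite /dotv (bigD1 i)//= mxE !eqxx mul1r big1 ?addr0// => j ji.
by rewrite mxE (negbTE ji) andbF mul0r.
Qed.

Lemma test_integration_by_parts O u phi i : open O -> (mu O < +oo)%E ->
  test_function O u -> test_function O phi ->
  \int[mu]_(x in O) (u x * partial i phi x) = - \int[mu]_(x in O) (partial i u x * phi x).
Proof.
move=> oO fO tu tphi; have mO := open_measurable_rV oO.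
have tup : test_function O (u * phi) by apply: test_functionM => //; case: tu.
have [_ [C cC [CO uC]]] := tup.
have := test_divergence0 (delta_mx ord0 i) tup.
under eq_Rintegral do rewrite dotv_delta mxE.
rewrite -(Rintegral_support CO); last first.
  by move=> x; apply: partial_zero => //; exact: compact_closed_rV.
have E x : partial i (u * phi) x = u x * partial i phi x + partial i u x * phi x.
  have [Cu _] := tu; have [Cp _] := tphi.
  rewrite /partial deriveM; [|exact: class_C_derivable (Cu 1%N)|exact: class_C_derivable (Cp 1%N)].
  by rewrite [_ *: 'D__ u x]mulrC.
under eq_Rintegral do rewrite E.
rewrite RintegralD//; last 2 first.
- by apply: bm_integrable => //; apply: bmM; apply: test_function_bm; [exact: tu|exact: test_function_partial tphi].
- by apply: bm_integrable => //; apply: bmM; apply: test_function_bm; [exact: test_function_partial tu|exact: tphi].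
by move/eqP; rewrite addr_eq0 => /eqP.
Qed.

Lemma bm_L2 O u : measurable O -> (mu O < +oo)%E -> bounded_measurable O u -> L2 O u.
Proof.
move=> mO fO bu; split; first by case: bu.
have /integrableP[_] := bm_integrable mO fO (bmX 2 bu).
by under eq_integral do rewrite /= ger0_norm ?sqr_ge0//.
Qed.

Lemma test_function_W012 O u : open O -> (mu O < +oo)%E -> test_function O u ->
  W012 O u (grad u).
Proof.
move=> oO fO tu; have mO := open_measurable_rV oO.
have gE i : (fun x => grad u x ord0 i) = partial i u by apply/funext => x; rewrite mxE.
split.
  split; first by apply: bm_L2 => //; exact: test_function_bm tu.
  move=> i; rewrite gE; split.
    by apply: bm_L2 => //; apply: test_function_bm; exact: test_function_partial tu.
  move=> phi tphi; under [in RHS]eq_Rintegral do rewrite mxE.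
  exact: test_integration_by_parts.
have zero (v : 'rV[R]_N -> R) : (\int[mu]_(x in O) ((v x - v x) ^+ 2)%:E)%E = 0%E.
  by under eq_integral do rewrite subrr expr0n /=; rewrite integral0.
exists (fun=> u); split => //.
  by rewrite /L2_cvg zero; exact: cvg_cst.
by move=> i; rewrite gE /L2_cvg zero; exact: cvg_cst.
Qed.

End test_functions.

(** * From test functions to W_0^{1,2} *)

Section real_integrable.
Context d (T : measurableType d) (R : realType) (mu : {measure set T -> \bar R}).
Variables (A : set T) (mA : measurable A).
Implicit Types (f g : T -> R).

Lemma integrable_realZl k f : mu.-integrable A (EFin \o f) ->
  mu.-integrable A (EFin \o (fun x => k * f x)).
Proof. by move=> fi; exact: (integrableZl mA k fi). Qed.

Lemma integrable_realD f g : mu.-integrable A (EFin \o f) -> mu.-integrable A (EFin \o g) ->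
  mu.-integrable A (EFin \o (fun x => f x + g x)).
Proof. by move=> fi gi; exact: (integrableD mA fi gi). Qed.

Lemma integrable_real_sum (I : Type) (s : seq I) (F : I -> T -> R) :
  (forall i, mu.-integrable A (EFin \o F i)) ->
  mu.-integrable A (EFin \o (fun x => \sum_(i <- s) F i x)).
Proof.
move=> iF; elim: s => [|i s IH].
  rewrite (_ : _ \o _ = cst 0%E); first exact: integrable0.
  by apply/funext => x /=; rewrite big_nil.
rewrite (_ : _ \o _ = EFin \o (fun x => F i x + \sum_(i <- s) F i x)).
  exact: integrable_realD.
by apply/funext => x /=; rewrite big_cons.
Qed.

Lemma Rintegral_sum (I : Type) (s : seq I) (F : I -> T -> R) :
  (forall i, mu.-integrable A (EFin \o F i)) ->
  \int[mu]_(x in A) (\sum_(i <- s) F i x) = \sum_(i <- s) \int[mu]_(x in A) F i x.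
Proof.
move=> iF; elim: s => [|i s IH].
  under eq_Rintegral do rewrite big_nil.
  by rewrite big_nil /Rintegral integral0.
under eq_Rintegral do rewrite big_cons.
by rewrite big_cons RintegralD// ?IH//; exact: integrable_real_sum.
Qed.

End real_integrable.

Lemma lipschitz_norm_continuous (R : realType) (V : normedModType R) (h : V -> R) (L : R) :
  (forall x y, `|h x - h y| <= L * `|x - y|) -> continuous h.
Proof.
move=> HL x; apply/cvgrPdist_le => e e0.
have L1 : 0 < `|L| + 1 by rewrite ltr_wpDl.
apply/nbhs_ballP; exists (e / (`|L| + 1)) => /=; first exact: divr_gt0.
move=> y; rewrite -ball_normE /= => /ltW H; rewrite (le_trans (HL _ _))//.
apply: (@le_trans _ _ ((`|L| + 1) * `|x - y|)).
  by rewrite ler_wpM2r// (le_trans (ler_norm _))// lerDl.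
by rewrite mulrC -ler_pdivlMr.
Qed.

Section sobolev_limits.
Variables (R : realType) (N : nat).
Local Notation mu := (@lebesgue_rV R N).
Implicit Types (O C A : set 'rV[R]_N) (u v phi a b : 'rV[R]_N -> R) (x y : 'rV[R]_N).

Lemma Rintegral_le_gap O (p q e : 'rV[R]_N -> R) : measurable O ->
  mu.-integrable O (EFin \o p) -> mu.-integrable O (EFin \o q) ->
  mu.-integrable O (EFin \o e) ->
  (forall x, O x -> `|p x - q x| <= e x) ->
  `|\int[mu]_(x in O) p x - \int[mu]_(x in O) q x| <= \int[mu]_(x in O) e x.
Proof.
move=> mO ip iq ie H; have ipq := integrableB mO ip iq.
rewrite -RintegralB//; apply: le_trans (le_normr_Rintegral mO ipq) _.
by apply: le_Rintegral => //; exact: integrable_norm.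
Qed.

Lemma cvg_real_sum (I : Type) (s : seq I) (F : nat -> I -> R) (l : I -> R) :
  (forall i, F n i @[n --> \oo] --> l i) ->
  \sum_(i <- s) F n i @[n --> \oo] --> \sum_(i <- s) l i.
Proof.
move=> Fl; elim: s => [|i s IH].
  by under eq_fun do rewrite big_nil; rewrite big_nil; exact: cvg_cst.
by under eq_fun do rewrite big_cons; rewrite big_cons; exact: cvgD.
Qed.

(** The shape in which Young's inequality 2 |a b| <= a^2 / e + e b^2 delivers L^2 convergence: e is
    fixed first, to make e A small, and n afterwards. *)
Lemma cvg_of_gap (I_ D : nat -> R) (l A K : R) : 0 <= A -> 0 <= K -> (D n @[n --> \oo] --> 0) ->
  (forall n e, 0 < e -> `|I_ n - l| <= (K + e^-1) * D n + e * A) ->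
  I_ n @[n --> \oo] --> l.
Proof.
move=> A0 K0 D0 H; apply/cvgrPdist_le => eps eps0.
pose e := eps / 2 / (A + 1).
have A1 : 0 < A + 1 by rewrite ltr_wpDl.
have e0 : 0 < e by rewrite !divr_gt0.
have Ke0 : 0 < K + e^-1 by rewrite ltr_wpDl ?invr_gt0.
have /cvgrPdist_le/(_ (eps / 2 / (K + e^-1))) := D0.
rewrite !divr_gt0// => /(_ isT); apply: filterS => n.
rewrite sub0r normrN => Dn; rewrite distrC (le_trans (H n _ e0))//.
rewrite [leRHS]splitr lerD//.
  apply: (@le_trans _ _ ((K + e^-1) * `|D n|)); first by rewrite ler_wpM2l ?ler_norm// ltW.
  by rewrite mulrC -ler_pdivlMr.
by rewrite /e mulrAC ler_pdivrMr// ler_wpM2l ?lerDl// ltW ?divr_gt0.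
Qed.

Lemma L2_integrable_sqr O u : measurable O -> L2 O u ->
  mu.-integrable O (EFin \o (fun x => u x ^+ 2)).
Proof.
move=> mO [mu_ fu]; apply/integrableP; split.
  by apply/measurable_EFinP; exact: measurable_funX.
by under eq_integral do rewrite /= ger0_norm ?sqr_ge0//.
Qed.

Lemma L2B O u v : measurable O -> L2 O u -> L2 O v -> L2 O (fun x => u x - v x).
Proof.
move=> mO Lu Lv; have [mu_ _] := Lu; have [mv _] := Lv.
split; first exact: measurable_funB.
have iu := L2_integrable_sqr mO Lu; have iv := L2_integrable_sqr mO Lv.
have /integrableP[_] : mu.-integrable O (EFin \o (fun x => (u x - v x) ^+ 2)).
  apply: le_integrable (integrableZl mO 2 (integrableD mO iu iv)) => //.
    by apply/measurable_EFinP/measurable_funX; exact: measurable_funB.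
  move=> x Ox; rewrite /= lee_fin ger0_norm ?sqr_ge0// ler_normr.
  by apply/orP; left; have := sqr_ge0 (u x + v x); lra.
by under eq_integral do rewrite /= ger0_norm ?sqr_ge0//.
Qed.

Lemma L2_integrable O u : measurable O -> (mu O < +oo)%E -> L2 O u ->
  mu.-integrable O (EFin \o u).
Proof.
move=> mO fO Lu; have iu := L2_integrable_sqr mO Lu; have [mu_ _] := Lu.
have i1 : mu.-integrable O (EFin \o cst 1) by apply: bm_integrable => //; exact: bm_cst.
apply: le_integrable (integrableD mO i1 iu) => //; first exact/measurable_EFinP.
move=> x Ox; rewrite /= lee_fin [leRHS]ger0_norm ?addr_ge0 ?sqr_ge0// ler_norml.
by apply/andP; split; nra.
Qed.

Lemma L2_cvg_Rintegral O (u_ : nat -> 'rV[R]_N -> R) u : measurable O ->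
  (forall n, L2 O (u_ n)) -> L2 O u -> L2_cvg O u_ u ->
  \int[mu]_(x in O) (u_ n x - u x) ^+ 2 @[n --> \oo] --> (0 : R).
Proof.
move=> mO Ln Lu H; rewrite /Rintegral; apply: fine_cvg.
by [].
Qed.

Lemma cvg_Rintegral_L2 O (u_ : nat -> 'rV[R]_N -> R) u : measurable O -> (mu O < +oo)%E ->
  (forall n, L2 O (u_ n)) -> L2 O u -> L2_cvg O u_ u ->
  \int[mu]_(x in O) u_ n x @[n --> \oo] --> \int[mu]_(x in O) u x.
Proof.
move=> mO fO Ln Lu H; have HD := L2_cvg_Rintegral mO Ln Lu H.
apply: (@cvg_of_gap _ _ _ (fine (mu O)) 0 _ _ HD) => [|//|n e e0]; first exact: fine_ge0.
have id := L2_integrable_sqr mO (L2B mO (Ln n) Lu).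
have ie : mu.-integrable O (EFin \o cst e) by apply: bm_integrable => //; exact: bm_cst.
rewrite add0r -RintegralZl// -Rintegral_cst// -RintegralD//; last exact: integrable_realZl.
apply: Rintegral_le_gap => //; [exact: L2_integrable|exact: L2_integrable| |].
  by apply: integrable_realD => //; exact: integrable_realZl.
move=> x Ox; move: (u_ n x - u x) => t.
rewrite -(ler_pM2l e0) mulrDr mulrA mulfV ?gt_eqF// mul1r.
by have [t0|t0] := ler0P t; nra.
Qed.

(** With z = s - t, s^2 - t^2 = z^2 + 2 z t is at most (1 + 1 / e) z^2 + e t^2 in absolute value.
    The squared difference is only dominated by [e_], which admits a Lipschitz function of the
    gradients in place of the gradients. *)
Lemma cvg_Rintegral_sqr O (a_ e_ : nat -> 'rV[R]_N -> R) a : measurable O ->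
  (forall n, mu.-integrable O (EFin \o (fun x => a_ n x ^+ 2))) ->
  mu.-integrable O (EFin \o (fun x => a x ^+ 2)) ->
  (forall n, mu.-integrable O (EFin \o e_ n)) ->
  (forall n x, O x -> (a_ n x - a x) ^+ 2 <= e_ n x) ->
  \int[mu]_(x in O) e_ n x @[n --> \oo] --> (0 : R) ->
  \int[mu]_(x in O) (a_ n x) ^+ 2 @[n --> \oo] --> \int[mu]_(x in O) (a x) ^+ 2.
Proof.
move=> mO ian ia ien H HD.
apply: (@cvg_of_gap _ _ _ (\int[mu]_(x in O) (a x) ^+ 2) 1 _ _ HD) => [|//|n e e0].
  by apply: Rintegral_ge0 => x _; exact: sqr_ge0.
rewrite -!RintegralZl// -RintegralD//; [|exact: integrable_realZl..].
apply: Rintegral_le_gap => //.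
  by apply: integrable_realD => //; exact: integrable_realZl.
move=> x Ox; apply: (@le_trans _ _ ((1 + e^-1) * (a_ n x - a x) ^+ 2 + e * a x ^+ 2)).
  move: (a_ n x) (a x) => s t.
  have -> : s ^+ 2 - t ^+ 2 = (s - t) ^+ 2 + 2 * (s - t) * t by ring.
  move: (s - t) => z.
  rewrite -(ler_pM2l e0) -[X in X * `|_|](gtr0_norm e0) -normrM ler_norml.
  have -> : e * ((1 + e^-1) * z ^+ 2 + e * t ^+ 2) = e * z ^+ 2 + z ^+ 2 + (e * t) ^+ 2.
    by field; rewrite gt_eqF.
  have ez : 0 <= e * z ^+ 2 by rewrite mulr_ge0 ?sqr_ge0 ?ltW.
  have := sqr_ge0 (z - e * t); have := sqr_ge0 (z + e * t).
  by move=> h1 h2; apply/andP; split; lra.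
by rewrite lerD2r ler_wpM2l ?H// addr_ge0// invr_ge0 ltW.
Qed.

Definition lipschitz_rV (h : 'rV[R]_N -> R) :=
  exists L, forall x y, `|h x - h y| <= L * `|x - y|.

Lemma lipschitz_rV_continuous h : lipschitz_rV h -> continuous h.
Proof. by move=> [L HL]; exact: lipschitz_norm_continuous HL. Qed.

Lemma sqr_norm_rV_le x : `|x| ^+ 2 <= dotv x x.
Proof.
have [->|] := eqVneq `|x| 0.
  by rewrite expr0n /= sumr_ge0// => i _; exact: sqr_ge0.
rewrite {1 2}/Num.norm /= => /mx_norm_neq0[[i j] ->] /=.
rewrite /dotv (bigD1 j)//= (ord1 i) real_normK ?num_real// expr2 lerDl sumr_ge0// => k _.
exact: sqr_ge0.
Qed.

Lemma measurable_comp_rV O (h : 'rV[R]_N -> R) (g : 'rV[R]_N -> 'rV[R]_N) : measurable O -> continuous h ->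
  (forall i, measurable_fun O (fun x => g x ord0 i)) -> measurable_fun O (h \o g).
Proof.
move=> mO ch mg.
(* g is measurable on O only; its extension by 0 is measurable everywhere and can be composed with
   h. *)
pose g' x : 'rV[R]_N := \row_i ((fun x => g x ord0 i) \_ O) x.
have mg' : measurable_fun setT g'.
  apply: measurable_rV => i; rewrite (_ : _ \o _ = (fun x => g x ord0 i) \_ O).
    exact: (iffLR (measurable_restrictT _ mO) (mg i)).
  by apply/funext => x; rewrite /= /rV_coord mxE.
apply: (@eq_measurable_fun _ _ _ _ _ (h \o g')).
  move=> x Ox /=; congr h; apply/rowP => i; rewrite mxE patchT//.
apply: measurable_funTS; apply: measurableT_comp => //.
exact: continuous_measurable_rV.
Qed.

(** Dominated by h (g)^2 <= 2 h (0)^2 + 2 L^2 |g|^2; the constant is integrable because O has finite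
    measure. *)
Lemma lipschitz_L2 O h (g : 'rV[R]_N -> 'rV[R]_N) : measurable O -> (mu O < +oo)%E ->
  lipschitz_rV h -> (forall i, L2 O (fun x => g x ord0 i)) -> L2 O (fun x => h (g x)).
Proof.
move=> mO fO lh Lg; have [L HL] := lh; have mh := lipschitz_rV_continuous lh.
have mhg : measurable_fun O (fun x => h (g x)).
  by apply: measurable_comp_rV => // i; case: (Lg i).
split => //.
have id := integrable_real_sum mO (index_enum 'I_N) (fun i => L2_integrable_sqr mO (Lg i)).
have ic : mu.-integrable O (EFin \o cst (2 * h 0 ^+ 2)).
  by apply: bm_integrable => //; exact: bm_cst.
have /integrableP[_] : mu.-integrable O (EFin \o (fun x => h (g x) ^+ 2)).
  apply: (le_integrable mO _ _ (integrable_realD mO ic (integrable_realZl mO (2 * L ^+ 2) id))).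
    by apply/measurable_EFinP/measurable_funX.
  move=> x Ox; rewrite /= lee_fin ger0_norm ?sqr_ge0// ler_normr; apply/orP; left.
  have := HL (g x) 0; rewrite subr0 => H.
  have H2 : (h (g x) - h 0) ^+ 2 <= L ^+ 2 * \sum_i (g x ord0 i) ^+ 2.
    rewrite -real_normK ?num_real//.
    apply: (@le_trans _ _ ((L * `|g x|) ^+ 2)).
      by rewrite lerXn2r// nnegrE// (le_trans _ H).
    by rewrite exprMn ler_wpM2l ?sqr_ge0// (le_trans (sqr_norm_rV_le _)).
  by have := sqr_ge0 (h (g x) - 2 * h 0); nra.
by under eq_integral do rewrite /= ger0_norm ?sqr_ge0//.
Qed.

Lemma test_function_L2 O u : open O -> (mu O < +oo)%E -> test_function O u -> L2 O u.
Proof.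
move=> oO fO tu; apply: bm_L2 => //; first exact: open_measurable_rV.
exact: test_function_bm tu.
Qed.

(** Transfers to W_0^{1,2} the inequalities proved for test functions. The Lipschitz function h is
    the support function of K in the anisotropic bounds and a coordinate in Barta's argument. *)
Lemma W012_approx O u g : open O -> (mu O < +oo)%E -> W012 O u g ->
  exists phi_ : nat -> 'rV[R]_N -> R, [/\ forall n, test_function O (phi_ n),
    \int[mu]_(x in O) phi_ n x @[n --> \oo] --> \int[mu]_(x in O) u x,
    \int[mu]_(x in O) (phi_ n x) ^+ 2 @[n --> \oo] --> \int[mu]_(x in O) (u x) ^+ 2 &
    forall h, lipschitz_rV h ->
    \int[mu]_(x in O) (h (grad (phi_ n) x)) ^+ 2 @[n --> \oo] -->
      \int[mu]_(x in O) (h (g x)) ^+ 2].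
Proof.
move=> oO fO [[Lu Wg] [phi_ [tphi cphi cg]]]; have mO := open_measurable_rV oO.
have Lphi n : L2 O (phi_ n) by exact: test_function_L2.
have Lg i : L2 O (fun x => g x ord0 i) by case: (Wg i).
have Lgphi n i : L2 O (partial i (phi_ n)).
  by apply: test_function_L2 => //; exact: test_function_partial.
exists phi_; split => //.
- exact: cvg_Rintegral_L2.
- apply: (@cvg_Rintegral_sqr _ _ (fun n x => (phi_ n x - u x) ^+ 2)) => //.
  + by move=> n; exact: L2_integrable_sqr.
  + exact: L2_integrable_sqr.
  + by move=> n; apply: L2_integrable_sqr => //; exact: L2B.
  + exact: L2_cvg_Rintegral.
move=> h lh; have [L HL] := lh.
have isq n i : mu.-integrable O (EFin \o (fun x => (partial i (phi_ n) x - g x ord0 i) ^+ 2)).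
  by apply: L2_integrable_sqr => //; exact: L2B.
apply: (@cvg_Rintegral_sqr _ (fun n x => h (grad (phi_ n) x))
   (fun n x => L ^+ 2 * \sum_i (partial i (phi_ n) x - g x ord0 i) ^+ 2) (fun x => h (g x))) => //.
- move=> n; apply: L2_integrable_sqr => //; apply: lipschitz_L2 => // i.
  by under eq_fun do rewrite mxE.
- by apply: L2_integrable_sqr => //; exact: lipschitz_L2.
- by move=> n; apply: integrable_realZl => //; exact: integrable_real_sum.
- move=> n x Ox; have H := HL (grad (phi_ n) x) (g x).
  rewrite -real_normK ?num_real//.
  apply: (@le_trans _ _ ((L * `|grad (phi_ n) x - g x|) ^+ 2)).
    by rewrite lerXn2r// nnegrE// (le_trans _ H).
  rewrite exprMn ler_wpM2l ?sqr_ge0// (le_trans (sqr_norm_rV_le _))//.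
  by rewrite /dotv; apply: ler_sum => i _; rewrite !mxE expr2.
have Hs : \sum_(i < N) \int[mu]_(x in O) (partial i (phi_ n) x - g x ord0 i) ^+ 2
    @[n --> \oo] --> \sum_(i < N) (0 : R).
  apply: cvg_real_sum => i; exact: (L2_cvg_Rintegral mO (fun n => Lgphi n i) (Lg i) (cg i)).
have := @cvgM _ _ _ _ (cst (L ^+ 2)) _ _ _ (cvg_cst _) Hs.
rewrite big1// mulr0 => H.
have E : (fun n => \int[mu]_(x in O) (L ^+ 2 * \sum_i (partial i (phi_ n) x - g x ord0 i) ^+ 2)) =
  (cst (L ^+ 2) * (fun n =>
  \sum_(i < N) \int[mu]_(x in O) (partial i (phi_ n) x - g x ord0 i) ^+ 2) : nat -> R).
  apply/funext => n.
  by rewrite RintegralZl ?Rintegral_sum//; exact: integrable_real_sum.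
rewrite E. exact: H.
Qed.

End sobolev_limits.

(** * Convex bodies and support functions *)

Section dot_product.
Variables (R : realType) (N : nat).
Implicit Types (x y z : 'rV[R]_N).

Lemma dotvC x y : dotv x y = dotv y x.
Proof. by apply: eq_bigr => i _; rewrite mulrC. Qed.

Lemma dotvDr x y z : dotv x (y + z) = dotv x y + dotv x z.
Proof. by rewrite /dotv -big_split; apply: eq_bigr => i _; rewrite mxE mulrDr. Qed.

Lemma dotvZr x (c : R) y : dotv x (c *: y) = c * dotv x y.
Proof. by rewrite /dotv mulr_sumr; apply: eq_bigr => i _; rewrite mxE mulrCA. Qed.

Lemma dotvNr x y : dotv x (- y) = - dotv x y.
Proof. by rewrite -scaleN1r dotvZr mulN1r. Qed.

Lemma dotvBr x y z : dotv x (y - z) = dotv x y - dotv x z.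
Proof. by rewrite dotvDr dotvNr. Qed.

Lemma dotvZl x (c : R) y : dotv (c *: x) y = c * dotv x y.
Proof. by rewrite dotvC dotvZr dotvC. Qed.

Lemma dotvNl x y : dotv (- x) y = - dotv x y.
Proof. by rewrite dotvC dotvNr dotvC. Qed.

Lemma dotvBl x y z : dotv (y - z) x = dotv y x - dotv z x.
Proof. by rewrite dotvC dotvBr ![dotv x _]dotvC. Qed.

Lemma dotv0r x : dotv x 0 = 0.
Proof. by rewrite -(scale0r 0) dotvZr mul0r. Qed.

Lemma dotv_gt0 x : x != 0 -> 0 < dotv x x.
Proof.
move=> x0; apply: lt_le_trans (sqr_norm_rV_le x).
by rewrite exprn_gt0// normr_gt0.
Qed.

Lemma ler_norm_dotv x y : `|dotv x y| <= (\sum_i `|x ord0 i|) * `|y|.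
Proof.
rewrite (le_trans (ler_norm_sum _ _ _))// mulr_suml ler_sum// => i _.
by rewrite normrM ler_wpM2l// coord_le_norm.
Qed.

Lemma dotv_continuous (a c : 'rV[R]_N) : continuous (fun x : 'rV[R]_N => dotv a (x - c)).
Proof. exact: (class_C_continuous (class_C_dot 0 a c)). Qed.

End dot_product.

Lemma affine_continuous (R : realType) (V : normedModType R) (x0 : V) (t : R) :
  continuous (fun x => x0 + t *: (x - x0)).
Proof.
move=> x; apply: cvgD; first exact: cvg_cst.
by apply: cvgZr; apply: cvgB; [exact: cvg_id|exact: cvg_cst].
Qed.

Section convex_geometry.
Variables (R : realType) (N : nat).
Implicit Types (A C K Omega : set 'rV[R]_N) (x y z : 'rV[R]_N) (t s : R).

Lemma convexP A x y t : convex_set (A : set (convex_lmodType 'rV[R]_N)) ->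
  A x -> A y -> 0 <= t <= 1 -> A (t *: x + (1 - t) *: y).
Proof.
move=> cA Ax Ay /andP[t0 t1].
by have := cA x y (Itv01 t0 t1); rewrite !inE; exact.
Qed.

Lemma ball_interior A x (e : R) : 0 < e -> (forall z, `|z| < e -> A (x + z)) -> A^° x.
Proof.
move=> e0 H; apply/nbhs_ballP; exists e => //= z; rewrite -ball_normE /= => xz.
by rewrite -(subrK x z) addrC; apply: H; rewrite distrC.
Qed.

Lemma interior_ball A x : A^° x -> exists2 e : R, 0 < e & forall z, `|z| < e -> A (x + z).
Proof.
move=> /nbhs_ballP[e /= e0 H]; exists e => // z ze; apply: H.
by rewrite -ball_normE /= opprD addNKr normrN.
Qed.

(** A ball of radius e around x0 is contracted to one of radius (1 - t) e around the image of x. *)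
Lemma homothety_interior A x0 x t : convex_set (A : set (convex_lmodType 'rV[R]_N)) ->
  A^° x0 -> A x -> 0 <= t < 1 -> A^° (x0 + t *: (x - x0)).
Proof.
move=> cA /interior_ball[e e0 H] Ax /andP[t0 t1].
have t1' : 0 < 1 - t by rewrite subr_gt0.
apply: (@ball_interior _ _ ((1 - t) * e)); first exact: mulr_gt0.
move=> z ze.
have -> : x0 + t *: (x - x0) + z = t *: x + (1 - t) *: (x0 + (1 - t)^-1 *: z).
  by apply/rowP => i; rewrite !mxE; field; rewrite gt_eqF.
apply: convexP => //; last by rewrite t0 ltW.
apply: H; rewrite normrZ gtr0_norm ?invr_gt0//.
by rewrite mulrC ltr_pdivrMr// mulrC.
Qed.

(** For x interior to K, a small z is the midpoint of x + 2 z and - x. *)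
Lemma origin_symmetric_interior0 K : convex_body K -> origin_symmetric K -> K^° 0.
Proof.
move=> [cK vK [x /interior_ball[e e0 H]]] sK.
apply: (@ball_interior _ _ (e / 2)) => [|z ze]; first exact: divr_gt0.
have -> : 0 + z = 2^-1 *: (x + 2 *: z) + (1 - 2^-1) *: (- x).
  by apply/rowP => i; rewrite !mxE; field.
apply: convexP => //; last by apply/andP; split; lra.
  by apply: H; rewrite normrZ gtr0_norm// mulrC -ltr_pdivlMr.
by apply: sK; rewrite -[x]addr0; apply: H; rewrite normr0.
Qed.

(* The functional is the direction from the nearest point of [A] to [z]. *)
Lemma separation A z : compact A -> A !=set0 ->
  convex_set (A : set (convex_lmodType 'rV[R]_N)) -> ~ A z ->
  exists a : 'rV[R]_N, forall x, A x -> dotv a x < dotv a z.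
Proof.
move=> cA A0 vA nAz.
have [|p] := @compact_EVT_min _ R (fun x => dotv (x - z) (x - z)) A A0 cA _.
  apply: continuous_subspaceT.
  rewrite (_ : (fun _ => _) = (fun x => \sum_(i <- index_enum 'I_N)
    (((fun x => x ord0 i) + (fun=> - z ord0 i)) * ((fun x => x ord0 i) + (fun=> - z ord0 i)) : 'rV[R]_N -> R) x)).
    apply: (@class_C_continuous _ _ 0); apply: class_C_sum => i.
    by apply: class_CM; (apply: class_CD; [exact: class_C_coord|exact: class_C_cst]).
  by apply/funext => x; apply: eq_bigr => i _; rewrite !mxE.
rewrite inE => Ap pmin; exists (z - p) => x Ax.
have zp : 0 < dotv (z - p) (z - p).
  by apply: dotv_gt0; rewrite subr_eq0; apply/eqP => zp; apply: nAz; rewrite zp.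
suff : dotv (z - p) (x - p) <= 0.
  by rewrite dotvBr; move: zp; rewrite [dotv (z - p) (z - p)]dotvBr; lra.
rewrite leNgt; apply/negP => H.
(* Minimality of p tested along the segment towards x. Writing q = (z - p) . (x - p) > 0 and w = |x
   - p|^2, the choice t = 1 is contradictory if w <= q, and t = q / w otherwise. *)
have H0 : forall t, 0 <= t <= 1 -> 2 * dotv (z - p) (x - p) * t <= t ^+ 2 * dotv (x - p) (x - p).
  move=> t t01; have := pmin (t *: x + (1 - t) *: p).
  rewrite inE => /(_ (convexP vA Ax Ap t01)).
  have -> : t *: x + (1 - t) *: p - z = t *: (x - p) - (z - p).
    by apply/rowP => i; rewrite !mxE; ring.
  have -> : p - z = - (z - p) by rewrite opprB.
  move: (z - p) (x - p) => q w.
  rewrite dotvBr !dotvBl !dotvZr !dotvZl dotvNl dotvNr opprK (dotvC w q); lra.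
set q := dotv (z - p) (x - p) in H H0; set w := dotv (x - p) (x - p) in H0.
have w0 : 0 <= w by rewrite /w /dotv sumr_ge0// => i _; rewrite -expr2 sqr_ge0.
have [wq|qw] := leP w q; first by have := H0 1; rewrite ler01 lexx => /(_ isT); lra.
have w1 : 0 < w by apply: lt_trans qw.
have qw01 : 0 <= q / w <= 1.
  by rewrite divr_ge0 ?(ltW H) ?(ltW w1)//= ler_pdivrMr// mul1r ltW.
have := H0 _ qw01; have -> : (q / w) ^+ 2 * w = q * (q / w) by field; rewrite gt_eqF.
have : 0 < q * (q / w) by rewrite mulr_gt0// divr_gt0.
by rewrite -mulrA; lra.
Qed.

Lemma compact_homothety A x0 t : compact A -> compact [set x0 + t *: (x - x0) | x in A].
Proof.
move=> cA; apply: continuous_compact => //; apply: continuous_subspaceT.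
exact: affine_continuous.
Qed.

(** The copy [Ct] of Omega contracted by t towards x0 lies in the interior. Each point of a large
    box outside that interior is cut off from [Ct] by an open half-space; by compactness finitely
    many of these, with the facets of the box, enclose a polytope. Normals are scaled so that the
    facets sit at level 1. *)
Lemma polytope_between Omega x0 t : convex_body Omega -> Omega^° x0 -> 0 <= t < 1 ->
  exists L : seq 'rV[R]_N, [/\
    forall a, a \in L -> a != 0,
    forall a, a \in L -> forall x, Omega x -> t * dotv a (x - x0) <= 1 &
    forall x, (forall a, a \in L -> dotv a (x - x0) <= 1) -> Omega^° x].
Proof.
move=> [cO vO _] Ox0 t01; have /andP[t0 t1] := t01.
pose Ct := [set x0 + t *: (x - x0) | x in Omega].
have cCt : compact Ct by exact: compact_homothety.
have x0O : Omega x0 by exact: interior_subset.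
have Ctx0 : Ct x0 by exists x0 => //; rewrite subrr scaler0 addr0.
have vCt : convex_set (Ct : set (convex_lmodType 'rV[R]_N)).
  move=> x y l; rewrite !inE => -[p Op <-] [q Oq <-].
  exists (l%:num *: p + (1 - l%:num) *: q).
    by apply: convexP => //; apply/andP; split.
  transitivity (l%:num *: (x0 + t *: (p - x0)) + (1 - l%:num) *: (x0 + t *: (q - x0))) => //.
  by apply/rowP => i; rewrite !mxE; ring.
have [M0 [M0r HM0]] := compact_bounded cO.
pose M := Num.max 1 (M0 + 1) + `|x0|.
have M_gt0 : 0 < M by rewrite /M ltr_pwDl// lt_max ltr01.
have HM x i : Omega x -> `|x ord0 i - x0 ord0 i| <= M.
  move=> Ox; rewrite (le_trans (ler_normB _ _))// lerD ?coord_le_norm//.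
  rewrite (le_trans (coord_le_norm _ _))// le_max; apply/orP; right.
  by apply: HM0 => //; rewrite ltrDl.
pose D := [set x : 'rV[R]_N | forall i, `[x0 ord0 i - M, x0 ord0 i + M]%classic (x ord0 i)].
have cD : compact D.
  apply: (@rV_compact _ _ (fun i => `[x0 ord0 i - M, x0 ord0 i + M]%classic)) => i.
  exact: segment_compact.
pose E := D `&` ~` Omega^°.
have cE : compact E.
  apply: (subclosed_compact _ cD); last by move=> x [].
  apply: closedI; first exact: compact_closed_rV.
  by apply: open_closedC; exact: open_interior.
have sepP z : exists a : 'rV[R]_N, E z ->
    (forall x, Ct x -> dotv a (x - x0) <= 1) /\ 1 < dotv a (z - x0).
  have [[Dz nOz]|nEz] := pselect (E z); last by exists 0.
  have [|a Ha] := @separation Ct z cCt (ex_intro _ x0 Ctx0) vCt.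
    by move=> [x Ox xz]; apply: nOz; rewrite -xz; exact: homothety_interior.
  have [p] := @compact_EVT_max _ R (fun x => dotv a (x - x0)) Ct (ex_intro _ x0 Ctx0) cCt
    (continuous_subspaceT (@dotv_continuous _ _ a x0)).
  rewrite inE => Ctp pmax.
  have p0 : 0 <= dotv a (p - x0).
    by have := pmax x0; rewrite inE => /(_ Ctx0); rewrite subrr dotv0r.
  have pz : dotv a (p - x0) < dotv a (z - x0) by rewrite !dotvBr ltrD2r; exact: Ha.
  (* A level strictly between the maximum over [Ct] and the value at z; it is positive because x0 is
     in [Ct], so dividing by it normalizes the half-space. *)
  pose b := (dotv a (p - x0) + dotv a (z - x0)) / 2.
  have b0 : 0 < b by rewrite /b; lra.
  exists (b^-1 *: a) => _; split => [x Ctx|].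
    rewrite dotvZl mulrC ler_pdivrMr// mul1r.
    by have := pmax x; rewrite inE => /(_ Ctx); rewrite /b; lra.
  by rewrite dotvZl mulrC ltr_pdivlMr// mul1r /b; lra.
have [f Hf] := choice sepP.
move: cE; rewrite compact_cover => /(_ _ E (fun z => [set x | 1 < dotv (f z) (x - x0)])).
case.
- move=> z Ez; have := @dotv_continuous R N (f z) x0.
  by move=> /continuousP/(_ _ (@open_gt R 1)).
- by move=> z Ez; exists z => //=; case: (Hf z Ez).
move=> D' D'E Ecov.
(* The functionals of norming factor 1 / M in the coordinate directions, with both signs, cut out
   the box [D], so that the covering of [E] is enough. *)
pose L0 := [seq f z | z <- finmap.enum_fset D'] ++ [seq M^-1 *: delta_mx ord0 i | i <- enum 'I_N] ++
  [seq - (M^-1 *: delta_mx ord0 i) | i <- enum 'I_N].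
exists [seq a <- L0 | a != 0]; split.
- by move=> a; rewrite mem_filter => /andP[].
- move=> a; rewrite mem_filter => /andP[_]; rewrite !mem_cat => /or3P[].
  + move=> /mapP[z zD' ->] x Ox.
    have Ez : E z by have := D'E z zD'; rewrite inE.
    have [/(_ (x0 + t *: (x - x0))) + _] := Hf z Ez.
    by rewrite addrAC subrr add0r dotvZr; apply; exists x.
  + move=> /mapP[i _ ->] x Ox; rewrite dotvZl dotv_delta !mxE.
    have := HM x i Ox; rewrite ler_norml => /andP[h1 h2].
    by rewrite mulrCA ler_pdivrMl// mulr1; nra.
  + move=> /mapP[i _ ->] x Ox; rewrite dotvNl dotvZl dotv_delta !mxE.
    have := HM x i Ox; rewrite ler_norml => /andP[h1 h2].
    by rewrite -mulrN mulrCA ler_pdivrMl// mulr1; nra.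
move=> x Hx0.
have Hx a : a \in L0 -> dotv a (x - x0) <= 1.
  move=> aL; have [->|a0] := eqVneq a 0; first by rewrite dotvC dotv0r.
  by apply: Hx0; rewrite mem_filter a0.
have Dx : D x.
  move=> i /=; rewrite in_itv/=.
  have H1 := Hx (M^-1 *: delta_mx ord0 i).
  have H2 := Hx (- (M^-1 *: delta_mx ord0 i)).
  have {}H1 : M^-1 * (x ord0 i - x0 ord0 i) <= 1.
    have := H1; rewrite dotvZl dotv_delta !mxE; apply; rewrite !mem_cat; apply/or3P/Or32.
    by apply/mapP; exists i => //; rewrite mem_enum.
  have {}H2 : - (M^-1 * (x ord0 i - x0 ord0 i)) <= 1.
    have := H2; rewrite dotvNl dotvZl dotv_delta !mxE; apply; rewrite !mem_cat; apply/or3P/Or33.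
    by apply/mapP; exists i => //; rewrite mem_enum.
  move: H1 H2; rewrite -mulrN ![M^-1 * _]mulrC !ler_pdivrMr// mul1r => H1 H2.
  by apply/andP; split; lra.
apply: contrapT => nOx; have [z /= zD'] := Ecov x (conj Dx nOx).
rewrite ltNge => /negP; apply; apply: Hx; rewrite mem_cat; apply/orP; left.
by apply/mapP; exists z.
Qed.

(** The sets of points that dilation by 1 + 1 / (n + 1) keeps in the interior form an open cover of
    C. *)
Lemma compact_inside Omega C x0 : convex_body Omega -> Omega^° x0 -> compact C ->
  C `<=` Omega^° -> exists2 s : R, 1 < s & forall x, C x -> Omega (x0 + s *: (x - x0)).
Proof.
move=> [cO vO _] Ox0 cC CO.
pose s (n : nat) : R := 1 + n.+1%:R^-1.
have s1 n : 1 < s n by rewrite /s ltrDl invr_gt0.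
move: cC; rewrite compact_cover =>
  /(_ nat setT (fun n => [set x | Omega^° (x0 + s n *: (x - x0))])).
case.
- move=> n _; have := @affine_continuous R _ x0 (s n).
  by move=> /continuousP/(_ _ (@open_interior _ Omega)).
- move=> x Cx; have [e e0 He] := interior_ball (CO x Cx).
  have [n] := ltr_add_invr (divr_gt0 (divr_gt0 e0 (ltr0n R 2)) (ltr_wpDl (normr_ge0 (x - x0)) ltr01)).
  rewrite add0r ltr_pdivlMr ?ltr_wpDl// => Hn.
  exists n => //=; apply: (@ball_interior _ _ (e / 2)) => [|z ze]; first exact: divr_gt0.
  have -> : x0 + s n *: (x - x0) + z = x + (n.+1%:R^-1 *: (x - x0) + z).
    by apply/rowP => i; rewrite /s !mxE; ring.
  apply: He; rewrite (le_lt_trans (ler_normD _ _))// normrZ gtr0_norm ?invr_gt0//.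
  have : n.+1%:R^-1 * `|x - x0| <= n.+1%:R^-1 * (`|x - x0| + 1).
    by rewrite ler_wpM2l// lerDl.
  by move=> /le_lt_trans /(_ Hn) h2; rewrite [ltRHS](splitr e) ltrD.
move=> D' _ Ccov.
(* The largest index gives the smallest dilation factor; convexity brings the point obtained with
   [s n] back to the one with [s m]. *)
pose m := (\max_(n <- finmap.enum_fset D') n)%N.
exists (s m) => // x /Ccov[n /= nD' Hn].
have nm : (n <= m)%N by exact: (@leq_bigmax_seq _ _ xpredT (fun n => n)).
have -> : x0 + s m *: (x - x0) = x0 + (s m / s n) *: ((x0 + s n *: (x - x0)) - x0).
  by rewrite ![x0 + _]addrC addrK scalerA divfK ?gt_eqF// (lt_trans ltr01).
have sn0 : 0 < s n by rewrite (lt_trans ltr01).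
have : 0 <= s m / s n <= 1.
  rewrite divr_ge0 ?(ltW (lt_trans ltr01 _))//= ler_pdivrMr// mul1r lerD2l.
  by rewrite lef_pV2 ?posrE// ler_nat.
move=> smn; have := convexP vO (interior_subset Hn) (interior_subset Ox0) smn.
by congr (Omega _); apply/rowP => i; rewrite !mxE; ring.
Qed.

End convex_geometry.

Section support.
Variables (R : realType) (N : nat) (K : set 'rV[R]_N).
Hypotheses (K_body : convex_body K) (K_sym : origin_symmetric K).
Implicit Types (x y a : 'rV[R]_N).
Local Notation h := (support_function K).

Lemma body_compact : compact K. Proof. by case: K_body. Qed.

Lemma body0 : K 0.
Proof. by apply: interior_subset; exact: origin_symmetric_interior0. Qed.

Lemma support_attained a : exists2 y, K y & dotv a y = h a.
Proof.
have [p] := @compact_EVT_max _ R (fun x => dotv a (x - 0)) K (ex_intro _ 0 body0) body_compact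
    (continuous_subspaceT (@dotv_continuous _ _ a 0)).
rewrite inE subr0 => Kp pmax; exists p => //.
have ub : ubound [set dotv a y | y in K] (dotv a p).
  by move=> _ [y Ky <-]; have := pmax y; rewrite inE subr0; exact.
apply/eqP; rewrite eq_le; apply/andP; split.
  by apply: ub_le_sup; [exists (dotv a p)|exists p].
by apply: ge_sup => //; exists (dotv a p); exists p.
Qed.

Lemma le_support a y : K y -> dotv a y <= h a.
Proof.
move=> Ky; have [p Kp _] := support_attained a.
apply: ub_le_sup; last by exists y.
have [M [Mr HM]] := compact_bounded body_compact.
exists ((\sum_i `|a ord0 i|) * (M + 1)) => _ [z Kz <-].
rewrite (le_trans (ler_norm _))// (le_trans (ler_norm_dotv _ _))// ler_wpM2l ?sumr_ge0//.
by apply: HM => //; rewrite ltrDl.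
Qed.

Lemma le_support_norm a y : K y -> `|dotv a y| <= h a.
Proof.
by move=> Ky; rewrite ler_norml lerNl -dotvNr !le_support//; exact: K_sym.
Qed.

Lemma support_ge0 a : 0 <= h a.
Proof. by rewrite -(dotv0r a) le_support//; exact: body0. Qed.

Lemma support_gt0 a : a != 0 -> 0 < h a.
Proof.
move=> a0; have [e e0 He] := interior_ball (origin_symmetric_interior0 K_body K_sym).
have na : 0 < `|a| + 1 by rewrite ltr_wpDl.
pose c := e / (`|a| + 1).
have c0 : 0 < c by exact: divr_gt0.
apply: (@lt_le_trans _ _ (dotv a (c *: a))); first by rewrite dotvZr mulr_gt0// dotv_gt0.
apply: le_support; rewrite -[c *: a]add0r; apply: He.
by rewrite normrZ gtr0_norm// /c mulrAC ltr_pdivrMr// ltr_pM2l// ltrDl.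
Qed.

Lemma supportZ (c : R) a : h (c *: a) = `|c| * h a.
Proof.
apply/eqP; rewrite eq_le; apply/andP; split.
  have [y Ky <-] := support_attained (c *: a).
  rewrite dotvZl (le_trans (ler_norm _))// normrM ler_wpM2l//.
  exact: le_support_norm.
have [y Ky <-] := support_attained a.
have [c0|c0] := leP 0 c; first by rewrite ?ger0_norm// -dotvZl le_support.
by rewrite ?ltr0_norm// mulNr -mulrN -dotvNr -dotvZl le_support//; exact: K_sym.
Qed.

Lemma support_sum_le (I : Type) (s : seq I) (w : I -> R) (a : I -> 'rV[R]_N) :
  h (\sum_(i <- s) w i *: a i) <= \sum_(i <- s) `|w i| * h (a i).
Proof.
have [y Ky <-] := support_attained (\sum_(i <- s) w i *: a i).
elim: s => [|i s IH]; first by rewrite !big_nil dotvC dotv0r.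
rewrite !big_cons dotvC dotvDr dotvC [dotv y (\sum_(_ <- _) _)]dotvC lerD//.
rewrite dotvZl (le_trans (ler_norm _))// normrM ler_wpM2l//.
exact: le_support_norm.
Qed.

Lemma support_lipschitz : lipschitz_rV h.
Proof.
have [M [Mr HM]] := compact_bounded body_compact.
pose S := \sum_(i < N) (M + 1).
have key x y : h x <= h y + S * `|x - y|.
  have [z Kz <-] := support_attained x.
  have -> : dotv x z = dotv y z + dotv z (x - y) by rewrite dotvBr ![dotv z _]dotvC; ring.
  rewrite lerD ?le_support// (le_trans (ler_norm _))// (le_trans (ler_norm_dotv _ _))//.
  rewrite ler_wpM2r// ler_sum// => i _; rewrite (le_trans (coord_le_norm _ _))//.
  by apply: HM => //; rewrite ltrDl.
exists S => x y; rewrite ler_norml; have H1 := key x y; have := key y x.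
by rewrite distrC => H2; apply/andP; split; lra.
Qed.

End support.

(** * Cells of a polytope *)

Section cells.
Variables (R : realType) (N m : nat).
Local Notation mu := (@lebesgue_rV R N).
Variables (a : 'I_m -> 'rV[R]_N) (c : 'I_m -> R) (x0 : 'rV[R]_N) (y : 'I_m -> 'rV[R]_N).
Hypotheses (ay : forall i, dotv (a i) (y i) = 1) (ay_le : forall i j, dotv (a j) (y i) <= 1).
Implicit Types (x z : 'rV[R]_N) (i j : 'I_m).

(* [depth i x] is the distance, in the norm with unit ball [K], from [x] to the
   i-th facet of the polytope, reached from [x] along [y i]. *)
Definition depth i x : R := c i - dotv (a i) (x - x0).

Definition polytope : set 'rV[R]_N := [set x | forall i, 0 <= depth i x].

(* The points whose nearest facet is the i-th one, the lowest index being
   preferred, so that the cells partition the polytope. *)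
Definition cell i : set 'rV[R]_N := [set x | polytope x /\
  forall j, depth i x <= depth j x /\ ((j < i)%N -> depth i x < depth j x)].

Lemma depth_class_C i k : class_C k (depth i).
Proof.
rewrite (_ : depth i = (fun=> c i) + (fun=> -1) * (fun x => dotv (a i) (x - x0))).
  apply: class_CD; first exact: class_C_cst.
  by apply: class_CM; [exact: class_C_cst|exact: class_C_dot].
by apply/funext => x; rewrite /depth !fctE mulN1r.
Qed.

Lemma measurable_depth i : measurable_fun setT (depth i).
Proof.
by apply: continuous_measurable_rV; exact: (class_C_continuous (depth_class_C i 0)).
Qed.

(** No depth decreases faster than at unit speed along y_i, while the i-th one decreases exactly at
    unit speed ([depth_flow_eq]): the nearest facet remains the i-th one along the flow. *)
Lemma depth_flow i j x t : 0 <= t -> depth j x - t <= depth j (x + t *: y i).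
Proof.
move=> t0; rewrite /depth (addrAC x) (dotvDr _ (x - x0)) dotvZr opprD addrA lerD2l lerN2.
by rewrite ler_piMr// ay_le.
Qed.

Lemma depth_flow_eq i x t : depth i (x + t *: y i) = depth i x - t.
Proof. by rewrite /depth (addrAC x) (dotvDr _ (x - x0)) dotvZr ay mulr1 opprD addrA. Qed.

Lemma is_derive_depth i x : is_derive x (y i) (depth i) (-1).
Proof.
apply/is_derive_lineP.
rewrite (_ : (fun h => _) = (fun h : R => depth i x - h)); last first.
  by apply/funext => h; rewrite addrC depth_flow_eq.
have := is_deriveB (is_derive_cst (depth i x) (0:R) (1:R)) (is_derive_id (0:R) 1).
by rewrite sub0r.
Qed.

Lemma measurable_ge0_set (f : 'rV[R]_N -> R) : measurable_fun setT f ->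
  measurable [set x | 0 <= f x].
Proof.
move=> mf; rewrite (_ : [set _ | _] = setT `&` f @^-1` [set` `[0, +oo[ ]); first exact: mf.
by rewrite setTI; apply/seteqP; split => x /=; rewrite in_itv/= andbT.
Qed.

Lemma measurable_gt0_set (f : 'rV[R]_N -> R) : measurable_fun setT f ->
  measurable [set x | 0 < f x].
Proof.
move=> mf; rewrite (_ : [set _ | _] = setT `&` f @^-1` [set` `]0, +oo[ ]); first exact: mf.
by rewrite setTI; apply/seteqP; split => x /=; rewrite in_itv/= andbT.
Qed.

Lemma measurable_polytope : measurable polytope.
Proof.
rewrite (_ : polytope = \bigcap_(i in [set: 'I_m]) [set x | 0 <= depth i x]).
  by apply: fin_bigcap_measurable => // i _; apply: measurable_ge0_set; exact: measurable_depth.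
by apply/seteqP; split => x /= H i; [move=> _; exact: H|exact: H].
Qed.

Lemma measurable_cell i : measurable (cell i).
Proof.
rewrite (_ : cell i = polytope `&` (\bigcap_(j in [set: 'I_m]) [set x | 0 <= depth j x - depth i x])
    `&` (\bigcap_(j in [set j : 'I_m | (j < i)%N]) [set x | 0 < depth j x - depth i x])).
  apply: measurableI; first apply: measurableI.
  - exact: measurable_polytope.
  - apply: fin_bigcap_measurable => // j _; apply: measurable_ge0_set.
    by apply: measurable_funB; exact: measurable_depth.
  - apply: fin_bigcap_measurable => // j _; apply: measurable_gt0_set.
    by apply: measurable_funB; exact: measurable_depth.
apply/seteqP; split => x.
  move=> [Px H]; split; first split => //.
  - by move=> j _ /=; rewrite subr_ge0; case: (H j).
  - by move=> j /= ji; rewrite subr_gt0; case: (H j) => _; exact.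
move=> [[Px H1] H2]; split => // j; split.
  by rewrite -subr_ge0; exact: H1.
by move=> ji; rewrite -subr_gt0; exact: H2.
Qed.

Lemma polytope_cell x j : polytope x -> exists i, cell i x.
Proof.
move=> Px.
have [i0 _ Hi0] := arg_minP (fun i => depth i x) (erefl : xpredT j).
have [i1 /eqP Hi1 Hmin] := @arg_minnP _ i0 (fun i => depth i x == depth i0 x) (fun i => i : nat) (eqxx _).
exists i1; split => // k; rewrite Hi1; split; first exact: Hi0.
move=> ki; rewrite lt_neqAle Hi0// andbT; apply/eqP => E.
by have := Hmin k; rewrite E eqxx => /(_ isT); rewrite leqNgt ki.
Qed.

Lemma cell_inj i j x : cell i x -> cell j x -> i = j.
Proof.
move=> [_ Hi] [_ Hj]; apply/val_inj/eqP; rewrite eqn_leq.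
have [Hij Hij'] := Hi j; have [Hji Hji'] := Hj i.
apply/andP; split; rewrite leqNgt; apply/negP => lt.
  by have := Hij' lt; rewrite ltNge Hji.
by have := Hji' lt; rewrite ltNge Hij.
Qed.

(** On the polytope f is the sum of its restrictions to the cells, exactly one of which is active at
    each point. The index j witnesses that there is a facet. *)
Lemma polytope_Rintegral_ge0 (f : 'rV[R]_N -> R) (j : 'I_m) :
  mu.-integrable polytope (EFin \o f) ->
  (forall i, 0 <= \int[mu]_(x in cell i) f x) -> 0 <= \int[mu]_(x in polytope) f x.
Proof.
move=> iF H.
have mP := measurable_polytope.
have ifc i : mu.-integrable setT (EFin \o (f \_ (cell i))).
  rewrite -restrict_EFin; apply/(integrable_mkcond _ (measurable_cell i)).
  by apply: (integrableS mP (measurable_cell i)) iF => // x [].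
have -> : \int[mu]_(x in polytope) f x =
    \int[mu]_x (\sum_(i < m) (f \_ (cell i)) x).
  rewrite Rintegral_mkcond; apply: eq_Rintegral => x _.
  rewrite {1}/patch; case: ifPn => Px.
    have [i ci] := @polytope_cell x j (set_mem Px).
    rewrite (bigD1 i)//= [(f \_ _) x]patchT ?inE// big1 ?addr0// => k ki.
    rewrite /patch ifF//; apply/negP; rewrite inE => ck.
    by move/eqP: ki; apply; exact: cell_inj ck ci.
  rewrite big1// => i _; rewrite /patch ifF//; apply/negP; rewrite inE => -[Px' _].
  by move/negP: Px; rewrite inE.
rewrite Rintegral_sum//; apply: sumr_ge0 => i _.
by rewrite -Rintegral_mkcond.
Qed.

Variables (u : 'rV[R]_N -> R) (C : set 'rV[R]_N) (Mu eta r : R).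
Hypotheses (Cu : class_C 1 u) (C_closed : closed C) (uC : forall x, ~ C x -> u x = 0).
Hypotheses (uM : forall x, `|u x| <= Mu) (duM : forall i x, `|dotv (y i) (grad u x)| <= Mu).
Hypotheses (r0 : 0 < r) (eta0 : 0 < eta) (C_eta : forall i x, C x -> eta <= depth i x).
Hypothesis (cell_r : forall i x, cell i x -> depth i x <= r).
Hypothesis (P_fin : (mu polytope < +oo)%E).

(** Functions of the depth s; primes denote derivatives. [be] and [ka] are differentiated only at s
    > 0 and may blow up at the facet. [al], the value of the calibration where u vanishes, is needed
    on both sides of the facet, down to depth - r. In [HJ], w stands for u and p for its derivative
    along y_i; the left side is minus the derivative of the calibration. *)
Variables (al al' be be' ka ka' : R -> R) (q0 q1 q2 M0 : R).
Hypotheses (mal : measurable_fun setT al) (mbe : measurable_fun setT be)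
  (mka : measurable_fun setT ka).
Hypothesis (Dal : forall s : R, is_derive s 1 al (al' s)).
Hypothesis (Dbe : forall s : R, 0 < s <= r -> is_derive s 1 be (be' s)).
Hypothesis (Dka : forall s : R, 0 < s <= r -> is_derive s 1 ka (ka' s)).
Hypothesis (Mal : forall s, - r <= s <= r -> `|al s| <= M0 /\ `|al' s| <= M0).
Hypothesis (Mbe : forall s, eta <= s <= r -> [/\ `|be s| <= M0, `|be' s| <= M0,
  `|ka s| <= M0 & `|ka' s| <= M0]).
Hypothesis (al_neg : forall s, - r <= s < 0 -> al s <= 0).
Hypothesis (al_pos : forall s, 0 <= s <= r -> 0 <= al s).
Hypothesis (V_pos : forall s w, 0 < s <= r -> 0 <= al s + be s * w + ka s * w * w).
Hypothesis (al'_le : forall s, 0 <= s <= r -> al' s <= q0).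
Hypothesis (HJ : forall s w p, 0 < s <= r ->
  (al' s + be' s * w + ka' s * w * w) - (be s + 2 * ka s * w) * p
    <= p ^+ 2 + (q0 + q1 * w + q2 * w ^+ 2)).

Let V i : 'rV[R]_N -> R :=
  (al \o depth i) + (be \o depth i) * u + (ka \o depth i) * u * u.
Let dV i x : R :=
  - (al' (depth i x) + be' (depth i x) * u x + ka' (depth i x) * u x * u x)
  + (be (depth i x) + 2 * ka (depth i x) * u x) * dotv (y i) (grad u x).

Let is_derive_V i z : - r <= depth i z <= r -> is_derive z (y i) (V i) (dV i z).
Proof.
move=> zr; have Dd := is_derive_depth i z.
have DA : is_derive z (y i) (al \o depth i) (al' (depth i z) * -1).
  exact: is_derive_compr Dd (Dal _).
have Du := class_C1_is_derive (y i) z Cu.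
have [Cz|nCz] := pselect (C z).
  have dz : 0 < depth i z <= r.
    by rewrite (lt_le_trans eta0 (C_eta i Cz)); case/andP: zr.
  have DB := is_derive_compr Dd (Dbe dz).
  have DK := is_derive_compr Dd (Dka dz).
  have D := is_deriveD (is_deriveD DA (is_deriveM DB Du)) (is_deriveM (is_deriveM DK Du) Du).
  apply: is_derive_eq D _.
  rewrite /dV /= !fctE /GRing.scale /=; ring.
(* Off C the function u vanishes nearby and only [al] is left, so the depth is allowed to be
   nonpositive. *)
have E : \near z, (al \o depth i) z = V i z.
  have : nbhs z (~` C) by apply: open_nbhs_nbhs; split => //; exact: closed_openC.
  by apply: filterS => w nCw; rewrite /V !fctE (uC nCw) !mulr0 !addr0.
have gz : dotv (y i) (grad u z) = 0.
  rewrite /dotv big1// => k _; rewrite mxE (partial_zero _ C_closed uC nCz) mulr0//.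
have -> : dV i z = al' (depth i z) * -1.
  by rewrite /dV gz (uC nCz) !mulr0 !addr0 mulrN1.
exact: near_eq_is_derive E DA.
Qed.

(** The calibration [V i] meets the sign conditions of [flow_Rintegral_le0]: nonnegative on the cell
    by [V_pos] and [al_pos], and equal to [al] <= 0 where the flow has left it. Then - dV, of
    nonnegative integral, is compared with the integrand through [HJ]. *)
Lemma cell_inequality i :
  0 <= \int[mu]_(x in cell i) (dotv (y i) (grad u x) ^+ 2 + (q0 + q1 * u x + q2 * u x ^+ 2)).
Proof.
have mc := measurable_cell i.
have cP : cell i `<=` polytope by move=> x [].
have fc : (mu (cell i) < +oo)%E.
  by apply: le_lt_trans P_fin; apply: le_measure; rewrite ?inE//; exact: measurable_polytope.
have mu_ : measurable_fun setT u.
  by apply: continuous_measurable_rV; exact: class_C_continuous Cu.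
have mg : measurable_fun setT (fun x => dotv (y i) (grad u x)).
  by apply: (measurable_is_derive mu_) => x; exact: class_C1_is_derive.
have Mu0 : 0 <= Mu by exact: le_trans (uM 0).
have M00 z : - r <= depth i z <= r -> 0 <= M0 by move=> /Mal[+ _]; exact: le_trans.
have flow_range x (t : R) : cell i x -> 0 <= t <= r -> - r <= depth i (x + t *: y i) <= r.
  move=> cx /andP[t0 t1]; rewrite depth_flow_eq.
  have := cell_r cx; case: cx => [Px _]; have := Px i => ? ?.
  by apply/andP; split; lra.
pose B := M0 + M0 * Mu + M0 * Mu * Mu + (M0 + 2 * M0 * Mu) * Mu.
have VB z : - r <= depth i z <= r -> `|V i z| <= B /\ `|dV i z| <= B.
  move=> zr; have [A1 A2] := Mal zr; have M0p := M00 z zr.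
  have p1 : 0 <= M0 * Mu by rewrite mulr_ge0.
  have p2 : 0 <= M0 * Mu * Mu by rewrite mulr_ge0.
  have p3 : 0 <= (M0 + 2 * M0 * Mu) * Mu by rewrite mulr_ge0// addr_ge0// -mulrA mulr_ge0.
  have [Cz|nCz] := pselect (C z).
    have dz : eta <= depth i z <= r by rewrite C_eta//; case/andP: zr.
    have [B1 B2 B3 B4] := Mbe dz; have U := uM z; have G := duM i z.
    have bU w : `|w| <= M0 -> `|w * u z| <= M0 * Mu by move=> ?; rewrite normrM ler_pM.
    have bUU w : `|w| <= M0 -> `|w * u z * u z| <= M0 * Mu * Mu.
      by move=> ?; rewrite normrM ler_pM// bU.
    split.
      rewrite /V !fctE /=; have := bU _ B1; have := bUU _ B3.
      rewrite /B => h2 h1; rewrite (le_trans (ler_normD _ _))//.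
      have := ler_normD (al (depth i z)) (be (depth i z) * u z); lra.
    have h1 := bU _ B2; have h2 := bUU _ B4.
    have h3 : `|(be (depth i z) + 2 * ka (depth i z) * u z) * dotv (y i) (grad u z)|
        <= (M0 + 2 * M0 * Mu) * Mu.
      rewrite normrM ler_pM// (le_trans (ler_normD _ _))// lerD//.
      by rewrite -!mulrA normrM ger0_norm// ler_wpM2l// bU.
    rewrite /dV /B (le_trans (ler_normD _ _))// normrN.
    have := ler_normD (al' (depth i z) + be' (depth i z) * u z) (ka' (depth i z) * u z * u z).
    have := ler_normD (al' (depth i z)) (be' (depth i z) * u z); lra.
  have gz : dotv (y i) (grad u z) = 0.
    rewrite /dotv big1// => k _; rewrite mxE (partial_zero _ C_closed uC nCz) mulr0//.
  rewrite /V /dV !fctE gz (uC nCz) !mulr0 !addr0 normrN /B /=; lra.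
have mV : measurable_fun setT (V i).
  have md := measurable_depth i.
  apply: measurable_funD; first apply: measurable_funD.
  - exact: measurableT_comp.
  - by apply: measurable_funM => //; exact: measurableT_comp.
  - by do 2 apply: measurable_funM => //; exact: measurableT_comp.
have Vcell x : cell i x -> 0 <= V i x.
  move=> cx; have rx := cell_r cx; have [/(_ i) px _] := cx.
  have [Cx|nCx] := pselect (C x).
    rewrite /V !fctE; apply: V_pos.
    by rewrite rx andbT (lt_le_trans eta0)// C_eta.
  by rewrite /V !fctE (uC nCx) !mulr0 !addr0 /= al_pos// px.
have [|||||iV Vle0] := @flow_Rintegral_le0 R N (cell i) (y i) r B (V i) (dV i) mc fc r0 mV.
- by move=> x t cx t01; case: (VB _ (flow_range x t cx t01)).
- by move=> x t cx t01; case: (VB _ (flow_range x t cx t01)).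
- by move=> x t cx t01; apply: is_derive_line; apply: is_derive_V; exact: flow_range.
- by move=> x t cx _ _; exact: Vcell.
- move=> x t ncx /andP[t0 t1] cxt.
  have E : x = (x - t *: y i) + t *: y i by rewrite subrK.
  have xr : - r <= depth i x <= r by rewrite E flow_range// ltW.
  (* If the i-th depth were still >= 0 at x, then x would be in the cell: the other depths have lost
     at most t and the i-th exactly t, so the large and the strict comparisons both survive. *)
  have xneg : depth i x < 0.
    rewrite ltNge; apply/negP => xp; apply: ncx.
    have [Pz Hz] := cxt; have Ei := depth_flow_eq i (x - t *: y i) t; rewrite -E in Ei.
    have Hj j := depth_flow i j (x - t *: y i) (ltW t0).
    have {}Hj j : depth j (x - t *: y i) - t <= depth j x by have := Hj j; rewrite -E.
    have cmp j : depth i x <= depth j x.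
      by have [h _] := Hz j; have := Hj j; rewrite Ei; lra.
    split => [j|j]; first exact: le_trans xp (cmp j).
    split => // ji; have [_ /(_ ji) h] := Hz j; have := Hj j; rewrite Ei; lra.
  have nCx : ~ C x by move=> /(C_eta i); rewrite leNgt (lt_trans xneg).
  by rewrite /V !fctE (uC nCx) !mulr0 !addr0 /= al_neg//; case/andP: xr => ->.
have bu : bounded_measurable (cell i) u by split; [exact: measurable_funTS|exists Mu].
have bg : bounded_measurable (cell i) (fun x => dotv (y i) (grad u x)).
  by split; [exact: measurable_funTS|exists Mu].
have bf : bounded_measurable (cell i)
    (fun x => dotv (y i) (grad u x) ^+ 2 + (q0 + q1 * u x + q2 * u x ^+ 2)).
  apply: bmD; first exact: bmX.
  apply: bmD; first (apply: bmD; first exact: bm_cst).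
    by apply: bmM => //; exact: bm_cst.
  by apply: bmM; [exact: bm_cst|exact: bmX].
(* On C the pointwise comparison is [HJ]; off C it reduces to [al'] <= q0, at depths that may be
   0. *)
apply: (@le_trans _ _ (- \int[mu]_(x in cell i) dV i x)); first by rewrite oppr_ge0.
rewrite -RintegralN//; apply: le_Rintegral => //.
- exact: (integrableN iV).
- exact: bm_integrable.
move=> x cx; have rx := cell_r cx; have [/(_ i) px _] := cx.
have [Cx|nCx] := pselect (C x).
  have xr : 0 < depth i x <= r by rewrite rx andbT (lt_le_trans eta0)// C_eta.
  by have := HJ (u x) (dotv (y i) (grad u x)) xr; rewrite /dV; lra.
have gz : dotv (y i) (grad u x) = 0.
  rewrite /dotv big1// => k _; rewrite mxE (partial_zero _ C_closed uC nCx) mulr0//.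
rewrite /dV gz (uC nCx) !mulr0 !addr0 opprK expr0n /= add0r ?mulr0 ?addr0.
by apply: al'_le; rewrite px.
Qed.

End cells.

(** * The inradius and the calibrated inequality on a convex body *)

Section inradius.
Variables (R : realType) (N : nat) (K Omega : set 'rV[R]_N).
Hypotheses (N_gt0 : (0 < N)%N) (K_body : convex_body K) (K_sym : origin_symmetric K)
  (Omega_body : convex_body Omega).
Local Notation mu := (@lebesgue_rV R N).
Local Notation r := (inradius K Omega).

Let S := [set t : R | exists2 x, Omega x & [set x + t *: y | y in K] `<=` Omega].

Lemma inradius_has_sup : has_sup S.
Proof.
have [cO _ [x0 Ox0]] := Omega_body; have Ox := interior_subset Ox0.
split; first by exists 0, x0 => // _ [y _ <-]; rewrite scale0r addr0.
have [e e0 He] := interior_ball (origin_symmetric_interior0 K_body K_sym).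
have [M [Mr HM]] := compact_bounded cO.
have {}HM x : Omega x -> `|x| <= M + 1 by apply: HM; rewrite ltrDl.
(* Both k and - k lie in K, so x + t k and x - t k lie in Omega; comparing one coordinate of the two
   bounds t. *)
pose k : 'rV[R]_N := const_mx (e / 2).
have i0 : 'I_N by exact: (Ordinal N_gt0).
have e20 : 0 < e / 2 by exact: divr_gt0.
have Kk : K k.
  rewrite -[k]add0r; apply: He; apply: (@le_lt_trans _ _ (e / 2)).
    by apply: norm_rV_le => [|j]; [exact: ltW|rewrite mxE gtr0_norm].
  by rewrite ltr_pdivrMr// ltr_pMr// ltr1n.
exists ((M + 1) / (e / 2)) => t [x Ox' xt].
have t1 := HM _ (xt _ (ex_intro2 _ _ k Kk erefl)).
have t2 := HM _ (xt _ (ex_intro2 _ _ (- k) (K_sym Kk) erefl)).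
rewrite ler_pdivlMr//.
have {}t1 := le_trans (coord_le_norm _ i0) t1.
have {}t2 := le_trans (coord_le_norm _ i0) t2.
move: t1 t2; rewrite !mxE !ler_norml => /andP[_ h1] /andP[h2 _]; lra.
Qed.

Lemma le_inradius t x : Omega x -> [set x + t *: y | y in K] `<=` Omega -> t <= r.
Proof.
by move=> Ox H; apply: sup_upper_bound; [exact: inradius_has_sup|exists x].
Qed.

Lemma inscribed_interior t x : 0 < t -> [set x + t *: y | y in K] `<=` Omega -> Omega^° x.
Proof.
move=> t0 H; have [e e0 He] := interior_ball (origin_symmetric_interior0 K_body K_sym).
apply: (@ball_interior _ _ _ _ (t * e)); first exact: mulr_gt0.
move=> z ze; apply: H; exists (t^-1 *: z); last by rewrite scalerA mulfV ?gt_eqF// scale1r.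
by rewrite -[_ *: z]add0r; apply: He; rewrite normrZ gtr0_norm ?invr_gt0// ltr_pdivrMl.
Qed.

Lemma inradius_gt0 : 0 < r.
Proof.
have [cO _ [x0 Ox0]] := Omega_body; have Ox := interior_subset Ox0.
have [e e0 He] := interior_ball Ox0.
have [M [Mr HM]] := compact_bounded (body_compact K_body).
have {}HM x : K x -> `|x| <= M + 1 by apply: HM; rewrite ltrDl.
have M1 : 0 < `|M + 1| + 1 by rewrite ltr_wpDl.
apply: (@lt_le_trans _ _ (e / (`|M + 1| + 1))); first exact: divr_gt0.
apply: (le_inradius Ox) => _ [y Ky <-]; apply: He.
rewrite normrZ gtr0_norm ?divr_gt0// mulrAC ltr_pdivrMr// ltr_pM2l//.
by rewrite (le_lt_trans (HM _ Ky))// (le_lt_trans (ler_norm _))// ltrDl.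
Qed.

(** A copy of size larger than r' is enough: r' tends to r in the bounds that use it. *)
Lemma inradius_approx r' : 0 < r' < r ->
  exists t x, [/\ r' < t, Omega^° x & [set x + t *: y | y in K] `<=` Omega].
Proof.
move=> /andP[r'0 r'r]; have rr : 0 < r - r' by rewrite subr_gt0.
have [t [x Ox H]] := sup_adherent rr inradius_has_sup; rewrite subKr => rt.
by exists t, x; split => //; apply: inscribed_interior H; exact: lt_trans rt.
Qed.

Lemma compact_lebesgue_lty (A : set 'rV[R]_N) : compact A -> (mu A < +oo)%E.
Proof.
move=> cA; apply: bounded_lebesgue_rV_lty; last exact: compact_bounded.
by apply: closed_measurable_rV; exact: compact_closed_rV.
Qed.

Lemma Omega_measurable : measurable Omega.
Proof. by case: Omega_body => /compact_closed_rV/closed_measurable_rV. Qed.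

Lemma Omega_lty : (mu Omega < +oo)%E.
Proof. by case: Omega_body => /compact_lebesgue_lty. Qed.

Lemma interior_lty : (mu Omega^° < +oo)%E.
Proof.
apply: le_lt_trans Omega_lty; apply: le_measure; rewrite ?inE//.
- by apply: open_measurable_rV; exact: open_interior.
- exact: Omega_measurable.
- exact: interior_subset.
Qed.

Variables (al al' be be' ka ka' : R -> R) (q0 q1 q2 : R).
Hypotheses (mal : measurable_fun setT al) (mbe : measurable_fun setT be)
  (mka : measurable_fun setT ka).
Hypothesis (Dal : forall s : R, is_derive s 1 al (al' s)).
Hypothesis (Dbe : forall s : R, 0 < s <= r -> is_derive s 1 be (be' s)).
Hypothesis (Dka : forall s : R, 0 < s <= r -> is_derive s 1 ka (ka' s)).
Hypothesis (bounds : forall eta, 0 < eta -> exists M0,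
  (forall s, - r <= s <= r -> `|al s| <= M0 /\ `|al' s| <= M0) /\
  (forall s, eta <= s <= r -> [/\ `|be s| <= M0, `|be' s| <= M0,
  `|ka s| <= M0 & `|ka' s| <= M0])).
Hypothesis (al_neg : forall s, - r <= s < 0 -> al s <= 0).
Hypothesis (al_pos : forall s, 0 <= s <= r -> 0 <= al s).
Hypothesis (V_pos : forall s w, 0 < s <= r -> 0 <= al s + be s * w + ka s * w * w).
Hypothesis (al'_le : forall s, 0 <= s <= r -> al' s <= q0).
Hypothesis (HJ : forall s w p, 0 < s <= r ->
  (al' s + be' s * w + ka' s * w * w) - (be s + 2 * ka s * w) * p
    <= p ^+ 2 + (q0 + q1 * w + q2 * w ^+ 2)).
Hypothesis (q0_ge0 : 0 <= q0).

(** Sum of the cell inequalities, for a polytope adapted to u: its facets stay at positive depth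
    from the support C, where u and its gradient live. Hence the integrals of u are the same over
    the polytope and over the interior of Omega, and only the term in q0 >= 0 grows when the volume
    of the polytope is replaced by that of Omega. *)
Lemma web_inequality u : test_function Omega^° u ->
  0 <= \int[mu]_(x in Omega^°) support_function K (grad u x) ^+ 2
     + q1 * \int[mu]_(x in Omega^°) u x + q2 * \int[mu]_(x in Omega^°) u x ^+ 2
     + q0 * fine (mu Omega).
Proof.
move=> tu; have [Cu [C cC [CO uC]]] := tu.
have cCl := compact_closed_rV cC.
have [cO vO [x0 Ox0]] := Omega_body.
have [s s1 Hs] := compact_inside Omega_body Ox0 cC CO.
have s0 : 0 < s by exact: lt_trans s1.
(* Halfway between 1 / s and 1: the polytope contains the contraction of Omega by t < 1, and t s > 1
   leaves room around C. *)
pose t := (s^-1 + 1) / 2.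
have si1 : s^-1 < 1 by rewrite invf_lt1.
have si0 : 0 < s^-1 by rewrite invr_gt0.
have t01 : 0 <= t < 1 by rewrite /t; apply/andP; split; lra.
have t0 : 0 < t by rewrite /t; lra.
have [L [L0 LO PL]] := polytope_between Omega_body Ox0 t01.
pose m := size L; pose nu (i : 'I_m) := tnth (in_tuple L) i.
have nuL i : nu i \in L by exact: mem_tnth.
have h0 i : 0 < support_function K (nu i) by apply: support_gt0 => //; exact: L0.
(* Rescaling each normal to support value 1 turns the affine functions into distances for the norm
   of unit ball K. *)
pose c (i : 'I_m) := (support_function K (nu i))^-1.
have c0 i : 0 < c i by rewrite invr_gt0.
pose a i := c i *: nu i.
have ha i : support_function K (a i) = 1.
  by rewrite supportZ// gtr0_norm// mulVf// gt_eqF.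
have att i : exists z, K z /\ dotv (a i) z = support_function K (a i).
  by have [z Kz E] := support_attained K_body K_sym (a i); exists z.
have [y Hy] := choice att.
have ay i : dotv (a i) (y i) = 1 by case: (Hy i) => _ ->.
have ay_le i j : dotv (a j) (y i) <= 1.
  by case: (Hy i) => Ky _; rewrite -(ha j) le_support.
have depthE i x : depth a c x0 i x = c i * (1 - dotv (nu i) (x - x0)).
  by rewrite /depth /a dotvZl mulrBr mulr1.
have PO : polytope a c x0 `<=` Omega^°.
  move=> x Px; apply: PL => b bL.
  have [i ->] : exists i, b = nu i.
    move: bL => /(nthP 0)[k km <-]; exists (Ordinal km).
    by rewrite /nu (tnth_nth 0).
  have := Px i; rewrite depthE pmulr_rge0//; lra.
(* Dilating C by s stays in Omega, so nu_i . (x - x0) <= 1 / (t s) on C, whereas the facet is at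
   level 1. *)
pose gap := 1 - (t * s)^-1.
have ts1 : 1 < t * s.
  have -> : t * s = (1 + s) / 2 by rewrite /t; field; rewrite gt_eqF.
  lra.
have gap0 : 0 < gap by rewrite subr_gt0 invf_lt1// (lt_trans ltr01).
(* One bound for all the factors 1 / [c i], which makes the depth [eta] uniform in i. *)
pose D := 1 + \sum_i support_function K (nu i).
have D0 : 0 < D by rewrite ltr_wpDr// sumr_ge0// => i _; rewrite ltW.
pose eta := gap / D.
have eta0 : 0 < eta by exact: divr_gt0.
have C_eta i x : C x -> eta <= depth a c x0 i x.
  move=> Cx; rewrite depthE /eta mulrC ler_pM ?invr_ge0 ?(ltW D0) ?(ltW gap0)//.
    rewrite /c lef_pV2 ?posrE// /D (bigD1 i)//= addrCA lerDl addr_ge0// sumr_ge0// => j _.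
    exact: ltW.
  rewrite /gap lerD2l lerN2 -[leRHS]mul1r ler_pdivlMr ?(lt_trans ltr01 ts1)//.
  have := LO _ (nuL i) _ (Hs x Cx).
  by rewrite addrAC subrr add0r dotvZr mulrA => ?; rewrite mulrC.
(* On its cell the i-th depth is the least one, so the translate of K of that size centred at x
   crosses no facet and is inscribed in Omega. *)
have cell_r i x : cell a c x0 i x -> depth a c x0 i x <= r.
  move=> [Px Hx]; apply: (@le_inradius _ x); first by apply: interior_subset; exact: PO.
  move=> _ [k Kk <-]; apply: interior_subset; apply: PO => j.
  have d0 := Px i; have [dj _] := Hx j.
  rewrite /depth (addrAC x) (dotvDr _ (x - x0)) dotvZr opprD addrA -/(depth a c x0 j x).
  rewrite subr_ge0 (le_trans _ dj)// ler_piMr//.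
  by rewrite -(ha j) le_support.
have mP := measurable_polytope a c x0.
have fP : (mu (polytope a c x0) < +oo)%E.
  apply: le_lt_trans interior_lty; apply: le_measure; rewrite ?inE//.
  by apply: open_measurable_rV; exact: open_interior.
have [Mu HMu] := test_function_bounded tu.
have [Lk HLk] := choice (fun i => test_function_bounded (test_function_partial i tu)).
have [MK [_ HMK]] := compact_bounded (body_compact K_body).
have {}HMK z : K z -> `|z| <= MK + 1 by apply: HMK; rewrite ltrDl.
pose Mg := (\sum_k Lk k) * (MK + 1).
have Lk0 k : 0 <= Lk k by exact: le_trans (HLk k 0).
have duM i x : `|dotv (y i) (grad u x)| <= Mg.
  rewrite dotvC (le_trans (ler_norm_dotv _ _))// ler_pM ?sumr_ge0//.
    by apply: ler_sum => k _; rewrite mxE.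
  by apply: HMK; case: (Hy i).
pose MM := Num.max Mu Mg.
have [M0 [B1 B2]] := bounds eta0.
have cellI i : 0 <= \int[mu]_(x in cell a c x0 i)
    (dotv (y i) (grad u x) ^+ 2 + (q0 + q1 * u x + q2 * u x ^+ 2)).
  apply: (@cell_inequality R N m a c x0 y ay ay_le u C MM eta r (Cu 1%N) cCl uC _ _ inradius_gt0 eta0
    C_eta cell_r fP al al' be be' ka ka' q0 q1 q2 M0) => //.
  - by move=> x; rewrite le_max HMu.
  - by move=> j x; rewrite le_max duM orbT.
pose h x := support_function K (grad u x).
have gO x : ~ C x -> grad u x = 0.
  by move=> nCx; apply/rowP => k; rewrite !mxE (partial_zero _ cCl uC nCx).
have hO x : ~ C x -> h x = 0.
  by move=> nCx; rewrite /h gO// -(scale0r 0) supportZ// normr0 mul0r.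
have mh : measurable_fun setT h.
  apply: measurable_comp_rV => //; first exact/lipschitz_rV_continuous/support_lipschitz.
  move=> k; under eq_fun do rewrite mxE; apply: continuous_measurable_rV.
  exact: test_function_continuous (test_function_partial k tu).
have bh A : bounded_measurable A h.
  split; first exact: measurable_funTS.
  exists Mg => x _; rewrite /h ger0_norm ?support_ge0//.
  have [z Kz <-] := support_attained K_body K_sym (grad u x).
  rewrite (le_trans (ler_norm _))// (le_trans (ler_norm_dotv _ _))// ler_pM ?sumr_ge0//.
    by apply: ler_sum => k _; rewrite mxE.
  exact: HMK.
have bu A : bounded_measurable A u by exact: test_function_bm tu.
pose Q x := q0 + q1 * u x + q2 * u x ^+ 2.
have bQ A : bounded_measurable A Q.
  apply: bmD; first (apply: bmD; first exact: bm_cst).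
    by apply: bmM => //; exact: bm_cst.
  by apply: bmM; [exact: bm_cst|exact: bmX].
have bI (f : 'rV[R]_N -> R) A : measurable A -> (mu A < +oo)%E -> bounded_measurable A f ->
  mu.-integrable A (EFin \o f) by exact: bm_integrable.
(* With no facet the polytope would be the whole space, against the boundedness of Omega. *)
have m0 : (0 < m)%N.
  rewrite lt0n; apply/eqP => /size0nil L_nil.
  have [M [Mr HM]] := compact_bounded cO.
  have OM : Omega (const_mx (`|M| + 2)).
    by apply: interior_subset; apply: PL => b; rewrite L_nil.
  have M1 : M < `|M| + 1 by rewrite (le_lt_trans (ler_norm M)) ?ltrDl.
  have := le_trans (coord_le_norm _ (Ordinal N_gt0)) (HM _ M1 _ OM).
  rewrite mxE ger0_norm ?addr_ge0//; lra.
have : 0 <= \int[mu]_(x in polytope a c x0) (h x ^+ 2 + Q x).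
  apply: (polytope_Rintegral_ge0 (Ordinal m0)) => //.
    by apply: bI => //; apply: bmD => //; exact: bmX.
  move=> i; apply: le_trans (cellI i) _.
  have mc := measurable_cell a c x0 i.
  have fc : (mu (cell a c x0 i) < +oo)%E.
    by apply: le_lt_trans fP; apply: le_measure; rewrite ?inE// => x [].
  have bg : bounded_measurable (cell a c x0 i) (fun x => dotv (y i) (grad u x)).
    split; last by exists Mg.
    apply: measurable_funTS; apply: (measurable_is_derive (V := u)).
      by apply: continuous_measurable_rV; exact: test_function_continuous tu.
    by move=> x; exact: class_C1_is_derive (Cu 1%N).
  apply: le_Rintegral => //.
  - by apply: bI => //; apply: bmD => //; exact: bmX.
  - by apply: bI => //; apply: bmD => //; exact: bmX.
  move=> x _; rewrite lerD2r -[leLHS]real_normK ?num_real// lerXn2r ?nnegrE ?support_ge0//.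
  by rewrite dotvC; apply: le_support_norm => //; case: (Hy i).
have CP : C `<=` polytope a c x0.
  by move=> x Cx i; rewrite (le_trans (ltW eta0))// C_eta.
have supp (f : 'rV[R]_N -> R) : (forall x, ~ C x -> f x = 0) ->
    \int[mu]_(x in polytope a c x0) f x = \int[mu]_(x in Omega^°) f x.
  by move=> fC; rewrite (Rintegral_support CP fC) (Rintegral_support CO fC).
rewrite RintegralD//; [|by apply: bI => //; exact: bmX|exact: bI].
rewrite /Q RintegralD//; last 2 first.
- by apply: bI => //; apply: bmD; [exact: bm_cst|apply: bmM => //; exact: bm_cst].
- by apply: bI => //; apply: bmM; [exact: bm_cst|exact: bmX].
rewrite RintegralD//; last 2 first.
- by apply: bI => //; exact: bm_cst.
- by apply: bI => //; apply: bmM => //; exact: bm_cst.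
rewrite !RintegralZl//; [|by apply: bI => //; exact: bmX|exact: bI].
rewrite Rintegral_cst// !supp//; last 2 first.
- by move=> x /uC ->; rewrite expr0n.
- by move=> x /hO ->; rewrite expr0n.
have mPO : fine (mu (polytope a c x0)) <= fine (mu Omega).
  apply: fine_le.
  - by rewrite ge0_fin_numE.
  - by rewrite ge0_fin_numE// Omega_lty.
  apply: le_measure; rewrite ?inE//; first exact: Omega_measurable.
  by move=> x /PO; exact: interior_subset.
have : q0 * fine (mu (polytope a c x0)) <= q0 * fine (mu Omega) by exact: ler_wpM2l.
rewrite -/h; lra.
Qed.

End inradius.

Lemma segment_bounded (R : realType) (f : R -> R) (a b : R) :
  (forall s, a <= s <= b -> {for s, continuous f}) ->
  exists M, forall s, a <= s <= b -> `|f s| <= M.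
Proof.
move=> cf; have [ab|ba] := leP a b; last first.
  by exists 0 => s /andP[h1 h2]; move: (le_trans h1 h2); rewrite leNgt ba.
have cw : {within `[a, b], continuous f}.
  apply: continuous_in_subspaceT => s; rewrite inE /= in_itv/=; exact: cf.
have /compact_bounded[M [Mr HM]] : compact (f @` `[a, b]%classic).
  by apply: continuous_compact => //; exact: segment_compact.
by exists (M + 1) => s sab; apply: HM; [rewrite ltrDl|exists s => //=; rewrite in_itv].
Qed.

Lemma is_derive_continuous (R : realType) (f : R -> R) (x l : R) :
  is_derive x 1 f l -> {for x, continuous f}.
Proof. by move=> D; exact/derivable_continuous/(@ex_derive _ _ _ _ _ _ _ D). Qed.

Lemma le_cvg_seq (R : realType) (f g : nat -> R) (l l' : R) :
  f n @[n --> \oo] --> l -> g n @[n --> \oo] --> l' -> (forall n, f n <= g n) -> l <= l'.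
Proof. by move=> fl gl H; apply: (ler_cvg_to fl gl); exact: nearW. Qed.

Lemma cvgZ_seq (R : realType) (f : nat -> R) (k l : R) :
  f n @[n --> \oo] --> l -> k * f n @[n --> \oo] --> k * l.
Proof. by move=> fl; apply: cvgM => //; exact: cvg_cst. Qed.

Lemma cvgDc_seq (R : realType) (f : nat -> R) (k l : R) :
  f n @[n --> \oo] --> l -> f n + k @[n --> \oo] --> l + k.
Proof. by move=> fl; apply: cvgD => //; exact: cvg_cst. Qed.

Lemma norm_le_max4 (R : realType) (a b c d : R) :
  let m := Num.max (Num.max a b) (Num.max c d) in [/\ a <= m, b <= m, c <= m & d <= m].
Proof. by rewrite /= !le_max !lexx !orbT. Qed.

(** * The two bounds by calibration *)

Section upper_torsion_lower_frequency.
Variables (R : realType) (N : nat) (K Omega : set 'rV[R]_N).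
Hypotheses (N_gt0 : (0 < N)%N) (K_body : convex_body K) (K_sym : origin_symmetric K)
  (Omega_body : convex_body Omega).
Local Notation mu := (@lebesgue_rV R N).
Local Notation r := (inradius K Omega).
Local Notation h := (support_function K).

Let r0 : 0 < r. Proof. exact: inradius_gt0. Qed.

(* The calibration is [V = c cot (c s) u^2], [s] the depth and [c = pi / (2 r)]. *)
Lemma test_function_frequency u : test_function Omega^° u ->
  pi ^+ 2 / 4 * r ^- 2 * \int[mu]_(x in Omega^°) u x ^+ 2 <=
  \int[mu]_(x in Omega^°) h (grad u x) ^+ 2.
Proof.
move=> tu; pose c : R := pi / (2 * r).
have pi0 : 0 < pi :> R by exact: pi_gt0.
have c0 : 0 < c by rewrite divr_gt0// mulr_gt0.
have cr s : 0 < s <= r -> 0 < c * s <= pi / 2.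
  move=> /andP[s0 sr]; rewrite mulr_gt0//= (le_trans (ler_wpM2l (ltW c0) sr))//.
  by rewrite /c le_eqVlt; apply/orP; left; apply/eqP; field; rewrite gt_eqF.
have sp s : 0 < s <= r -> 0 < sin (c * s).
  by move=> /cr/andP[s1 s2]; apply: sin_gt0_pi; rewrite s1 (le_lt_trans s2)// ltr_pdivrMr// ltr_pMr// ltr1n.
pose ka s := c * cos (c * s) / sin (c * s).
pose ka' s := - c ^+ 2 / sin (c * s) ^+ 2.
have Dl (s : R) : is_derive s 1 (fun s => c * s) c.
  have := is_deriveM (is_derive_cst c s (1:R)) (is_derive_id s 1).
  by rewrite scaler0 addr0 [_ *: 1]mulr1.
have Ds (s : R) : is_derive s 1 (sin \o (fun s => c * s)) (cos (c * s) * c).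
  exact: is_derive1_comp (is_derive_sin _) (Dl s).
have Dc (s : R) : is_derive s 1 (cos \o (fun s => c * s)) (- sin (c * s) * c).
  exact: is_derive1_comp (is_derive_cos _) (Dl s).
have Dka s : 0 < s <= r -> is_derive s 1 ka (ka' s).
  move=> sr; have sn0 : sin (c * s) != 0 by rewrite gt_eqF ?sp.
  have D := is_deriveM (is_deriveM (is_derive_cst c s (1:R)) (Dc s)) (is_deriveV (f := sin \o (fun s => c * s)) sn0 (Ds s)).
  apply: (is_derive_eq D); rewrite /ka' /= !fctE /GRing.scale /=.
  have : cos (c * s) ^+ 2 = 1 - sin (c * s) ^+ 2 by rewrite -(cos2Dsin2 (c * s)) addrK.
  move: (cos (c * s)) (sin (c * s)) sn0 => C S S0 CS.
  have -> : - c ^+ 2 / S ^+ 2 = - (c ^+ 2 * S ^+ 2 + c ^+ 2 * (1 - S ^+ 2)) / S ^+ 2.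
    by congr (_ / _); ring.
  by rewrite -CS; field.
have D0 (s : R) : is_derive s 1 (fun _ : R => 0 : R) 0 by exact: is_derive_cst.
have := @web_inequality R N K Omega N_gt0 K_body K_sym Omega_body
  (fun=> 0) (fun=> 0) (fun=> 0) (fun=> 0) ka ka' 0 0 (- c ^+ 2) _ _ _ _ _ Dka _ _ _ _ _ _ _ u tu.
have -> : pi ^+ 2 / 4 * r ^- 2 = c ^+ 2.
  by rewrite /c; field; rewrite gt_eqF.
rewrite !mul0r !addr0 mulNr subr_ge0; apply => //.
- apply: measurable_funM; last first.
    apply: (measurableT_comp (@measurable_inv R)).
    apply: continuous_measurable_fun => s; exact: is_derive_continuous (Ds s).
  apply: measurable_funM => //.
  by apply: continuous_measurable_fun => s; exact: is_derive_continuous (Dc s).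
- move=> eta eta0.
  have rng s : eta <= s <= r -> 0 < s <= r by move=> /andP[/(lt_le_trans eta0) ->].
  have [M1 HM1] := @segment_bounded R ka eta r (fun s sr => is_derive_continuous (Dka s (rng s sr))).
  have [|M2 HM2] := @segment_bounded R ka' eta r.
    move=> s /rng sr; have sn0 : sin (c * s) != 0 by rewrite gt_eqF ?sp.
    apply: cvgM; first exact: cvg_cst.
    apply: cvgV; first by rewrite expf_neq0.
    have cs : {for s, continuous (sin \o (fun s => c * s))} by exact: is_derive_continuous (Ds s).
    exact: (@cvgM _ _ _ _ (sin \o (fun s => c * s)) (sin \o (fun s => c * s))).
  have [m1 m2 m3 _] := @norm_le_max4 R M1 M2 0 0.
  exists (Num.max (Num.max M1 M2) (Num.max 0 0)); split => s sr; first by rewrite normr0.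
  rewrite normr0; split => //; [exact: le_trans (HM1 s sr) _|exact: le_trans (HM2 s sr) _].
(* Here c = pi / (2 r) is forced: the cotangent has to be nonnegative up to s = r, where c s = pi /
   2. *)
- move=> s w sr; have /andP[c1 c2] := cr s sr; rewrite mul0r !add0r -mulrA -expr2 mulr_ge0 ?sqr_ge0//.
  rewrite /ka divr_ge0 ?(ltW (sp s sr))// mulr_ge0 ?(ltW c0)//.
  by apply: cos_ge0_pihalf; rewrite c2 andbT; lra.
- move=> s w p sr; have sn0 : sin (c * s) != 0 by rewrite gt_eqF ?sp.
  (* The Riccati equation of the cotangent; it makes the gap in the pointwise inequality the square
     of p + ka w, zero for w = sin (c s) and p = - c cos (c s). *)
  have E : ka' s = - c ^+ 2 - ka s ^+ 2.
    have : cos (c * s) ^+ 2 = 1 - sin (c * s) ^+ 2 by rewrite -(cos2Dsin2 (c * s)) addrK.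
    rewrite /ka /ka'; move: (cos (c * s)) (sin (c * s)) sn0 => C S S0 CS.
    have -> : (c * C / S) ^+ 2 = c ^+ 2 * C ^+ 2 / S ^+ 2 by field.
    by rewrite CS; field.
  rewrite E; have := sqr_ge0 (p + ka s * w); lra.
Qed.

(* The calibration is [V = s (r^2 / 3 - s^2 / 12) - s u + u^2 / s], [s] the depth. *)
Lemma test_function_torsion u : test_function Omega^° u ->
  2 * \int[mu]_(x in Omega^°) u x <=
  \int[mu]_(x in Omega^°) h (grad u x) ^+ 2 + 3^-1 * r ^+ 2 * fine (mu Omega).
Proof.
move=> tu; pose al s : R := 3^-1 * r ^+ 2 * s - 12^-1 * s ^+ 3.
pose al' s : R := 3^-1 * r ^+ 2 - 4^-1 * s ^+ 2.
have Did (s : R) := is_derive_id s (1:R).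
have Dcst (k s : R) := is_derive_cst k s (1:R).
have Dal (s : R) : is_derive s 1 al (al' s).
  have D := is_deriveB (is_deriveM (Dcst (3^-1 * r ^+ 2) s) (Did s)) (is_deriveM (Dcst 12^-1 s) (is_deriveX 3 (Did s))).
  by apply: (is_derive_eq D); rewrite /al' !fctE /GRing.scale /=; field.
have Dbe (s : R) : is_derive s 1 (fun z : R => - z) (-1) by exact: is_deriveN (Did s).
have Dka s : 0 < s <= r -> is_derive s (1:R) (fun z : R => z^-1) (- s ^- 2).
  move=> /andP[s0 _]; have D := is_deriveV (f := id) (lt0r_neq0 s0) (Did s).
  by apply: (is_derive_eq D); rewrite /GRing.scale /= mulr1.
have := @web_inequality R N K Omega N_gt0 K_body K_sym Omega_body
  al al' (fun s => - s) (fun=> -1) (fun s => s^-1) (fun s => - s ^- 2)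
  (3^-1 * r ^+ 2) (-2) 0 _ _ _ Dal (fun s _ => Dbe s) Dka _ _ _ _ _ _ _ u tu.
rewrite mul0r addr0 => H; rewrite -subr_ge0; move: H; rewrite mulNr.
rewrite -[X in _ -> 0 <= X]addrA [X in _ -> 0 <= _ + X]addrC addrA; apply => //.
- by apply: continuous_measurable_fun => s; exact: is_derive_continuous (Dal s).
- by apply: continuous_measurable_fun => s; exact: is_derive_continuous (Dbe s).
- exact: measurable_inv.
- move=> eta eta0.
  have rng s : eta <= s <= r -> 0 < s <= r by move=> /andP[/(lt_le_trans eta0) ->].
  have [M1 HM1] := @segment_bounded R al (- r) r (fun s _ => is_derive_continuous (Dal s)).
  have [|M2 HM2] := @segment_bounded R al' (- r) r.
    move=> s _; apply: cvgB; first exact: cvg_cst.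
    by apply: cvgM; [exact: cvg_cst|exact: exprn_continuous].
  have [M3 HM3] := @segment_bounded R _ eta r (fun s sr => is_derive_continuous (Dka s (rng s sr))).
  have [|M4 HM4] := @segment_bounded R (fun s : R => - s ^- 2) eta r.
    move=> s /rng/andP[s0 _]; apply: cvgN; apply: cvgV; first by rewrite expf_neq0// gt_eqF.
    exact: exprn_continuous.
  have [m1 m2 m3 m4] := @norm_le_max4 R M1 M2 M3 M4.
  set MM := Num.max _ _ in m1 m2 m3 m4.
  have [n1 n2 n3 _] := @norm_le_max4 R MM r 1 0.
  exists (Num.max (Num.max MM r) (Num.max 1 0)); split => s sr.
    by split; [exact: le_trans (HM1 s sr) (le_trans m1 n1)|exact: le_trans (HM2 s sr) (le_trans m2 n1)].
  have /andP[s0 s1] := rng s sr; split.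
  - by rewrite normrN gtr0_norm// (le_trans s1 n2).
  - by rewrite normrN normr1.
  - exact: le_trans (HM3 s sr) (le_trans m3 n1).
  - exact: le_trans (HM4 s sr) (le_trans m4 n1).
- move=> s /andP[s1 s0]; have -> : al s = s * (3^-1 * r ^+ 2 - 12^-1 * s ^+ 2) by rewrite /al; ring.
  rewrite mulr_le0_ge0 ?(ltW s0)//.
  have : 0 <= (r - s) * (r + s) by rewrite mulr_ge0; lra.
  have := sqr_ge0 s; nra.
- move=> s /andP[s0 s1]; have -> : al s = s * (3^-1 * r ^+ 2 - 12^-1 * s ^+ 2) by rewrite /al; ring.
  rewrite mulr_ge0//; have : 0 <= (r - s) * (r + s) by rewrite mulr_ge0; lra.
  have := sqr_ge0 s; nra.
- move=> s w /andP[s0 s1].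
  (* The coefficient of [al] is adjusted so that the remainder after completing the square vanishes
     at s = r: there the calibration touches 0 at w = r^2 / 2. *)
  have -> : al s + - s * w + s^-1 * w * w = s^-1 * (w - s ^+ 2 / 2) ^+ 2 + 3^-1 * s * (r ^+ 2 - s ^+ 2).
    by rewrite /al; field; rewrite gt_eqF.
  rewrite addr_ge0//; first by rewrite mulr_ge0 ?sqr_ge0// invr_ge0 ltW.
  by rewrite mulr_ge0//; [rewrite mulr_ge0// ltW|nra].
- by move=> s /andP[s0 s1]; rewrite /al' gerBl mulr_ge0// sqr_ge0.
- move=> s w p /andP[s0 s1].
  (* The gap is this square, zero for the one-dimensional torsion function w = r s - s^2 / 2 and p =
     - (r - s). *)
  have := sqr_ge0 (p + w / s - s / 2).
  have -> : (p + w / s - s / 2) ^+ 2 = (p ^+ 2 + (3^-1 * r ^+ 2 + -2 * w + 0 * w ^+ 2))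
     - ((al' s + -1 * w + - s ^- 2 * w * w) - (- s + 2 * s^-1 * w) * p).
    by rewrite /al'; field; rewrite gt_eqF.
  by rewrite subr_ge0.
- by rewrite mulr_ge0 ?sqr_ge0.
Qed.

Lemma W012_frequency u g : W012 Omega^° u g ->
  pi ^+ 2 / 4 * r ^- 2 * \int[mu]_(x in Omega^°) u x ^+ 2 <=
  \int[mu]_(x in Omega^°) h (g x) ^+ 2.
Proof.
move=> W.
have [phi [tphi _ c2 /(_ h (support_lipschitz K_body K_sym)) ch]] :=
  W012_approx (@open_interior _ Omega) (interior_lty Omega_body) W.
apply: (le_cvg_seq (cvgZ_seq (k := pi ^+ 2 / 4 * r ^- 2) c2) ch) => n.
exact: test_function_frequency.
Qed.

(** The inequality for s u, kept for every s: optimizing in s turns a linear-quadratic bound into a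
    bound on the quotient. The factor is inserted at the level of test functions, before the
    limit. *)
Lemma W012_torsion u g (s : R) : W012 Omega^° u g ->
  2 * (s * \int[mu]_(x in Omega^°) u x) <=
  s ^+ 2 * (\int[mu]_(x in Omega^°) h (g x) ^+ 2) + 3^-1 * r ^+ 2 * fine (mu Omega).
Proof.
move=> W; have oO := @open_interior _ Omega; have fO := interior_lty Omega_body.
have mO := open_measurable_rV oO.
have [phi [tphi c1 _ /(_ h (support_lipschitz K_body K_sym)) ch]] := W012_approx oO fO W.
rewrite mulrA; apply: (le_cvg_seq (cvgZ_seq (k := 2 * s) c1)
  (cvgDc_seq (k := 3^-1 * r ^+ 2 * fine (mu Omega)) (cvgZ_seq (k := s ^+ 2) ch))) => n.
have ts : test_function Omega^° ((fun=> s) * phi n).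
  by apply: test_functionM => // k; exact: class_C_cst.
have := test_function_torsion ts.
have -> : \int[mu]_(x in Omega^°) (((fun=> s) * phi n : 'rV[R]_N -> R) x)
    = s * \int[mu]_(x in Omega^°) phi n x.
  rewrite -RintegralZl//; apply: bm_integrable => //; exact: test_function_bm (tphi n).
have -> : \int[mu]_(x in Omega^°) h (grad ((fun=> s) * phi n) x) ^+ 2
    = s ^+ 2 * \int[mu]_(x in Omega^°) h (grad (phi n) x) ^+ 2.
  have Cphi := (tphi n).1 1%N.
  rewrite -RintegralZl//; last first.
    apply: L2_integrable_sqr => //; apply: lipschitz_L2 => //.
      exact: support_lipschitz.
    move=> i; under eq_fun do rewrite mxE.
    by apply: test_function_L2 => //; exact: test_function_partial.
  apply: eq_Rintegral => x _.
  have -> : grad ((fun=> s) * phi n) x = s *: grad (phi n) x.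
    apply/rowP => i; rewrite !mxE /partial deriveM//; last exact: class_C_derivable Cphi.
    by rewrite derive_cst scaler0 addr0.
  by rewrite supportZ// exprMn real_normK ?num_real.
by rewrite mulrA.
Qed.

Lemma torsional_rigidity_le :
  (torsional_rigidity K Omega <= (3^-1 * r ^+ 2 * fine (mu Omega))%:E)%E.
Proof.
apply: ge_ereal_sup => _ [u [g [[W _] ->]]]; rewrite lee_fin.
set I_ := \int[mu]_(x in Omega^°) u x; set E := \int[mu]_(x in Omega^°) _.
set M := 3^-1 * r ^+ 2 * fine (mu Omega).
have E0 : 0 <= E by apply: Rintegral_ge0 => x _; exact: sqr_ge0.
have H s : 2 * (s * I_) <= s ^+ 2 * E + M by exact: W012_torsion.
have M0 : 0 <= M by have := H 0; rewrite mul0r mulr0 expr0n mul0r add0r.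
(* For a zero denominator the quotient is 0 by convention, and M >= 0. *)
have [->|En] := eqVneq E 0; first by rewrite invr0 mulr0.
(* The optimal s. *)
have := H (I_ / E); have -> : (I_ / E) ^+ 2 * E = I_ / E * I_ by field.
by rewrite expr2 -mulrA [_^-1 * I_]mulrC mulrA; lra.
Qed.

Lemma L2_norm_gt0 O u : measurable O -> L2 O u -> ~ ae_zero O u ->
  0 < \int[mu]_(x in O) u x ^+ 2.
Proof.
move=> mO Lu nz; rewrite lt_neqAle Rintegral_ge0 ?andbT => [|x _]; last exact: sqr_ge0.
apply/eqP => /esym E; apply: nz.
have iu := L2_integrable_sqr mO Lu.
have := @ae_eq_integral_abs _ _ _ mu O mO (EFin \o (fun x => u x ^+ 2)) (measurable_int _ iu).
move=> [+ _]; case.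
  under eq_integral do rewrite /= ger0_norm ?sqr_ge0//.
  rewrite -[LHS]fineK; last exact: integrable_fin_num.
  by congr EFin.
move=> A [mA A0 HA]; exists A; split => // x /= nz; apply: HA => /= H; apply: nz => Ox.
by have [/eqP] := H Ox; rewrite sqrf_eq0 => /eqP.
Qed.

Lemma principal_frequency_ge :
  ((pi ^+ 2 / 4 * r ^- 2)%:E <= principal_frequency K Omega)%E.
Proof.
apply: le_ereal_inf_tmp => _ [u [g [[W nz] ->]]]; rewrite lee_fin.
have mO := open_measurable_rV (@open_interior _ Omega).
rewrite ler_pdivlMr; first exact: W012_frequency.
by apply: L2_norm_gt0 => //; case: W => -[].
Qed.

End upper_torsion_lower_frequency.

(** * Gauges and their smoothing *)

Section homogeneous.
Variables (R : realType) (N : nat).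
Local Notation mu := (@lebesgue_rV R N).
Variables (x0 : 'rV[R]_N) (J : 'rV[R]_N -> R).
Hypotheses (J_ge0 : forall x, 0 <= J x) (J_cont : continuous J)
  (J_hom : forall x t, 0 <= t -> J (x0 + t *: (x - x0)) = t * J x).
Let P : set 'rV[R]_N := [set x | J x <= 1].
Hypothesis P_bounded : bounded_set P.

Let sublevel (t : R) : set 'rV[R]_N := [set x | J x <= t].

Let msublevel t : measurable (sublevel t).
Proof.
rewrite (_ : sublevel t = setT `&` J @^-1` [set` `]-oo, t] ]).
  exact: continuous_measurable_rV.
by rewrite setTI; apply/seteqP; split => x /=; rewrite in_itv.
Qed.

Let fP : (mu P < +oo)%E.
Proof. by apply: bounded_lebesgue_rV_lty => //; exact: msublevel. Qed.

Let sublevel_preimage t : 0 < t ->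
  P = (fun x => (x0 - t *: x0) + t *: x) @^-1` (sublevel t).
Proof.
move=> t0; apply/seteqP; split => x /=; rewrite /P /sublevel /=.
  have -> : x0 - t *: x0 + t *: x = x0 + t *: (x - x0) by rewrite scalerBr addrAC addrA.
  by rewrite J_hom ?(ltW t0)// ger_pMr.
have -> : x0 - t *: x0 + t *: x = x0 + t *: (x - x0) by rewrite scalerBr addrAC addrA.
by rewrite J_hom ?(ltW t0)// ger_pMr.
Qed.

Let sublevel_measure t : 0 < t -> mu (sublevel t) = ((t ^+ N)%:E * mu P)%E.
Proof.
move=> t0; rewrite (sublevel_preimage t0) lebesgue_rV_affine//.
by rewrite muleA -EFinM mulfV ?mul1e// expf_neq0// gt_eqF.
Qed.

Let fsublevel t : 0 < t -> (mu (sublevel t) < +oo)%E.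
Proof.
move=> t0; rewrite sublevel_measure// lte_mul_pinfty//.
by rewrite lee_fin exprn_ge0// ltW.
Qed.

Variables (q dq : R -> R).
Hypotheses (Dq : forall s : R, is_derive s 1 q (dq s)) (dq_cont : continuous dq) (q1 : q 1 = 0).

Let q_cont : continuous q.
Proof. by move=> s; exact: is_derive_continuous (Dq s). Qed.

Let bm_comp (f : R -> R) t : continuous f -> bounded_measurable (sublevel t) (f \o J).
Proof.
move=> cf; split.
  apply: measurable_funTS; apply: measurableT_comp.
    exact: continuous_measurable_fun.
  exact: continuous_measurable_rV.
have [M HM] := @segment_bounded R f 0 t (fun s _ => cf s).
by exists M => x xt; apply: HM; rewrite J_ge0.
Qed.

(** At s = J x: the pullback of q (J) under the dilation of ratio 1 + h about x0, with its
    Jacobian. *)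
Let dilation (h s : R) := (1 + h) ^+ N * q ((1 + h) * s).
Let ddilation (h s : R) :=
  N%:R * (1 + h) ^+ N.-1 * q ((1 + h) * s) + (1 + h) ^+ N * (s * dq ((1 + h) * s)).

Let is_derive_dilation (s h : R) : is_derive h 1 (dilation ^~ s) (ddilation h s).
Proof.
have D1 : is_derive h (1:R) (fun h : R => 1 + h) 1.
  by have := is_deriveD (is_derive_cst (1:R) h (1:R)) (is_derive_id h 1); rewrite add0r.
have D2 : is_derive h (1:R) (fun h : R => (1 + h) * s) s.
  have := is_deriveM D1 (is_derive_cst s h (1:R)).
  by rewrite scaler0 add0r /GRing.scale /= mulr1.
have D3 := @is_derive1_comp R q (fun h : R => (1 + h) * s) h _ _ (Dq _) D2.
rewrite (_ : dilation ^~ s = (fun h : R => 1 + h) ^+ N * (q \o (fun h : R => (1 + h) * s))).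
  apply: (is_derive_eq (is_deriveM (is_deriveX N D1) D3)).
  by rewrite /ddilation !fctE /GRing.scale /=; ring.
by apply/funext => z; rewrite /dilation !fctE.
Qed.

Let ddilation_bounded : exists M, forall h s, 0 <= h <= 1 -> 0 <= s <= 1 -> `|ddilation h s| <= M.
Proof.
have [M1 HM1] := @segment_bounded R q 0 2 (fun s _ => @q_cont s).
have [M2 HM2] := @segment_bounded R dq 0 2 (fun s _ => @dq_cont s).
exists (N%:R * 2 ^+ N.-1 * M1 + 2 ^+ N * (1 * M2)) => h s /andP[h0 h1] /andP[s0 s1].
have hs : 0 <= (1 + h) * s <= 2 by apply/andP; split; nra.
have h2 k : `|(1 + h) ^+ k| <= 2 ^+ k.
  by rewrite normrX lerXn2r ?nnegrE// ger0_norm; lra.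
rewrite (le_trans (ler_normD _ _))// lerD//.
  by rewrite normrM ler_pM// ?HM1// normrM ler_pM// normr_nat.
by rewrite normrM ler_pM// normrM ler_pM// ?HM2// ger0_norm.
Qed.

(* Dilating [P] by [1 + h] and differentiating at [h = 0] the integral of [q (J)];
   the layer between [P] and its dilate is negligible to first order as [q 1 = 0]. *)
Lemma homogeneous_identity :
  \int[mu]_(x in P) (N%:R * q (J x) + J x * dq (J x)) = 0.
Proof.
pose h (n : nat) : R := n.+1%:R^-1.
have h_gt0 n : 0 < h n by rewrite invr_gt0.
have h_le1 n : h n <= 1 by rewrite invf_le1 ?ler1n.
pose f n x := (h n)^-1 * (dilation (h n) (J x) - dilation 0 (J x)).
have [M HM] := ddilation_bounded.
have mP : measurable P by exact: msublevel.
have qJ_cont (c : R) : continuous (fun s : R => q ((1 + c) * s)).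
  move=> s; apply: continuous_comp; last exact: q_cont.
  by apply: cvgM; [exact: cvg_cst|exact: cvg_id].
have bd c : bounded_measurable P (fun x => dilation c (J x)).
  apply: bmM; first exact: bm_cst.
  exact: (@bm_comp (fun s => q ((1 + c) * s)) 1).
have bf n : bounded_measurable P (f n).
  by apply: bmM; [exact: bm_cst|exact: bmB].
have fM n x : P x -> `|f n x| <= M.
  move=> Px; have [|||c] := @MVT_segment R (dilation ^~ (J x)) (fun t => ddilation t (J x)) 0 (h n).
  - exact: ltW.
  - by move=> t _; exact: is_derive_dilation.
  - apply: derivable_within_continuous => t _.
    exact: (@ex_derive _ _ _ _ _ _ _ (is_derive_dilation (J x) t)).
  rewrite in_itv/= subr0 => /andP[c0 ch] E.
  rewrite /f E mulrC mulfK ?gt_eqF//; apply: HM; first by rewrite c0 (le_trans ch).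
  by rewrite J_ge0.
have fcvg x : P x -> f n x @[n --> \oo] --> N%:R * q (J x) + J x * dq (J x).
  move=> Px; have D := is_derive_dilation (J x) 0.
  have := cvg_difference_quotient (fun n => lt0r_neq0 (h_gt0 n)) (@cvg_harmonic R) D.
  by rewrite /ddilation addr0 !expr1n mulr1 !mul1r.
have L := bounded_cvg_Rintegral mP fP (fun n => (bf n).1) fcvg fM.
have [B HB] := @segment_bounded R dq 0 2 (fun s _ => @dq_cont s).
have B0 : 0 <= B by apply: le_trans (HB 0 _) => //; rewrite lexx ler0n.
(* After the change of variables only the layer 1 < J <= 1 + h contributes. There |q (J)| <= B h
   because q 1 = 0, and the layer has measure of order h; one power of h survives the division by
   h. *)
have key n : `|\int[mu]_(x in P) f n x| <= B * (N%:R * 2 ^+ N) * fine (mu P) * h n.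
  have h1 : 0 < 1 + h n by rewrite addr_gt0.
  have PT : P `<=` sublevel (1 + h n) by move=> x; rewrite /P /sublevel /=; have := h_gt0 n; lra.
  have mT := msublevel (1 + h n); have fT := fsublevel h1.
  have mD : measurable (sublevel (1 + h n) `\` P) by exact: measurableD.
  have iT : mu.-integrable (sublevel (1 + h n)) (EFin \o (q \o J)).
    by apply: bm_integrable => //; exact: bm_comp.
  have iP : mu.-integrable P (EFin \o (q \o J)) by apply: bm_integrable => //; exact: (@bm_comp _ 1).
  have iPh : mu.-integrable P (EFin \o (fun x => q ((1 + h n) * J x))).
    by apply: bm_integrable => //; exact: (@bm_comp (fun s => q ((1 + h n) * s)) 1).
  have E1 : \int[mu]_(x in P) q ((1 + h n) * J x) =
      (1 + h n) ^- N * \int[mu]_(x in sublevel (1 + h n)) q (J x).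
    rewrite -(integral_affine (x0 - (1 + h n) *: x0) h1 mT iT) -sublevel_preimage//.
    apply: eq_Rintegral => x _ /=; rewrite -J_hom ?(ltW h1)//; congr (q (J _)).
    by rewrite scalerBr addrA addrAC.
  have E2 : \int[mu]_(x in P) f n x = (h n)^-1 * \int[mu]_(x in sublevel (1 + h n) `\` P) q (J x).
    rewrite /f RintegralZl//; last by apply: bm_integrable => //; exact: bmB.
    congr (_ * _); rewrite RintegralB//; [|exact: bm_integrable..].
    rewrite /dilation.
    under [X in _ - X]eq_Rintegral do rewrite addr0 expr1n !mul1r.
    rewrite RintegralZl// E1 mulrA mulfV ?mul1r; last by rewrite expf_neq0// gt_eqF.
    rewrite -[in X in X - _](setDUK PT) Rintegral_setU//.
    - by rewrite addrAC subrr add0r.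
    - by rewrite setDUK.
    - by apply/disj_setPS => x [] Px [_].
  have mDE : fine (mu (sublevel (1 + h n) `\` P)) = ((1 + h n) ^+ N - 1) * fine (mu P).
    have -> : mu (sublevel (1 + h n) `\` P) = (mu (sublevel (1 + h n)) - mu P)%E.
      by rewrite measureD ?setIidr.
    rewrite (sublevel_measure h1).
    have : mu P \is a fin_num by rewrite ge0_fin_numE.
    by move=> /fineK <-; rewrite -EFinM -EFinB /= mulrBl mul1r.
  have fD : (mu (sublevel (1 + h n) `\` P) < +oo)%E.
    by apply: le_lt_trans fT; apply: le_measure; rewrite ?inE// => x [].
  have iD : mu.-integrable (sublevel (1 + h n) `\` P) (EFin \o (q \o J)).
    by apply: integrableS iT => // x [].
  have bD : `|\int[mu]_(x in sublevel (1 + h n) `\` P) q (J x)| <= B * h n * fine (mu (sublevel (1 + h n) `\` P)).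
    apply: le_trans (le_normr_Rintegral mD iD) _.
    rewrite -Rintegral_cst//; apply: le_Rintegral => //.
    - exact: integrable_norm.
    - by apply: bm_integrable => //; exact: bm_cst.
    move=> x [xT /negP]; rewrite -ltNge => x1.
    have qw : {within `[1, J x], continuous q} by exact: continuous_subspaceT.
    have [c] := @MVT_segment R q dq 1 (J x) (ltW x1) (fun t _ => Dq t) qw.
    rewrite in_itv/= q1 subr0 => /andP[c1 cJ] ->; rewrite normrM ler_pM//.
      apply: HB; rewrite (le_trans ler01)//= (le_trans cJ)// (le_trans xT)//.
      by have := h_le1 n; lra.
    by rewrite ger0_norm ?subr_ge0 ?(ltW x1)// lerBlDl.
  have pw : (1 + h n) ^+ N - 1 <= N%:R * 2 ^+ N * h n.
    rewrite -[X in _ - X](expr1n _ N) subrXX addrAC subrr add0r mulrC ler_wpM2r ?(ltW (h_gt0 n))//.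
    rewrite mulr_natl -[X in _ *+ X]card_ord -sumr_const; apply: ler_sum => i _.
    rewrite expr1n mulr1 (@le_trans _ _ (2 ^+ (N.-1 - i)))//.
      by rewrite lerXn2r ?nnegrE//; have := h_le1 n; have := h_gt0 n; lra.
    rewrite ler_weXn2l ?ler1n// (leq_trans (leq_subr _ _))// leq_pred//.
  have mP0 : 0 <= fine (mu P) by exact: fine_ge0.
  rewrite E2 normrM gtr0_norm ?invr_gt0// ler_pdivrMl//.
  rewrite (le_trans bD)// mDE.
  apply: (@le_trans _ _ (B * h n * (N%:R * 2 ^+ N * h n * fine (mu P)))).
    by rewrite ler_wpM2l ?mulr_ge0 ?(ltW (h_gt0 n))// ler_wpM2r.
  by rewrite le_eqVlt; apply/orP; left; apply/eqP; ring.
apply/eqP; rewrite -normr_eq0 eq_le normr_ge0 andbT.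
have h0 : B * (N%:R * 2 ^+ N) * fine (mu P) * h n @[n --> \oo] -->
    B * (N%:R * 2 ^+ N) * fine (mu P) * 0 by apply: cvgZ_seq; exact: cvg_harmonic.
rewrite mulr0 in h0; apply: (le_cvg_seq _ h0 key).
exact: cvg_norm.
Qed.

End homogeneous.

(** * Smooth functions of one variable and a smooth positive part *)

Section smooth_functions.
Variable R : realType.
Implicit Types (D : set R) (f g : R -> R) (p : {poly R}).

Lemma eq_diff_on D k f g : open D -> (forall z, D z -> f z = g z) ->
  diff_on D k f -> diff_on D k g.
Proof.
move=> oD; elim: k f g => [|k IH] f g fg.
  move=> cf z Dz; have := cf z Dz; rewrite /prop_for /continuous_at (fg z Dz).
  apply: cvg_trans.
  apply: near_eq_cvg; apply: filterS (open_nbhs_nbhs (conj oD Dz)) => y Dy.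
  by rewrite fg.
have near_fg z : D z -> \near z, f z = g z.
  by move=> Dz; apply: filterS (open_nbhs_nbhs (conj oD Dz)) => y /fg.
move=> [df Df]; split => [z Dz|].
  exact: near_eq_derivable (near_fg z Dz) (df z Dz).
apply: IH Df => z Dz; rewrite !derive1E; exact: near_eq_derive (near_fg z Dz).
Qed.

Lemma diff_on_horner p k : diff_on setT k (horner p).
Proof.
elim: k p => [|k IH] p /=; first by move=> z _; exact: continuous_horner.
by split => [z _|]; [exact: derivable_horner|rewrite -derivE; exact: IH].
Qed.

Lemma diff_on_expR k : diff_on setT k (@expR R).
Proof.
have E : derive1 (@expR R) = expR.
  by apply/funext => z; rewrite derive1E; exact: (@derive_val _ _ _ _ _ _ _ (is_derive_expR z)).
elim: k => [|k IH] /=; first by move=> z _; exact: continuous_expR.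
by split => [z _|]; [exact: derivable_expR|rewrite E].
Qed.

Let pos : set R := [set z | 0 < z].
Let pos_open : open pos. Proof. exact: open_gt. Qed.

Lemma diff_on_inv k (c : R) n : diff_on pos k (fun z => c * z ^- n).
Proof.
have D (d : R) m (z : R) : 0 < z -> is_derive z (1:R) (fun z : R => d * z ^- m) (- d * m%:R * z ^- m.+1).
  move=> z0; have zn : z ^+ m != 0 by rewrite expf_neq0// gt_eqF.
  have Dx : is_derive z (1:R) (fun z : R => z ^+ m) (m%:R * z ^+ m.-1).
    rewrite (_ : (fun z : R => z ^+ m) = id ^+ m); last by apply/funext => y; rewrite fctE.
    by apply: (is_derive_eq (is_deriveX m (is_derive_id z (1:R)))); rewrite [_ *: 1]mulr1.
  have H := is_deriveM (is_derive_cst d z (1:R)) (is_deriveV (f := fun z : R => z ^+ m) zn Dx).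
  apply: (is_derive_eq H); rewrite !fctE /GRing.scale /= mulr0 addr0.
  case: m zn {H Dx} => [|m] zn; first by rewrite ?mulr0n !(mul0r, mulr0).
  rewrite /= !exprS; field; rewrite ?expf_neq0 ?(gt_eqF z0)//.
elim: k c n => [|k IH] c n /=.
  by move=> z /= z0; exact: is_derive_continuous (D c n z z0).
split => [z /= z0|]; first exact: (@ex_derive _ _ _ _ _ _ _ (D c n z z0)).
apply: (@eq_diff_on _ _ (fun z => - c * n%:R * z ^- n.+1)) => //.
by move=> z /= z0; rewrite derive1E (@derive_val _ _ _ _ _ _ _ (D c n z z0)).
Qed.

Lemma diff_on_ln k : diff_on pos k (@ln R).
Proof.
case: k => [|k] /=; first by move=> z /= z0; exact: is_derive_continuous (is_derive1_ln z0).
split => [z /= z0|]; first exact: (@ex_derive _ _ _ _ _ _ _ (is_derive1_ln z0)).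
apply: (@eq_diff_on _ _ (fun z => 1 * z ^- 1)) (diff_on_inv k 1 1) => //.
by move=> z /= z0; rewrite derive1E (@derive_val _ _ _ _ _ _ _ (is_derive1_ln z0)) mul1r.
Qed.

Variables (e : R) (e0 : 0 < e).

(** The polynomial factor makes this family of flat functions stable under differentiation, p
    becoming X^2 (e p - p'), so that smoothness is a single induction. *)
Definition flat p (z : R) : R := if 0 < z then p.[z^-1] * expR (- e * z^-1) else 0.

(** Induction on the polynomial with n free, since multiplication by X raises n; each monomial is
    absorbed by (e y)^n / n! <= exp (e y). *)
Lemma poly_expR_bounded p n : exists C, forall y, 0 <= y ->
  y ^+ n * `|p.[y]| * expR (- e * y) <= C.
Proof.
elim/poly_ind: p n => [|p c IH] n.
  by exists 0 => y _; rewrite horner0 normr0 mulr0 mul0r.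
have [C HC] := IH n.+1.
exists (C + `|c| * (n`!%:R / e ^+ n)) => y y0.
rewrite hornerMXaddC.
have yn : 0 <= y ^+ n by rewrite exprn_ge0.
apply: (@le_trans _ _ (y ^+ n.+1 * `|p.[y]| * expR (- e * y) + `|c| * (y ^+ n * expR (- e * y)))).
  have -> : y ^+ n.+1 * `|p.[y]| * expR (- e * y) + `|c| * (y ^+ n * expR (- e * y)) =
    y ^+ n * (`|p.[y] * y| + `|c|) * expR (- e * y).
    by rewrite normrM (ger0_norm y0) exprS; ring.
  by rewrite ler_wpM2r ?expR_ge0// ler_wpM2l// ler_normD.
rewrite lerD ?HC// ler_wpM2l//.
have ey0 : 0 <= e * y by rewrite mulr_ge0// ltW.
have H : (e * y) ^+ n / n`!%:R <= expR (e * y).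
  case: n {IH HC yn} => [|n]; first by rewrite expr0 fact0 divr1 -expR0 ler_expR.
  by apply: le_trans (expR_ge1Dxn n ey0); rewrite lerDr.
have nf : 0 < n`!%:R :> R by rewrite ltr0n fact_gt0.
have en : 0 < e ^+ n by rewrite exprn_gt0.
have : y ^+ n * expR (- e * y) <= n`!%:R / e ^+ n.
  rewrite mulNr expRN ler_pdivrMr ?expR_gt0//.
  rewrite -ler_pdivrMl ?divr_gt0// (le_trans _ H)// le_eqVlt; apply/orP; left; apply/eqP.
  by rewrite exprMn; field; rewrite !gt_eqF.
by [].
Qed.

Lemma flat_cvg0 p : h^-1 * flat p h @[h --> (0:R)^'] --> 0.
Proof.
(* Two powers of 1 / h: one for the quotient by h, one to leave a factor h that tends to 0. *)
have [C HC] := poly_expR_bounded p 2.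
have C0 : 0 <= C by have := HC 0 (lexx _); rewrite expr0n /= !mul0r.
apply/cvgrPdist_le => d d0; near=> h.
rewrite sub0r normrN /flat; case: ifPn => [h0|_]; last by rewrite mulr0 normr0 ltW.
have hi : 0 <= h^-1 by rewrite invr_ge0 ltW.
have H := HC _ hi; rewrite normrM ger0_norm// normrM [X in _ * (_ * X)]ger0_norm ?expR_ge0//.
have -> : h^-1 * (`|p.[h^-1]| * expR (- e * h^-1)) = h * (h^-1 ^+ 2 * `|p.[h^-1]| * expR (- e / h)).
  by field; rewrite gt_eqF.
apply: (@le_trans _ _ (h * C)); first by rewrite ler_wpM2l// ltW.
have hd : `|h| < d / (C + 1).
  by near: h; apply: dnbhs0_lt; rewrite divr_gt0// ltr_wpDl.
apply: (@le_trans _ _ (`|h| * (C + 1))).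
  by rewrite ler_pM ?ler_norm ?(ltW h0)// lerDl.
by rewrite -ler_pdivlMr ?ltW// ltr_wpDl.
Unshelve. all: by end_near. Qed.

Lemma is_derive_flat p (z : R) : is_derive z 1 (flat p) (flat ('X^2 * (e *: p - p^`())) z).
Proof.
have [z0|z0|->] := ltgtP z 0.
- have E : \near z, cst 0 z = flat p z.
    apply: filterS (open_nbhs_nbhs (conj (@open_lt R 0) (z0 : [set z | z < 0] z))) => y /= y0.
    by rewrite /flat ltNge (ltW y0).
  rewrite {2}/flat ltNge (ltW z0) /=.
  exact: near_eq_is_derive E (is_derive_cst _ _ _).
- have E : \near z, p.[z^-1] * expR (- e * z^-1) = flat p z.
    apply: filterS (open_nbhs_nbhs (conj (@open_gt R 0) (z0 : [set z | 0 < z] z))) => y /= y0.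
    by rewrite /flat y0.
  apply: near_eq_is_derive E _; have zn0 := lt0r_neq0 z0.
  have Di : is_derive z (1:R) (fun z : R => z^-1) (- z ^- 2).
    have D := is_deriveV (f := id) zn0 (is_derive_id z (1:R)).
    by apply: (is_derive_eq D); rewrite /GRing.scale /= mulr1.
  have Dp := @is_derive1_comp R (horner p) (fun z : R => z^-1) z _ _ (is_derive_poly p z^-1) Di.
  have De1 := is_deriveM (is_derive_cst (- e) z (1:R)) Di.
  have De := @is_derive1_comp R expR _ z _ _ (is_derive_expR _) De1.
  apply: (is_derive_eq (is_deriveM Dp De)).
  rewrite /flat z0 !hornerE /= !fctE /GRing.scale /=; field => //.
rewrite {2}/flat ltxx.
suff H : h^-1 *: (flat p (h *: 1 + 0) - flat p 0) @[h --> (0:R)^'] --> 0.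
  by constructor; [apply/cvg_ex; eexists; exact: H|exact: cvg_lim H].
apply: cvg_trans (flat_cvg0 p); apply: near_eq_cvg; apply: nearW => h.
by rewrite addr0 [flat p 0]/flat ltxx subr0 [h *: 1]mulr1.
Qed.

Lemma diff_on_flat p k : diff_on setT k (flat p).
Proof.
elim: k p => [|k IH] p /=; first by move=> z _; exact: is_derive_continuous (is_derive_flat p z).
split => [z _|]; first exact: (@ex_derive _ _ _ _ _ _ _ (is_derive_flat p z)).
rewrite (_ : derive1 (flat p) = flat ('X^2 * (e *: p - p^`()))); first exact: IH.
by apply/funext => z; rewrite derive1E (@derive_val _ _ _ _ _ _ _ (is_derive_flat p z)).
Qed.

(** Used through z * bump z, a smooth substitute for the positive part of z: within e of it, zero
    for z <= 0, and with slope in [0, 1], so that composing with it does not increase gradients. *)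
Definition bump := flat 1.

Lemma bumpE z : bump z = if 0 < z then expR (- e / z) else 0.
Proof. by rewrite /bump /flat hornerC mul1r. Qed.

Lemma derive1_bump z : derive1 bump z = if 0 < z then e / z ^+ 2 * expR (- e / z) else 0.
Proof.
rewrite derive1E (@derive_val _ _ _ _ _ _ _ (is_derive_flat 1 z)) /flat.
by case: ifP => // z0; rewrite !hornerE derivC !hornerE /=; congr (_ * _); field; rewrite gt_eqF.
Qed.

Lemma bump_lower z : 0 < z -> z - e <= z * bump z <= z.
Proof.
move=> z0; rewrite bumpE z0; apply/andP; split.
  have := expR_ge1Dx (- e / z) => H.
  have : z * (1 + - e / z) <= z * expR (- e / z) by rewrite ler_wpM2l// ltW.
  by have -> : z * (1 + - e / z) = z - e by field; rewrite gt_eqF.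
rewrite ler_piMr ?(ltW z0)// -[leRHS]expR0 ler_expR mulNr oppr_le0.
by rewrite divr_ge0 ?(ltW z0) ?(ltW e0).
Qed.

(* The derivative of [z * bump z] is [exp (- e / z) (1 + e / z) <= 1]. *)
Lemma bump_slope z : 0 <= bump z + z * derive1 bump z <= 1.
Proof.
rewrite bumpE derive1_bump; case: ifPn => [z0|_]; last by rewrite mulr0 addr0 lexx ler01.
have -> : expR (- e / z) + z * (e / z ^+ 2 * expR (- e / z)) = (1 + e / z) * expR (- e / z).
  by field; rewrite gt_eqF.
have ez : 0 <= e / z by rewrite divr_ge0 ?(ltW z0) ?(ltW e0).
rewrite mulr_ge0 ?expR_ge0 ?addr_ge0//=.
rewrite mulNr expRN ler_pdivrMr ?expR_gt0// mul1r.
exact: expR_ge1Dx.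
Qed.

End smooth_functions.

Lemma near_eq_continuous (R : realType) (V : normedModType R) (u v : V -> R) (x : V) :
  (\near x, v x = u x) -> {for x, continuous v} -> {for x, continuous u}.
Proof.
move=> vu; rewrite /prop_for /continuous_at -(nbhs_singleton vu); apply: cvg_trans.
by apply: near_eq_cvg; apply: filterS vu => y ->.
Qed.

Section local_class_C.
Variables (R : realType) (N : nat).
Implicit Types (u v : 'rV[R]_N -> R) (x : 'rV[R]_N).

Lemma near_partial u v x i : (\near x, v x = u x) -> partial i u x = partial i v x.
Proof. by move=> H; rewrite /partial; apply: near_eq_derive; apply: filterS H. Qed.

Lemma class_C_local k u :
  (forall x, exists2 v, class_C k v & \near x, v x = u x) -> class_C k u.
Proof.
elim: k u => [|k IH] u H; split => //.
- by move=> x; have [v [cv _] vu] := H x; exact: near_eq_continuous vu (cv x).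
- move=> x; have [v Cv vu] := H x.
  exact: near_eq_continuous vu (class_C_continuous Cv (x := x)).
move=> i; split => [x|].
  have [v Cv vu] := H x.
  exact: near_eq_derivable vu (class_C_derivable Cv).
apply: IH => x; have [v Cv vu] := H x.
exists (partial i v); first exact: class_C_partial.
have := nbhs_interior vu; apply: filterS => y Hy.
by rewrite (near_partial _ Hy).
Qed.

End local_class_C.

(** * Gauge of a polytope and its log-sum-exp *)

Section gauge.
Variables (R : realType) (N : nat) (L : seq 'rV[R]_N) (x0 : 'rV[R]_N).
Implicit Types (x a : 'rV[R]_N).
Local Notation lin a x := (dotv a (x - x0)).

(** The gauge about x0 of the polytope cut out by the inequalities [lin a] <= 1; starting the
    maximum at 0 makes it nonnegative for any list. *)
Definition pgauge x : R := \big[Num.max/0]_(a <- L) lin a x.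

Lemma pgauge_ge0 x : 0 <= pgauge x.
Proof.
rewrite /pgauge; elim: L => [|a s IH]; first by rewrite big_nil.
by rewrite big_cons le_max IH orbT.
Qed.

Lemma le_pgauge a x : a \in L -> lin a x <= pgauge x.
Proof.
rewrite /pgauge; elim: L => [//|b s IH]; rewrite inE big_cons le_max => /predU1P[->|/IH ->].
  by rewrite lexx.
by rewrite orbT.
Qed.

Lemma pgauge_le x (c : R) : 0 <= c -> (forall a, a \in L -> lin a x <= c) -> pgauge x <= c.
Proof.
move=> c0; rewrite /pgauge; elim: L => [|b s IH] H; first by rewrite big_nil.
rewrite big_cons ge_max H ?mem_head// IH// => a asn; apply: H.
by rewrite inE asn orbT.
Qed.

Lemma pgauge_continuous : continuous pgauge.
Proof.
rewrite (_ : pgauge = fun x => \big[Num.max/0]_(a <- L) lin a x)//.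
elim: L => [|a s IH].
  by under eq_fun do rewrite big_nil; exact: cst_continuous.
rewrite (_ : (fun x => _) = (fun x => lin a x) \max (fun x => \big[Num.max/0]_(b <- s) lin b x)).
  by move=> x; apply: continuous_max; [exact: dotv_continuous|exact: IH].
by apply/funext => x; rewrite big_cons.
Qed.

Lemma pgauge_hom x t : 0 <= t -> pgauge (x0 + t *: (x - x0)) = t * pgauge x.
Proof.
move=> t0; rewrite /pgauge; elim: L => [|a s IH]; first by rewrite !big_nil mulr0.
rewrite !big_cons IH maxr_pMr//; congr Num.max.
by rewrite addrAC subrr add0r dotvZr.
Qed.

Section log_sum_exp.
Variables (p : R) (p0 : 0 < p).

(** The summand 1 is the exponential of the 0 in the maximum that defines the gauge. *)
Definition sumexp x : R := 1 + \sum_(a <- L) expR (p * lin a x).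

(* Exceeds the gauge by at most [p^-1 * ln (1 + size L)]. *)
Definition softmax x : R := p^-1 * ln (sumexp x).

Lemma sumexp_ge1 x : 1 <= sumexp x.
Proof. by rewrite lerDl sumr_ge0// => a _; exact: expR_ge0. Qed.

Lemma sumexp_gt0 x : 0 < sumexp x.
Proof. exact: lt_le_trans (sumexp_ge1 x). Qed.

Let lin_class_C k a : class_C k (fun x => p * lin a x).
Proof.
rewrite (_ : (fun x => _) = (fun=> p) * (fun x => lin a x)) //.
by apply: class_CM; [exact: class_C_cst|exact: class_C_dot].
Qed.

Lemma class_C_sumexp k : class_C k sumexp.
Proof.
rewrite (_ : sumexp = (fun=> 1) + (fun x => \sum_(a <- L) expR (p * lin a x))) //.
apply: class_CD; first exact: class_C_cst.
apply: class_C_sum => a.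
by apply: (@class_C_comp _ _ setT k expR (fun x => p * lin a x)) => //; exact: diff_on_expR.
Qed.

Lemma class_C_softmax k : class_C k softmax.
Proof.
rewrite (_ : softmax = (fun=> p^-1) * (@ln R \o sumexp)) //.
apply: class_CM; first exact: class_C_cst.
apply: (@class_C_comp _ _ [set z | 0 < z]); [exact: class_C_sumexp|exact: sumexp_gt0|exact: diff_on_ln].
Qed.

Lemma partial_lin a i x : partial i (fun x => p * lin a x) x = p * a ord0 i.
Proof.
have D : is_derive x (delta_mx ord0 i) (fun x => p * lin a x) (p * a ord0 i).
  apply/is_derive_lineP.
  rewrite (_ : (fun h => _) = (fun h : R => h * (p * a ord0 i) + p * lin a x)); last first.
    apply/funext => h; rewrite -addrA (dotvDr _ (h *: _)) dotvZr [dotv a (delta_mx _ _)]dotvC dotv_delta; ring.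
  have := is_deriveD (is_deriveM (is_derive_id (0:R) 1) (is_derive_cst (p * a ord0 i) (0:R) (1:R)))
     (is_derive_cst (p * lin a x) (0:R) (1:R)).
  by rewrite /= addr0 scale0r add0r [_ *: 1]mulr1.
exact: (@derive_val _ _ _ _ _ _ _ D).
Qed.

Lemma partial_sumexp i x :
  partial i sumexp x = \sum_(a <- L) p * a ord0 i * expR (p * lin a x).
Proof.
have De a : is_derive x (delta_mx ord0 i) (fun x => expR (p * lin a x)) (p * a ord0 i * expR (p * lin a x)).
  rewrite mulrC; apply: (@is_derive_compr _ _ expR (fun x => p * lin a x)).
  by rewrite -(partial_lin a i x); apply: derivableP; exact: class_C_derivable (lin_class_C 1 a).
have D s : is_derive x (delta_mx ord0 i) (fun x => \sum_(a <- s) expR (p * lin a x))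
    (\sum_(a <- s) p * a ord0 i * expR (p * lin a x)).
  elim: s => [|a s IH].
    by rewrite big_nil; under eq_fun do rewrite big_nil; exact: is_derive_cst.
  rewrite big_cons (_ : (fun x => _) = (fun x => expR (p * lin a x)) + (fun x => \sum_(a <- s) expR (p * lin a x))).
    exact: is_deriveD.
  by apply/funext => z; rewrite big_cons.
have D1 := is_deriveD (is_derive_cst (1:R) x (delta_mx ord0 i)) (D L).
by rewrite add0r in D1; exact: (@derive_val _ _ _ _ _ _ _ D1).
Qed.

(** The reason for this smoothing: the gradient is a combination of the normals with nonnegative
    weights of sum at most 1, so its support value is at most the largest one among the normals. *)
Lemma grad_softmax x :
  grad softmax x = \sum_(a <- L) (expR (p * lin a x) / sumexp x) *: a.
Proof.
apply/rowP => i; rewrite mxE summxE.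
have Dl : is_derive x (delta_mx ord0 i) softmax (p^-1 * ((sumexp x)^-1 * partial i sumexp x)).
  have D1 : is_derive x (delta_mx ord0 i) (@ln R \o sumexp) ((sumexp x)^-1 * partial i sumexp x).
    apply: is_derive_compr; last exact: is_derive1_ln (sumexp_gt0 x).
    by apply: derivableP; exact: class_C_derivable (class_C_sumexp 1).
  apply: (is_derive_eq (is_deriveM (is_derive_cst p^-1 x (delta_mx ord0 i)) D1)).
  by rewrite /GRing.scale /= mulr0 addr0.
rewrite /partial (@derive_val _ _ _ _ _ _ _ Dl) partial_sumexp mulrA mulr_sumr.
apply: eq_bigr => a _; rewrite mxE; field.
by rewrite !gt_eqF ?sumexp_gt0.
Qed.

Lemma softmax_ge x : pgauge x <= softmax x.
Proof.
rewrite /softmax -ler_pdivrMl ?invr_gt0// invrK.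
rewrite -[leLHS]expRK ler_ln ?posrE ?expR_gt0 ?sumexp_gt0//.
have [i [ai|->]] : exists a, a \in L /\ pgauge x = lin a x \/ pgauge x = 0.
- rewrite /pgauge; elim: L => [|b s [a H]]; first by exists 0; right; rewrite big_nil.
  rewrite big_cons; have [h|h] := leP (lin b x) (\big[Num.max/0]_(a <- s) lin a x).
    by exists a; case: H => [[as_ ->]|->]; [left; rewrite inE as_ orbT|right].
  by exists b; left; rewrite mem_head.
- case: ai => iL ->; rewrite /sumexp (big_rem i)//= addrCA lerDl addr_ge0// sumr_ge0//.
by rewrite mulr0 expR0 sumexp_ge1.
Qed.

Lemma softmax_le x : softmax x <= pgauge x + p^-1 * ln (1 + (size L)%:R).
Proof.
rewrite /softmax -[X in X + _](mulKf (lt0r_neq0 p0)) -mulrDr ler_pM2l ?invr_gt0//.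
rewrite -[X in X + _]expRK -lnM ?posrE ?expR_gt0 ?ltr_wpDr//.
rewrite ler_ln ?posrE ?sumexp_gt0 ?mulr_gt0 ?expR_gt0 ?ltr_wpDr//.
rewrite mulrDr mulr1 lerD//.
  by rewrite -expR0 ler_expR mulr_ge0 ?pgauge_ge0// ltW.
rewrite mulr_natr -sum1_size.
have H s : {subset s <= L} -> \sum_(a <- s) expR (p * lin a x) <= expR (p * pgauge x) *+ (\sum_(a <- s) 1)%N.
  elim: s => [|a s IH] sL; first by rewrite !big_nil.
  rewrite !big_cons mulrS lerD ?IH// => [|b bs]; last by apply: sL; rewrite inE bs orbT.
  by rewrite ler_expR ler_pM2l// le_pgauge// sL// mem_head.
exact: H.
Qed.

End log_sum_exp.
End gauge.

(** * Smooth functions of the gauge *)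

Section smooth_web.
Variables (R : realType) (N : nat) (K Omega : set 'rV[R]_N).
Hypotheses (K_body : convex_body K) (K_sym : origin_symmetric K)
  (Omega_body : convex_body Omega).
Variables (L : seq 'rV[R]_N) (x0 : 'rV[R]_N) (H : R).
Hypotheses (H_ge0 : 0 <= H) (LH : forall a, a \in L -> support_function K a <= H).
Hypothesis (LO : forall x, (forall a, a \in L -> dotv a (x - x0) <= 1) -> Omega^° x).
Variable phi : R -> R.
Hypotheses (phi_smooth : forall k, diff_on setT k phi) (phi1 : phi 1 = 0)
  (phi_ge0 : forall s, 0 <= s <= 1 -> 0 <= phi s).
Implicit Types (x : 'rV[R]_N).
Local Notation J := (pgauge L x0).
Local Notation h := (support_function K).

Let Dphi (s : R) : is_derive s 1 phi (derive1 phi s).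
Proof. by rewrite derive1E; apply: derivableP; case: (phi_smooth 1) => + _; apply. Qed.

Let Ddphi (s : R) : is_derive s 1 (derive1 phi) (derive1 (derive1 phi) s).
Proof. by rewrite [X in is_derive _ _ _ X]derive1E; apply: derivableP; case: (phi_smooth 2) => _ [+ _]; apply. Qed.

Let ddphi_cont (s : R) : {for s, continuous (derive1 (derive1 phi))}.
Proof. by case: (phi_smooth 2) => _ [_]; apply. Qed.

Lemma derive_lipschitz (f df : R -> R) (B : R) : (forall s : R, is_derive s 1 f (df s)) ->
  (forall s, 0 <= s <= 1 -> `|df s| <= B) ->
  forall s t, 0 <= s -> s <= t -> t <= 1 -> `|f t - f s| <= B * (t - s).
Proof.
move=> D HB s t s0 st t1.
have cf : {within `[s, t], continuous f}.
  by apply: continuous_subspaceT => z; exact: is_derive_continuous (D z).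
have [c] := @MVT_segment R f df s t st (fun z _ => D z) cf.
rewrite in_itv/= => /andP[c0 c1] ->; rewrite normrM [X in _ * X]ger0_norm ?subr_ge0//.
by rewrite ler_wpM2r ?subr_ge0// HB// (le_trans s0 c0) (le_trans c1).
Qed.

Lemma smooth_web (d : R) : 0 < d -> exists u, [/\ test_function Omega^° u,
  forall x, 0 <= u x,
  forall x, J x <= 1 -> `|u x - phi (J x)| <= d /\
     h (grad u x) ^+ 2 <= (H * derive1 phi (J x)) ^+ 2 + d &
  forall x, 1 < J x -> u x = 0 /\ grad u x = 0].
Proof.
move=> d0.
have [B1 HB1] := @segment_bounded R (derive1 phi) 0 1 (fun s _ => is_derive_continuous (Ddphi s)).
have [B2 HB2] := @segment_bounded R (derive1 (derive1 phi)) 0 1 (fun s _ => @ddphi_cont s).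
have B10 : 0 <= B1 by apply: le_trans (HB1 0 _) => //; rewrite lexx ler01.
have B20 : 0 <= B2 by apply: le_trans (HB2 0 _) => //; rewrite lexx ler01.
(* With [dl] = d / A, the first summand controls the change of phi from J to G and the second that
   of (H phi')^2. *)
pose A := 2 * (B1 + 1) + H ^+ 2 * (2 * B1 * B2).
have A0 : 0 < A by rewrite ltr_pwDl ?mulr_ge0 ?sqr_ge0// mulr_gt0// ltr_wpDl.
pose dl := d / A; have dl0 : 0 < dl by exact: divr_gt0.
have dlA : dl * A = d by rewrite /dl divfK// gt_eqF.
have HBB : 0 <= H ^+ 2 * (2 * B1 * B2) by rewrite !mulr_ge0 ?sqr_ge0.
have dlB : B1 * dl <= d / 2 by rewrite -dlA /A; nra.
have dlC : H ^+ 2 * (2 * B1 * B2) * dl <= d by rewrite -dlA /A; nra.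
pose l := ln (1 + (size L)%:R) : R.
have l0 : 0 <= l by rewrite ln_ge0// lerDl.
(* Makes the excess of the log-sum-exp over the gauge at most [dl]; the 1 keeps p positive for an
   empty list. *)
pose p := (l + 1) / dl.
have p0 : 0 < p by rewrite divr_gt0// ltr_wpDl.
have pl : p^-1 * l <= dl.
  by rewrite ler_pdivrMl// /p divfK ?gt_eqF// lerDl.
pose G := softmax L x0 p.
have JG x : J x <= G x by exact: softmax_ge.
have GJ x : G x <= J x + dl by rewrite (le_trans (softmax_le L x0 p0 x))// lerD2l.
have J0 x : 0 <= J x by exact: pgauge_ge0.
have CG k : class_C k G by exact: class_C_softmax.
(* The shift and the smoothed positive part cost e each, together half of d; the other half pays for
   replacing J by G. *)
pose e := d / 4; have e0 : 0 < e by rewrite divr_gt0.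
have [eta eta0 Heta] : exists2 eta : R, 0 < eta & forall s, `|1 - s| < eta -> phi s <= e.
  have /cvgrPdist_le/(_ e e0)/nbhs_ballP[eta /= eta0 He] := is_derive_continuous (Dphi 1).
  exists eta => // s s1; have := He s s1; rewrite phi1 sub0r normrN.
  exact: le_trans (ler_norm _).
pose w := (phi \o G) + (fun=> - e).
have Cw k : class_C k w.
  apply: class_CD; last exact: class_C_cst.
  exact: (@class_C_comp _ _ setT).
pose v := w * (bump e \o w).
have Cv k : class_C k v.
  apply: class_CM => //; apply: (@class_C_comp _ _ setT) => //; exact: diff_on_flat.
(* The sign of phi beyond 1 is unknown, so v is cut there. On the overlap 1 - eta < G < 1 both
   definitions give 0, and smoothness is local. *)
pose u x := if G x < 1 then v x else 0.
have oG : open [set x | G x < 1].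
  by have /continuousP/(_ _ (@open_lt R 1)) := class_C_continuous (CG 0%N).
have oG' : open [set x | 1 - eta < G x].
  by have /continuousP/(_ _ (@open_gt R (1 - eta))) := class_C_continuous (CG 0%N).
have uv x : G x < 1 -> \near x, v x = u x.
  move=> Gx; apply: filterS (open_nbhs_nbhs (conj oG Gx)) => y /= Gy.
  by rewrite /u Gy.
have u0' x : 1 - eta < G x -> u x = 0.
  move=> Gx; rewrite /u; case: ifPn => // G1.
  have : phi (G x) <= e by apply: Heta; rewrite gtr0_norm; lra.
  move=> Ge; rewrite /v fctE /= bumpE ltNge.
  by rewrite (_ : w x <= 0) ?mulr0// /w fctE /=; lra.
have u0 x : 1 - eta < G x -> \near x, cst 0 x = u x.
  by move=> Gx; apply: filterS (open_nbhs_nbhs (conj oG' Gx)) => y /= /u0'.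
have cov x : G x < 1 \/ 1 - eta < G x.
  by have [g1|g1] := ltP (G x) 1; [left|right; lra].
have Cu k : class_C k u.
  apply: class_C_local => x; have [Gx|Gx] := cov x.
    by exists v => //; exact: uv.
  by exists (cst 0); [exact: class_C_cst|exact: u0].
have bO : bounded_set [set x | J x <= 1].
  have [cO _ _] := Omega_body; have [M [Mr HM]] := compact_bounded cO.
  exists M; split => // M' MM' x /= Jx; apply: HM MM' _ _; apply: interior_subset.
  by apply: LO => a aL; exact: le_trans (le_pgauge x0 x aL) Jx.
have tu : test_function Omega^° u.
  split=> //; exists [set x | G x <= 1 - eta].
    apply: bounded_closed_compact.
      have [M [Mr HM]] := bO; exists M; split => // M' MM' x /= Gx; apply: HM MM' _ _ => /=.
      by rewrite (le_trans (JG x))//; lra.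
    rewrite (_ : [set x | _] = ~` [set x | 1 - eta < G x]); first exact: open_closedC.
    by apply/seteqP; split => x /=; rewrite leNgt => /negP.
  split=> [x /= Gx|x /= /negP]; last by rewrite -ltNge; exact: u0'.
  apply: LO => a aL; rewrite (le_trans (le_pgauge x0 x aL))// (le_trans (JG x))//; lra.
have gu0 x : 1 <= G x -> grad u x = 0.
  move=> Gx; apply/rowP => i; rewrite !mxE (near_partial i (u0 x _)); last by lra.
  exact: derive_cst.
exists u; split => //.
- move=> x; rewrite /u; case: ifPn => // _; rewrite /v fctE /=.
  have [w0|w0] := ltP 0 (w x); last by rewrite bumpE ltNge w0 mulr0.
  by rewrite mulr_ge0 ?(ltW w0)// bumpE w0 expR_ge0.
- move=> x Jx; have [G1|G1] := ltP (G x) 1; last first.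
    have ux : u x = 0 by rewrite /u ltNge G1.
    split; last by rewrite gu0// -(scale0r 0) supportZ// normr0 mul0r expr0n addr_ge0 ?sqr_ge0// ltW.
    have := derive_lipschitz Dphi HB1 (J0 x) Jx (lexx 1).
    rewrite phi1 ux => hL; rewrite (le_trans hL)// (@le_trans _ _ (B1 * dl))//.
      by rewrite ler_wpM2l//; have := GJ x; lra.
    lra.
  have G0 : 0 <= G x by exact: le_trans (J0 x) (JG x).
  have GJx : G x - J x <= dl by have := GJ x; lra.
  have phiG := phi_ge0 (s := G x); rewrite G0 (ltW G1) in phiG; have {}phiG := phiG isT.
  split.
    have hL := derive_lipschitz Dphi HB1 (J0 x) (JG x) (ltW G1).
    have hL2 : `|phi (G x) - phi (J x)| <= d / 2.
      by rewrite (le_trans hL)// (le_trans _ dlB)// ler_wpM2l.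
    have hu : `|u x - phi (G x)| <= d / 2.
      rewrite /u G1 /v fctE /= ; have wE : w x = phi (G x) - e by [].
      have [w0|w0] := ltP 0 (w x).
        have /andP[b1 b2] := bump_lower e0 w0; rewrite ler_norml; apply/andP; split; rewrite /e in wE b1 *; lra.
      by rewrite bumpE ltNge w0 mulr0 sub0r normrN ger0_norm//; rewrite /e in wE; lra.
    have := ler_normD (u x - phi (G x)) (phi (G x) - phi (J x)).
    have -> : u x - phi (G x) + (phi (G x) - phi (J x)) = u x - phi (J x) by ring.
    lra.
  (* The slope of z * bump z at w x, which lies in [0, 1]. *)
  pose k := bump e (w x) + w x * derive1 (bump e) (w x).
  have gE : grad u x = (k * derive1 phi (G x)) *: grad G x.
    apply/rowP => i; rewrite [LHS]mxE (near_partial i (uv x G1)).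
    have DG : is_derive x (delta_mx ord0 i) G (partial i G x).
      by apply: derivableP; exact: class_C_derivable (CG 1%N).
    have Dw : is_derive x (delta_mx ord0 i) w (derive1 phi (G x) * partial i G x).
      have := is_deriveD (is_derive_compr DG (Dphi _)) (is_derive_cst (- e) x (delta_mx ord0 i)).
      by rewrite addr0.
    have Db : is_derive (w x) 1 (bump e) (derive1 (bump e) (w x)).
      by rewrite derive1E; apply: derivableP; exact: (@ex_derive _ _ _ _ _ _ _ (is_derive_flat e0 1 (w x))).
    have Dv := is_deriveM Dw (is_derive_compr Dw Db).
    rewrite /partial (@derive_val _ _ _ _ _ _ _ Dv) !mxE /k /GRing.scale /=; ring.
  have /andP[k0 k1] : 0 <= k <= 1 by exact: bump_slope.
  have hG : h (grad G x) <= H.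
    rewrite grad_softmax// (le_trans (support_sum_le K_body K_sym _ _ _))//.
    have S0 := sumexp_gt0 L x0 p x.
    apply: (@le_trans _ _ (\sum_(a <- L) expR (p * dotv a (x - x0)) / sumexp L x0 p x * H)).
      rewrite big_seq [leRHS]big_seq; apply: ler_sum => a aL.
      rewrite ger0_norm ?divr_ge0 ?expR_ge0 ?(ltW S0)//.
      by rewrite ler_wpM2l ?LH// divr_ge0 ?expR_ge0 ?(ltW S0).
    rewrite -mulr_suml ler_piMl// -mulr_suml ler_pdivrMr// mul1r.
    by rewrite /sumexp lerDr.
  have hu : h (grad u x) <= `|H * derive1 phi (G x)|.
    rewrite gE supportZ// !normrM (ger0_norm k0) (ger0_norm H_ge0).
    rewrite [leRHS]mulrC ler_pM ?mulr_ge0 ?support_ge0//.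
    by rewrite ler_piMl.
  have hd : `|derive1 phi (G x) - derive1 phi (J x)| <= B2 * dl.
    have := derive_lipschitz Ddphi HB2 (J0 x) (JG x) (ltW G1).
    by move=> /le_trans; apply; rewrite ler_wpM2l.
  have s1 : `|derive1 phi (G x)| <= B1 by rewrite HB1// G0 ltW.
  have s2 : `|derive1 phi (J x)| <= B1 by rewrite HB1// J0.
  have : h (grad u x) ^+ 2 <= (H * derive1 phi (G x)) ^+ 2.
    by rewrite -[leRHS]real_normK ?num_real// lerXn2r ?nnegrE ?support_ge0.
  move=> /le_trans; apply.
  have hs : `|derive1 phi (G x) + derive1 phi (J x)| <= 2 * B1.
    by rewrite (le_trans (ler_normD _ _))//; lra.
  have key : derive1 phi (G x) ^+ 2 - derive1 phi (J x) ^+ 2 <= B2 * dl * (2 * B1).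
    by rewrite subr_sqr (le_trans (ler_norm _))// normrM ler_pM.
  have := ler_wpM2l (sqr_ge0 H) key; rewrite !exprMn.
  move: dlC; move: (derive1 phi (G x)) (derive1 phi (J x)) => a b; lra.
- move=> x Jx; have G1 : 1 <= G x by rewrite (le_trans (ltW Jx)).
  by split; [rewrite /u ltNge G1|exact: gu0].
Qed.

End smooth_web.

(** * The radial eigenfunction of the ball *)

Section entire_series.
Variable R : realType.
Implicit Types (a : R^nat) (x : R).

(** A factorial bound, since termwise differentiation preserves it with the same C; comparison with
    the exponential series gives convergence everywhere. *)
Definition entire a : Prop := exists2 C : R, 0 <= C & forall n, `|a n| <= C / n`!%:R.

Definition psum a x : R := limn (pseries a x).

Lemma entire_diffs a : entire a -> entire (pseries_diffs a).
Proof.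
move=> [C C0 aC]; exists C => // n; rewrite normrM ger0_norm//.
have := ler_wpM2l (ler0n R n.+1) (aC n.+1); move=> /le_trans; apply.
by rewrite factS natrM invfM mulrCA mulVKf// pnatr_eq0.
Qed.

Lemma is_cvg_psum a x : entire a -> cvgn (pseries a x).
Proof.
move=> [C C0 aC]; apply: normed_cvg.
apply: (@series_le_cvg _ _ (fun n => C * exp_coeff `|x| n)) => [n|n|n|]; first exact: normr_ge0.
- by rewrite mulr_ge0// exp_coeff_ge0.
- rewrite /= normrM normrX (le_trans (ler_wpM2r _ (aC n))) ?exprn_ge0//.
  by rewrite /exp_coeff /= mulrAC mulrA.
- exact/is_cvg_seriesZ/is_cvg_series_exp_coeff.
Qed.

Lemma cvg_psum a x : entire a -> pseries a x @ \oo --> psum a x.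
Proof. exact: is_cvg_psum. Qed.

Lemma is_derive_psum a x : entire a -> is_derive x 1 (psum a) (psum (pseries_diffs a) x).
Proof.
move=> ea; have ed := entire_diffs ea; have edd := entire_diffs ed.
apply: (@pseries_snd_diffs _ _ (`|x| + 1)).
- exact: is_cvg_psum.
- exact: is_cvg_psum.
- exact: is_cvg_psum.
- by rewrite [ltRHS]ger0_norm ?addr_ge0// ltrDl.
Qed.

Lemma derive1_psum a : entire a -> derive1 (psum a) = psum (pseries_diffs a).
Proof.
by move=> ea; apply/funext => x; rewrite derive1E; exact: (@derive_val _ _ _ _ _ _ _ (is_derive_psum x ea)).
Qed.

Lemma diff_on_psum a k : entire a -> diff_on setT k (psum a).
Proof.
elim: k a => [|k IH] a ea /=; first by move=> x _; exact: is_derive_continuous (is_derive_psum x ea).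
split => [x _|]; first exact: (@ex_derive _ _ _ _ _ _ _ (is_derive_psum x ea)).
by rewrite derive1_psum//; exact/IH/entire_diffs.
Qed.

Lemma psum0 a : psum a 0 = a 0%N.
Proof.
apply: cvg_lim => //; rewrite -(cvg_shiftS (pseries a 0)).
rewrite (_ : (fun n => _) = fun=> a 0%N); first exact: cvg_cst.
apply/funext => n; rewrite /pseries /series /= big_nat_recl//= expr0 mulr1 big1_seq ?addr0// => i _.
by rewrite expr0n mulr0.
Qed.

Definition shift_coeff a : R^nat := fun n => if n is m.+1 then a m else 0.

Lemma cvg_shift_coeff a x : entire a ->
  pseries (shift_coeff a) x @ \oo --> x * psum a x.
Proof.
move=> ea; rewrite -(cvg_shiftS (pseries (shift_coeff a) x)).
rewrite (_ : (fun n => _) = fun n => x * pseries a x n).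
  by apply: cvgZ_seq; exact: cvg_psum.
apply/funext => n; rewrite /pseries /series /= big_nat_recl//= mul0r add0r mulr_sumr.
by apply: eq_bigr => i _; rewrite exprS mulrCA.
Qed.

End entire_series.

Section bessel.
Variables (R : realType) (N : nat).
Hypothesis N_gt0 : (0 < N)%N.

(* [psum bessel_coeff (l |x|^2)] is the radial solution of [- Laplacian w = l w]
   on R^N with [w 0 = 1]. *)
Fixpoint bessel_coeff (k : nat) : R :=
  if k is m.+1 then - bessel_coeff m / (2 * m.+1%:R * (2 * m + N)%:R) else 1.

Local Notation F := (psum bessel_coeff).

Lemma entire_bessel : entire bessel_coeff.
Proof.
exists 1 => //; elim => [|n IH]; first by rewrite /= normr1 fact0 divr1.
rewrite /= normrM normrN normfV (ger0_norm (_ : 0 <= 2 * n.+1%:R * (2 * n + N)%:R :> R)); last by rewrite !mulr_ge0.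
have N1 : 1 <= (2 * n + N)%:R :> R by rewrite ler1n; lia.
rewrite mul1r in IH; rewrite mul1r factS natrM (invfM n.+1%:R) [leRHS]mulrC ler_pM// ?invr_ge0 ?mulr_ge0//.
rewrite lef_pV2 ?posrE ?mulr_gt0// ?(lt_le_trans _ N1)//.
have : 1 <= n.+1%:R :> R by rewrite ler1n.
move: (n.+1%:R : R) ((2 * n + N)%:R : R) N1 => p q; nra.
Qed.

(** At z = l |x|^2 this is the equation of the ball: the Laplacian of F (l |x|^2) is l (4 z F'' + 2
    N F'). *)
Lemma bessel_ode z :
  4 * z * derive1 (derive1 F) z + (2 * N)%:R * derive1 F z = - F z.
Proof.
have e0 := entire_bessel; have e1 := entire_diffs e0; have e2 := entire_diffs e1.
rewrite !derive1_psum//; apply/eqP; rewrite -subr_eq0 opprK; apply/eqP.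
have c2 := cvgZ_seq (k := 4) (cvg_shift_coeff (x := z) e2).
have c1 := cvgZ_seq (k := (2 * N)%:R) (cvg_psum (x := z) e1).
have c : 4 * pseries (shift_coeff (pseries_diffs (pseries_diffs bessel_coeff))) z n +
    (2 * N)%:R * pseries (pseries_diffs bessel_coeff) z n + pseries bessel_coeff z n
    @[n --> \oo] --> 4 * (z * psum (pseries_diffs (pseries_diffs bessel_coeff)) z) +
    (2 * N)%:R * psum (pseries_diffs bessel_coeff) z + F z.
  by apply: cvgD; [exact: cvgD c2 c1|exact: cvg_psum].
rewrite -mulrA -(cvg_lim _ c)//; apply: cvg_lim => //.
(* The recursion for the coefficients kills the combination term by term, so all its partial sums
   vanish. *)
rewrite (_ : (fun n => _) = fun=> 0); first exact: cvg_cst.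
apply/funext => n; rewrite /pseries /series /= !mulr_sumr -!big_split /=.
apply: big1_seq => i _; rewrite /pseries_diffs /=.
have q0 k : (2 * k + N)%:R != 0 :> R by rewrite pnatr_eq0; lia.
case: i => [|i] /=.
  have := q0 0%N; rewrite muln0 add0n natrM; move: (N%:R : R) => q qn0; field; exact: qn0.
have := q0 i.+1; have p0 : i.+2%:R != 0 :> R by rewrite pnatr_eq0.
have -> : (2 * i.+1 + N)%:R = 2 * i.+2%:R - 2 + N%:R :> R by rewrite natrD natrM -[i.+2%:R]natr1; ring.
have -> : i.+1%:R = i.+2%:R - 1 :> R by rewrite -[i.+2%:R]natr1; ring.
have p1 : i.+2%:R - 1 != 0 :> R by rewrite -natr1 addrK pnatr_eq0.
have := q0 i; rewrite natrM natrD natrM; move: (i.+2%:R : R) p0 p1 => p p0 p1 r0 s0; field.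
by rewrite p0 p1 r0 s0.
Qed.

End bessel.

(** z is the least point of the compact set of those s in [0, b] with f s <= 0; the intermediate
    value theorem gives a zero in [0, z], which minimality identifies with z. *)
Lemma first_zero (R : realType) (f : R -> R) (b : R) : continuous f ->
  0 < f 0 -> 0 <= b -> f b <= 0 ->
  exists z, [/\ 0 < z <= b, f z = 0 & forall s, 0 <= s < z -> 0 < f s].
Proof.
move=> cf f0 b0 fb.
have cS : compact ([set` `[0, b]] `&` [set z | f z <= 0]).
  apply: compact_closedI; first exact: segment_compact.
  exact: ((continuous_closedP f).1 cf _ (@closed_le _ 0)).
have [|z] := @compact_EVT_min R R id _ _ cS (continuous_subspaceT (fun x => cvg_id)).
  by exists b; split => //=; rewrite in_itv/= b0 lexx.
rewrite inE => -[/=]; rewrite in_itv/= => /andP[z0 zb] fz zmin.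
have zlt : 0 < z by rewrite lt_neqAle z0 andbT; apply/eqP => E; move: fz; rewrite -E leNgt f0.
have pos s : 0 <= s < z -> 0 < f s.
  move=> /andP[s0 sz]; rewrite ltNge; apply/negP => fs.
  suff : z <= s by rewrite leNgt sz.
  apply: zmin; rewrite inE; split => //=; rewrite in_itv/= s0.
  exact: le_trans (ltW sz) zb.
exists z; rewrite zlt zb; split => //.
have [|c] := @IVT _ f 0 z 0 z0 (continuous_subspaceT cf).
  by rewrite ge_min le_max fz orbT (ltW f0).
rewrite in_itv/= => /andP[c0 cz] fc; suff <- : c = z by [].
apply/eqP; rewrite eq_le cz; apply: zmin; rewrite inE; split; last by rewrite /= fc.
by rewrite /= in_itv/= c0 (le_trans cz).
Qed.

(** * Barta's argument on the Euclidean ball *)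

Section ball.
Variables (R : realType) (N : nat).
Hypothesis N_gt0 : (0 < N)%N.
Local Notation mu := (@lebesgue_rV R N).
Local Notation B := (euclidean_ball R N).
Local Notation e_ i := (delta_mx ord0 i : 'rV[R]_N).
Local Notation F := (psum (@bessel_coeff R N)).
Local Notation F' := (derive1 F).
Local Notation F'' := (derive1 F').

Lemma class_C_dotvv k : class_C k (fun x : 'rV[R]_N => dotv x x).
Proof. by apply: class_C_sum => i; apply: class_CM; exact: class_C_coord. Qed.

Lemma is_derive_dotvv (x y : 'rV[R]_N) : is_derive x y (fun x => dotv x x) (2 * dotv x y).
Proof.
apply/is_derive_lineP.
rewrite (_ : (fun h => _) = fun h : R => h * (h * dotv y y) + h * (2 * dotv x y) + dotv x x).
  have Di := is_derive_id (0 : R) (1 : R).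
  have c k := is_derive_cst (k : R) (0 : R) (1 : R).
  have D := is_deriveD (is_deriveD (is_deriveM Di (is_deriveM Di (c (dotv y y))))
    (is_deriveM Di (c (2 * dotv x y)))) (c (dotv x x)).
  apply: (is_derive_eq D).
  by rewrite !fctE /= /GRing.scale /=; ring.
apply/funext => h; rewrite dotvDr dotvZr (dotvC _ y) (dotvC _ x) !dotvDr !dotvZr (dotvC y x).
ring.
Qed.

Lemma euclidean_ball_compact : compact B.
Proof.
apply: bounded_closed_compact.
  exists 1; split => // M M1 x Bx; apply: (le_trans _ (ltW M1)).
  apply: norm_rV_le => // i.
  have : x ord0 i ^+ 2 <= 1.
    rewrite (le_trans _ Bx)// /dotv (bigD1 i)//= expr2 lerDl.
    by apply: sumr_ge0 => j _; rewrite -expr2 sqr_ge0.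
  by rewrite -real_normK ?num_real// expr_le1.
have cd : continuous (fun x : 'rV[R]_N => dotv x x).
  by case: (class_C_dotvv 0).
exact: ((continuous_closedP _).1 cd _ (@closed_le _ 1)).
Qed.

Let oB : open B^°. Proof. exact: open_interior. Qed.
Let mB : measurable B^°. Proof. exact: open_measurable_rV. Qed.
Let fB : (mu B^° < +oo)%E.
Proof.
apply: le_lt_trans (compact_lebesgue_lty euclidean_ball_compact).
apply: le_measure; rewrite ?inE; [exact: mB| |exact: interior_subset].
apply: closed_measurable_rV. apply: compact_closed_rV. apply: euclidean_ball_compact.
Qed.

Let cF : continuous F.
Proof. by move=> x; exact: (diff_on_continuous (diff_on_psum 0 (entire_bessel R N_gt0))). Qed.

Let F_diff : diff_on setT 2 F. Proof. exact/diff_on_psum/entire_bessel. Qed.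

Section barta.
Variable lam : R.
Hypothesis lam_ge0 : 0 <= lam.
Hypothesis F_gt0 : forall z, 0 <= z <= lam -> 0 < F z.

Let z_ (x : 'rV[R]_N) : R := lam * dotv x x.

Let z_rng x : B x -> 0 <= z_ x <= lam.
Proof.
move=> Bx; rewrite mulr_ge0//=; first by rewrite ler_piMr.
by apply: sumr_ge0 => i _; rewrite -expr2 sqr_ge0.
Qed.

Let measurable_z (f : R -> R) : continuous f ->
  measurable_fun [set: 'rV[R]_N] (f \o z_).
Proof.
move=> cf; apply: continuous_measurable_rV => x.
apply: (@continuous_comp _ _ _ z_ f); last exact: cf.
have cz : class_C 0 z_ by apply: (@class_CM _ _ 0 (fun=> lam)); [exact: class_C_cst|exact: class_C_dotvv].
by case: cz => + _; exact.
Qed.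

Let bm_comp (f : R -> R) : continuous f -> bounded_measurable B^° (f \o z_).
Proof.
move=> cf; split; first by apply: measurable_funTS; exact: measurable_z.
have cn : {within `[0, lam], continuous (fun z => `|f z|)}.
  apply: continuous_subspaceT => x; apply: cvg_norm; exact: cf.
have [c _ Hc] := EVT_max lam_ge0 cn.
exists (`|f c|) => x /interior_subset/z_rng zr; apply: Hc; by rewrite in_itv.
Qed.

Let bm_inv : bounded_measurable B^° (fun x => (F (z_ x))^-1).
Proof.
have [mF _] := bm_comp cF; split.
  by apply: (measurableT_comp (@measurable_inv R)).
have [c] := EVT_min lam_ge0 (continuous_subspaceT cF).
rewrite in_itv /= => cr Hc.
exists ((F c)^-1) => x /interior_subset/z_rng zr.
rewrite gtr0_norm ?invr_gt0 ?F_gt0// lef_pV2 ?posrE ?F_gt0//.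
by apply: Hc; rewrite in_itv.
Qed.

(* With [Q = F' / F], the vector field [V i = 2 lam x_i Q u^2] satisfies
   [sum_i (D_i u)^2 - lam u^2 = sum_i (D_i u - 2 lam x_i Q u)^2 + sum_i D_i (V i)]. *)
Lemma barta (u : 'rV[R]_N -> R) : test_function B^° u ->
  lam * \int[mu]_(x in B^°) (u x) ^+ 2 <=
  \sum_(i < N) \int[mu]_(x in B^°) (partial i u x) ^+ 2.
Proof.
move=> tu; have [Cu [C cC [CB uC]]] := tu.
have cCl := compact_closed_rV cC.
pose Q (x : 'rV[R]_N) : R := F' (z_ x) / F (z_ x).
pose dQ (x : 'rV[R]_N) : R := F'' (z_ x) / F (z_ x) - Q x ^+ 2.
pose V (i : 'I_N) (x : 'rV[R]_N) : R := 2 * lam * (x ord0 i * Q x) * u x ^+ 2.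
pose dV (i : 'I_N) (x : 'rV[R]_N) : R := 2 * lam * (Q x + x ord0 i * (dQ x * (2 * lam * x ord0 i))) * u x ^+ 2 +
  4 * lam * (x ord0 i * Q x) * (u x * partial i u x).
pose W (i : 'I_N) (x : 'rV[R]_N) : R := partial i u x - 2 * lam * (x ord0 i * Q x) * u x.
have [dF [dF1 cF2']] := F_diff.
have cF2 : continuous F'' by move=> z; exact: cF2'.
have cF1 : continuous F' by move=> z; exact/derivable_continuous/dF1.
have bQ : bounded_measurable B^° Q by apply: bmM => //; exact: (bm_comp cF1).
have bdQ : bounded_measurable B^° dQ.
  by apply: bmB; [apply: bmM => //; exact: (bm_comp cF2)|exact: bmX].
have bx (i : 'I_N) : bounded_measurable B^° (fun x : 'rV[R]_N => x ord0 i).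
  split; first by apply: measurable_funTS; exact: measurable_rV_coord.
  have [M [Mr HM]] := compact_bounded euclidean_ball_compact.
  exists (M + 1) => x /interior_subset Bx; rewrite (le_trans (coord_le_norm _ _))//.
  by apply: HM => //; rewrite ltrDl.
have bu : bounded_measurable B^° u by exact: test_function_bm tu.
have bp i : bounded_measurable B^° (partial i u) by exact: test_function_bm (test_function_partial i tu).
have bc k := bm_cst B^° (k : R).
have bV i : bounded_measurable B^° (V i) by do !apply: bmM => //; exact: bmX.
have bdV i : bounded_measurable B^° (dV i).
  apply: bmD; last by do !apply: bmM => //.
  apply: bmM; last exact: bmX.
  apply: bmM; first exact: bc.
  by apply: bmD => //; do !apply: bmM => //.
have bW i : bounded_measurable B^° (W i) by apply: bmB => //; do !apply: bmM => //.
have dVC i x : ~ C x -> dV i x = 0.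
  by move=> nCx; rewrite /dV uC// (partial_zero _ cCl uC nCx) expr0n !mulr0 addr0.
have VC i x : ~ C x -> V i x = 0 by move=> nCx; rewrite /V uC// expr0n mulr0.
have DV i x : is_derive x (e_ i) (V i) (dV i x).
  (* F may vanish beyond the ball, so Q is differentiated at points of C only; off C the field is 0
     nearby. *)
  have [Cx|nCx] := pselect (C x); last by rewrite dVC//; exact: is_derive_zero cCl (VC i) nCx.
  have Fx : F (z_ x) != 0 by rewrite gt_eqF// F_gt0//; apply: z_rng; exact: interior_subset (CB _ Cx).
  have Dc j := is_derive_coord j x (e_ i).
  have Dz : is_derive x (e_ i) z_ (2 * lam * x ord0 i).
    have := is_deriveM (is_derive_cst lam x (e_ i)) (is_derive_dotvv x (e_ i)).
    move=> D; apply: (is_derive_eq D).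
    by rewrite dotvC dotv_delta scaler0 addr0 /GRing.scale /= /cst; ring.
  have D1 : is_derive (z_ x) 1 F' (F'' (z_ x)) by rewrite derive1E; exact/derivableP/dF1.
  have D0 : is_derive (z_ x) 1 F (F' (z_ x)) by rewrite derive1E; exact/derivableP/dF.
  have DQ := is_derive_compr Dz (is_deriveM D1 (is_deriveV (f := F) Fx D0)).
  have Du : is_derive x (e_ i) u (partial i u x) by apply: derivableP; exact: class_C_derivable (Cu 1%N).
  have D := is_deriveM (is_deriveM (is_derive_cst (2 * lam) x (e_ i)) (is_deriveM (Dc i) DQ)) (is_deriveM Du Du).
  rewrite (_ : V i = cst (2 * lam) * ((fun x : 'rV[R]_N => x ord0 i) * ((F' * (fun z => (F z)^-1)) \o z_)) * (u * u)); last first.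
    by apply/funext => y; rewrite /V /Q !fctE expr2.
  apply: (is_derive_eq D); rewrite !fctE /dV /dQ /Q /GRing.scale /= mxE !eqxx /=.
  field; exact: Fx.
have I0 i : \int[mu]_(x in B^°) dV i x = 0.
  have [[mV [M1 HM1]] [mdV [M2 HM2]]] := (bV i, bdV i).
  rewrite (Rintegral_support CB (dVC i)).
  apply: (@divergence0 _ _ C (V i) _ (e_ i) (Num.max 0 (Num.max M1 M2))) => //.
  - exact: compact_bounded.
  - have mu0 : measurable_fun setT u by apply: continuous_measurable_rV; exact: test_function_continuous tu.
    apply: measurable_funM; last exact: measurable_funX.
    apply: measurable_funM => //; apply: measurable_funM; first exact: measurable_rV_coord.
    apply: measurable_funM; first exact: measurable_z.
    by apply: (measurableT_comp (@measurable_inv R)); exact: measurable_z.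
  - move=> x; rewrite !le_max; have [Cx|nCx] := pselect (C x); last by rewrite VC// normr0 lexx.
    by rewrite HM1 ?orbT//; exact: CB.
  - move=> x; rewrite !le_max; have [Cx|nCx] := pselect (C x); last by rewrite dVC// normr0 lexx.
    by rewrite HM2 ?orbT//; exact: CB.
  - exact: VC.
  - exact: dVC.
have key x : B^° x -> \sum_(i < N) (partial i u x) ^+ 2 - lam * u x ^+ 2 =
    \sum_(i < N) (W i x) ^+ 2 + \sum_(i < N) dV i x.
  move=> /interior_subset Bx.
  have Fx : F (z_ x) != 0 by rewrite gt_eqF// F_gt0//; exact: z_rng.
  (* The equation of F divided by F: a Riccati equation for Q, exactly what the sum over i of the
     x_i^2 terms requires. *)
  have ode : 2 * (N%:R * Q x + 2 * z_ x * dQ x) = - 1 - 4 * z_ x * Q x ^+ 2.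
    have := bessel_ode N_gt0 (z_ x); rewrite /dQ /Q natrM.
    move: (F'' (z_ x)) (F' (z_ x)) (F (z_ x)) Fx => a b c c0 H.
    have -> : 2 * (N%:R * (b / c) + 2 * z_ x * (a / c - (b / c) ^+ 2)) =
        (4 * z_ x * a + 2 * N%:R * b) / c - 4 * z_ x * (b / c) ^+ 2 by field.
    by rewrite H mulNr divff.
  rewrite -big_split /= [RHS](eq_bigr (fun i => partial i u x ^+ 2 +
      (4 * lam ^+ 2 * (Q x ^+ 2 + dQ x) * u x ^+ 2 * (x ord0 i * x ord0 i) +
       2 * lam * Q x * u x ^+ 2))); last first.
    move=> j _; rewrite /W /dV; move: (dQ x) (Q x) (partial j u x) (u x) (x ord0 j) => a b c d f; ring.
  rewrite big_split /= big_split /= -mulr_sumr sumr_const card_ord -mulr_natl -/(dotv x x).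
  congr (_ + _); transitivity (lam * u x ^+ 2 * (2 * (N%:R * Q x + 2 * z_ x * dQ x) + 4 * z_ x * Q x ^+ 2)).
    by rewrite ode; ring.
  rewrite /z_; ring.
have int f : bounded_measurable B^° f -> mu.-integrable B^° (EFin \o f) by exact: bm_integrable.
have bS : bounded_measurable B^° (fun x => \sum_(i < N) (partial i u x) ^+ 2).
  by apply: bm_sum => i; exact: bmX.
have bSW : bounded_measurable B^° (fun x => \sum_(i < N) (W i x) ^+ 2).
  by apply: bm_sum => i; exact: bmX.
have : 0 <= \int[mu]_(x in B^°) (\sum_(i < N) (W i x) ^+ 2 + \sum_(i < N) dV i x).
  rewrite RintegralD//; [|exact: int|by apply: int; exact: bm_sum].
  rewrite (Rintegral_sum mB _ (fun i => int _ (bdV i))) big1// addr0.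
  by apply: Rintegral_ge0 => x _; apply: sumr_ge0 => i _; exact: sqr_ge0.
under eq_Rintegral => x xB do rewrite -(key _ (set_mem xB)).
rewrite RintegralB//; [|exact: int|by apply: int; apply: bmM => //; exact: bmX].
rewrite RintegralZl//; last by apply: int; exact: bmX.
rewrite subr_ge0 => /le_trans; apply.
by rewrite Rintegral_sum// => i; apply: int; exact: bmX.
Qed.

Lemma W012_barta (u : 'rV[R]_N -> R) g : W012 B^° u g ->
  lam * \int[mu]_(x in B^°) (u x) ^+ 2 <= \int[mu]_(x in B^°) dotv (g x) (g x).
Proof.
move=> Wu; have [p [tp _ cu cg]] := W012_approx oB fB Wu.
have [[_ Wg] _] := Wu.
have lc (i : 'I_N) : lipschitz_rV (fun x : 'rV[R]_N => x ord0 i).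
  by exists 1 => x y; rewrite mul1r (le_trans _ (coord_le_norm (x - y) i))// !mxE.
have -> : \int[mu]_(x in B^°) dotv (g x) (g x) = \sum_(i < N) \int[mu]_(x in B^°) (g x ord0 i) ^+ 2.
  by rewrite -Rintegral_sum// => i; apply: L2_integrable_sqr => //; case: (Wg i).
have cs : \sum_(i < N) \int[mu]_(x in B^°) (grad (p n) x ord0 i) ^+ 2 @[n --> \oo] -->
    \sum_(i < N) \int[mu]_(x in B^°) (g x ord0 i) ^+ 2.
  by apply: cvg_real_sum => i; exact: cg (lc i).
apply: (le_cvg_seq (cvgZ_seq (k := lam) cu) cs) => n.
rewrite (le_trans (barta (tp n)))// le_eqVlt; apply/orP; left; apply/eqP.
by apply: eq_bigr => i _; apply: eq_Rintegral => x _; rewrite mxE.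
Qed.

End barta.

(** Testing the weak equation with the eigenfunction itself makes l its Rayleigh quotient. *)
Lemma eigenvalue_barta l lam : dirichlet_eigenvalue B l -> 0 <= lam ->
  (forall z, 0 <= z <= lam -> 0 < F z) -> lam <= l.
Proof.
move=> [u [g [[Wu nu] Hl]]] lam0 Fpos.
have E : \int[mu]_(x in B^°) (u x * u x) = \int[mu]_(x in B^°) (u x) ^+ 2.
  by apply: eq_Rintegral => x _; rewrite expr2.
have := W012_barta lam0 Fpos Wu; rewrite (Hl _ _ Wu) E ler_pM2r//; apply: L2_norm_gt0 => //.
by case: Wu => -[].
Qed.

(** If F were positive on the whole of [0, l] it would be so slightly beyond l, and Barta's
    inequality there would exceed l. So F has a zero in the interval, and the first one is taken. *)
Lemma eigenvalue_zero l : dirichlet_eigenvalue B l ->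
  exists z, [/\ 0 < z <= l, F z = 0 & forall s, 0 <= s < z -> 0 < F s].
Proof.
move=> El; have F0 : 0 < F 0 by rewrite psum0 /=.
have l0 : 0 <= l.
  (* Barta's inequality with lam = 0, where the interval is a point and F 0 = 1. *)
  by apply: (eigenvalue_barta El) => // z; rewrite -eq_le => /eqP <-.
have [[s /andP[s0 sl] Fs]|nF] := pselect (exists2 s, 0 <= s <= l & F s <= 0).
  have [z [/andP[z0 zs] Fz zpos]] := first_zero cF F0 s0 Fs.
  by exists z; rewrite z0 (le_trans zs).
have Fpos s : 0 <= s <= l -> 0 < F s.
  by move=> sl; rewrite ltNge; apply/negP => Fs; apply: nF; exists s.
have : \forall s \near l, 0 < F s.
  have Fl : 0 < F l by rewrite Fpos// l0 lexx.
  have cl : F @ l --> F l by exact: cF.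
  exact: cl (lt_nbhsr Fl).
move=> /nbhs_ballP[e /= e0 He].
suff : l + e / 2 <= l by lra.
apply: eigenvalue_barta => // [|s /andP[s0 sl]]; first lra.
have [sl'|ls] := leP s l; first by apply: Fpos; rewrite s0.
by apply: He; rewrite /ball /= distrC ger0_norm; lra.
Qed.

End ball.

Lemma is_derive_sqr (R : realType) (s : R) : is_derive s 1 (fun s : R => s ^+ 2) (2 * s).
Proof.
apply: (is_derive_eq (is_deriveX 2 (is_derive_id s (1 : R)))).
by rewrite /GRing.scale /=; ring.
Qed.

Lemma diff_onD (R : realType) k (f g : R -> R) :
  diff_on setT k f -> diff_on setT k g -> diff_on setT k (f + g).
Proof.
elim: k f g => [|k IH] f g /=; first by move=> cf cg z Dz; apply: cvgD; [exact: cf|exact: cg].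
move=> [df Df] [dg Dg]; split => [z Dz|]; first by apply: derivableD; [exact: df|exact: dg].
rewrite (_ : derive1 (f + g) = derive1 f + derive1 g); first exact: IH.
by apply/funext => z; rewrite derive1E (deriveD (df z I) (dg z I)) -!derive1E.
Qed.

(** The polynomial factor absorbs the 2 z s of the chain rule and closes the induction on k. *)
Lemma diff_on_psum_sqr (R : realType) (a : R^nat) (p : {poly R}) (z : R) k : entire a ->
  diff_on setT k (fun s => p.[s] * psum a (z * s ^+ 2)).
Proof.
have D (b : R^nat) (q : {poly R}) (s : R) : entire b ->
  is_derive s 1 (fun s => q.[s] * psum b (z * s ^+ 2))
    (q^`().[s] * psum b (z * s ^+ 2) + (q * (2 * z)%:P * 'X).[s] * psum (pseries_diffs b) (z * s ^+ 2)).
  move=> eb.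
  have Dz := is_deriveM (is_derive_cst z s (1 : R)) (is_derive_sqr s).
  have Dq : is_derive s 1 (horner q) (q^`().[s]) by rewrite derivE derive1E; apply: derivableP; exact: derivable_horner.
  have := is_deriveM Dq (is_derive_compr Dz (is_derive_psum _ eb)).
  move=> H; apply: (is_derive_eq H); rewrite !fctE !hornerE /GRing.scale /=; ring.
elim: k a p => [|k IH] a p ea /=; first by move=> s _; exact: is_derive_continuous (D a p s ea).
split => [s _|]; first exact: (@ex_derive _ _ _ _ _ _ _ (D a p s ea)).
rewrite (_ : derive1 _ = (fun s => p^`().[s] * psum a (z * s ^+ 2)) +
    (fun s => (p * (2 * z)%:P * 'X).[s] * psum (pseries_diffs a) (z * s ^+ 2))).
  by apply: diff_onD; apply: IH => //; exact: entire_diffs.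
by apply/funext => s; rewrite derive1E (@derive_val _ _ _ _ _ _ _ (D a p s ea)).
Qed.

(** Serves for every limit below in a small parameter: once denominators are cleared, the error is
    linear in d. *)
Lemma le_of_le_addM (R : realType) (x y c d0 : R) : 0 < d0 ->
  (forall d, 0 < d < d0 -> x <= y + d * c) -> x <= y.
Proof.
move=> d00 H; rewrite leNgt; apply/negP => yx.
pose d := Num.min (d0 / 2) ((x - y) / (2 * (`|c| + 1))).
have c1 : 0 < 2 * (`|c| + 1) by rewrite mulr_gt0// ltr_wpDl.
have d1 : 0 < d by rewrite lt_min !divr_gt0// ?subr_gt0.
have d2 : d < d0 by rewrite gt_min; apply/orP; left; lra.
have := H d; rewrite d1 d2 => /(_ isT); apply/negP; rewrite -ltNge -ltrBrDl.
have dc : d * (2 * (`|c| + 1)) <= x - y by rewrite -ler_pdivlMr// ge_min lexx orbT.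
apply: le_lt_trans (_ : d * `|c| < _); first by rewrite ler_wpM2l ?(ltW d1)// ler_norm.
have : 0 <= d * `|c| by rewrite mulr_ge0 ?(ltW d1).
lra.
Qed.

(** * Web functions as test functions *)

Section web_test.
Variables (R : realType) (N : nat) (K Omega : set 'rV[R]_N).
Hypotheses (N_gt0 : (0 < N)%N).
Hypotheses (K_body : convex_body K) (K_sym : origin_symmetric K).
Hypothesis Omega_body : convex_body Omega.
Variables (L : seq 'rV[R]_N) (x0 : 'rV[R]_N) (t H : R).
Hypotheses (t_gt0 : 0 < t) (H_gt0 : 0 < H).
Hypothesis LH : forall a, a \in L -> support_function K a <= H.
Hypothesis LO : forall x, (forall a, a \in L -> dotv a (x - x0) <= 1) -> Omega^° x.
Hypothesis LT : forall a, a \in L -> forall x, Omega x -> t * dotv a (x - x0) <= 1.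

Local Notation mu := (@lebesgue_rV R N).
Local Notation h := (support_function K).
Local Notation J := (pgauge L x0).
Local Notation vol A := (fine (mu A)).

Definition pcell := [set x | J x <= 1].
Local Notation P := pcell.

Let J0 : forall x, 0 <= J x. Proof. exact: pgauge_ge0. Qed.

Lemma pcell_sub : P `<=` Omega^°.
Proof. by move=> x Px; apply: LO => a aL; exact: le_trans (le_pgauge x0 x aL) Px. Qed.

Let oO : open Omega^°. Proof. exact: open_interior. Qed.
Let mO : measurable Omega^°. Proof. exact: open_measurable_rV. Qed.
Let fO : (mu Omega^° < +oo)%E. Proof. exact: interior_lty. Qed.

Let mlevel (s : R) : measurable [set x | J x <= s].
Proof. by apply: closed_measurable_rV; exact: ((continuous_closedP _).1 (@pgauge_continuous _ _ L x0) _ (@closed_le _ s)). Qed.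

Let mP : measurable P. Proof. exact: mlevel. Qed.

Lemma pcell_lty : (mu P < +oo)%E.
Proof.
by apply: le_lt_trans fO; apply: le_measure; rewrite ?inE//; exact: pcell_sub.
Qed.

Lemma pcell_bounded : bounded_set P.
Proof.
have [cO _ _] := Omega_body; have [M [Mr HM]] := compact_bounded cO.
by exists M; split => // M' MM' x /pcell_sub/interior_subset Ox; exact: HM.
Qed.

(** The level set contains the homothetic copy of Omega of centre x0 and ratio s t. *)
Lemma pgauge_level_ge (s : R) : 0 < s -> (((s * t) ^+ N)%:E * mu Omega <= mu [set x | (J x <= s)%R])%E.
Proof.
move=> s0; have st0 : 0 < s * t by rewrite mulr_gt0.
have mOm := Omega_measurable Omega_body.
have := lebesgue_rV_affine (x0 - (s * t)^-1 *: x0) (t := (s * t)^-1) (A := Omega) _ mOm.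
rewrite invr_gt0 => /(_ st0); rewrite exprVn invrK => <-.
apply: le_measure; rewrite ?inE//; first exact: measurable_affine_preimage.
move=> x /= Ox; apply: pgauge_le; first exact: ltW.
move=> a aL; have := LT aL Ox.
have -> : x0 - (s * t)^-1 *: x0 + (s * t)^-1 *: x - x0 = (s * t)^-1 *: (x - x0).
  by apply/rowP => i; rewrite !mxE; ring.
rewrite dotvZr (_ : t * _ = dotv a (x - x0) / s); first by rewrite ler_pdivrMr// mul1r.
by field; rewrite !gt_eqF.
Qed.

Lemma Omega_vol_gt0 : 0 < vol Omega.
Proof.
apply: fine_gt0; rewrite Omega_lty// andbT.
have [_ _ [y /nbhs_ballP[e /= e0 He]]] := Omega_body.
pose a : 'rV[R]_N := \row_i (y ord0 i - e / 2); pose b : 'rV[R]_N := \row_i (y ord0 i + e / 2).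
have e2 : 0 < e / 2 by rewrite divr_gt0.
have ab i : a ord0 i <= b ord0 i by rewrite !mxE; lra.
apply: (@lt_le_trans _ _ (\prod_(i < N) (b ord0 i - a ord0 i))%:E).
  by rewrite lte_fin; apply: prodr_gt0 => i _; rewrite !mxE; lra.
rewrite -lebesgue_rV_box//; apply: le_measure; rewrite ?inE; [exact: measurable_box|exact: Omega_measurable|].
move=> x /= xab; apply: He; rewrite -ball_normE /= (@le_lt_trans _ _ (e / 2))//; last by lra.
by apply: norm_rV_le; [exact: ltW|move=> i; have := xab i; rewrite !mxE ler_norml; lra].
Qed.

Lemma pgauge_level_vol (s : R) : 0 < s <= 1 -> 0 < (s * t) ^+ N * vol Omega <= vol [set x | J x <= s].
Proof.
move=> /andP[s0 s1]; rewrite mulr_gt0 ?exprn_gt0 ?mulr_gt0 ?Omega_vol_gt0//=.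
have fs : (mu [set x | (J x <= s)%R] < +oo)%E.
  apply: le_lt_trans pcell_lty; apply: le_measure; rewrite ?inE//.
  by move=> x /= /le_trans; apply.
rewrite -lee_fin EFinM !fineK ?ge0_fin_numE//; first exact: pgauge_level_ge.
exact: Omega_lty.
Qed.

Section profile.
Variable phi : R -> R.
Hypothesis phi_smooth : forall k, diff_on setT k phi.
Hypothesis phi1 : phi 1 = 0.
Hypothesis phi_gt0 : forall s, 0 <= s < 1 -> 0 < phi s.

Let phi_ge0 s : 0 <= s <= 1 -> 0 <= phi s.
Proof.
move=> /andP[s0]; rewrite le_eqVlt => /predU1P[->|s1]; first by rewrite phi1.
by rewrite ltW// phi_gt0// s0.
Qed.

Lemma bm_profile (f : R -> R) : continuous f -> bounded_measurable P (f \o J).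
Proof.
move=> cf; split.
  apply: measurable_funTS; apply: continuous_measurable_rV => x.
  by apply: continuous_comp; [exact: pgauge_continuous|exact: cf].
have cn : {within `[0, 1], continuous (fun z => `|f z|)}.
  apply: continuous_subspaceT => x; apply: cvg_norm; exact: cf.
have [c _ Hc] := EVT_max ler01 cn.
by exists (`|f c|) => x Px; apply: Hc; rewrite in_itv /= J0.
Qed.

Local Notation A1 := (\int[mu]_(x in P) phi (J x)).
Local Notation A2 := (\int[mu]_(x in P) (phi (J x)) ^+ 2).
Local Notation E := (\int[mu]_(x in P) (derive1 phi (J x)) ^+ 2).

Let cphi : continuous phi. Proof. by move=> z; exact: (phi_smooth 0). Qed.
Let cdphi : continuous (derive1 phi).
Proof. by move=> z; have [_ Dphi] := phi_smooth 1; exact: Dphi. Qed.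

Let int f : bounded_measurable P f -> mu.-integrable P (EFin \o f).
Proof. by apply: bm_integrable => //; exact: pcell_lty. Qed.

Lemma profile_sqr_gt0 : 0 < A2.
Proof.
apply: L2_norm_gt0 => //.
  by apply: bm_L2 => //; [exact: pcell_lty|exact: bm_profile].
move=> [A [mA A0 HA]].
have /andP[+ h2] : 0 < (2^-1 * t) ^+ N * vol Omega <= vol [set x | J x <= 2^-1].
  by apply: pgauge_level_vol; lra.
apply/negP; rewrite -leNgt (le_trans h2)//.
rewrite le_eqVlt; apply/orP; left; apply/eqP.
suff -> : mu [set x | J x <= 2^-1] = 0%E by [].
apply: (@subset_measure0 _ _ _ mu _ A) => //.
move=> x /= Jx; apply: HA => /= /(_ _) H0.
have : 0 < phi (J x) by apply: phi_gt0; rewrite J0; lra.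
by rewrite H0 ?ltxx// /pcell /=; lra.
Qed.

Let volE : \int[mu]_(x in P) (1 : R) = vol P.
Proof. by rewrite Rintegral_cst// mul1r. Qed.

Let split_P (f : 'rV[R]_N -> R) : (forall x, 1 < J x -> f x = 0) ->
  \int[mu]_(x in Omega^°) f x = \int[mu]_(x in P) f x.
Proof.
move=> fP; have f0 x : ~ P x -> f x = 0 by move=> /negP; rewrite -ltNge; exact: fP.
by rewrite (Rintegral_support pcell_sub f0) (Rintegral_support (@subset_refl _ P) f0).
Qed.

Lemma web_test (d : R) : 0 < d -> exists u, [/\ test_function Omega^° u,
  A1 - d * vol P <= \int[mu]_(x in Omega^°) u x,
  A2 - 2 * d * A1 <= \int[mu]_(x in Omega^°) (u x) ^+ 2 &
  \int[mu]_(x in Omega^°) h (grad u x) ^+ 2 <= H ^+ 2 * E + d * vol P].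
Proof.
move=> d0.
have [u [tu u0 uP uO]] := smooth_web K_body K_sym Omega_body (ltW H_gt0) LH LO phi_smooth phi1 phi_ge0 d0.
have bu : bounded_measurable P u by exact: test_function_bm tu.
have bphi := bm_profile cphi; have bdphi := bm_profile cdphi.
have bh : bounded_measurable P (fun x => h (grad u x) ^+ 2).
  split; first apply: measurable_funX.
    apply: measurable_comp_rV => //; first exact/lipschitz_rV_continuous/support_lipschitz.
    move=> i; under eq_fun do rewrite mxE.
    by have [] := test_function_bm P (test_function_partial i tu).
  have [_ [M HM]] := bmD (bmX 2 (bmM (bm_cst P H) bdphi)) (bm_cst P d).
  exists M => x Px; have [_ hx] := uP x Px; rewrite ger0_norm ?sqr_ge0// (le_trans hx)//.
  exact: le_trans (ler_norm _) (HM x Px).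
have bc k := bm_cst P (k : R).
exists u; split => //.
- rewrite split_P; last by move=> x /uO[].
  rewrite -volE -RintegralZl//; last by apply: int; exact: bc.
  rewrite -RintegralB//; [|exact: int|by apply: int; exact: bmM].
  apply: le_Rintegral => //; [by apply: int; apply: bmB => //; exact: bmM|exact: int|].
  by move=> x /= Px; have [+ _] := uP x Px; rewrite ler_distl => /andP[+ _]; rewrite mulr1; lra.
- rewrite split_P; last by move=> x /uO[-> _]; rewrite expr0n.
  rewrite -RintegralZl//; last exact: int.
  rewrite -RintegralB//; [|by apply: int; exact: bmX|by apply: int; exact: bmM].
  apply: le_Rintegral => //; [by apply: int; apply: bmB; [exact: bmX|exact: bmM]|by apply: int; exact: bmX|].
  move=> x /= Px; have [+ _] := uP x Px; rewrite ler_distl => /andP[+ _].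
  have : 0 <= phi (J x) by apply: phi_ge0; rewrite J0.
  (* If d <= phi, squaring u >= phi - d; otherwise phi^2 - 2 d phi <= 0. *)
  move: (u0 x); move: (phi (J x)) (u x) => a b; have [da|da] := leP d a; nra.
- rewrite split_P; last by move=> x /uO[_ ->]; rewrite -(scale0r 0) supportZ// normr0 mul0r expr0n.
  rewrite -volE -!RintegralZl//; [|by apply: int; exact: bc|by apply: int; exact: bmX].
  rewrite -RintegralD//; [|by apply: int; apply: bmM => //; exact: bmX|by apply: int; exact: bmM].
  apply: le_Rintegral => //; [exact: int|by apply: int; apply: bmD; apply: bmM => //; exact: bmX|].
  by move=> x /= Px; have [_ +] := uP x Px; rewrite exprMn mulr1.
Qed.

Let A1_ge0 : 0 <= A1.
Proof. by apply: Rintegral_ge0 => x Px; apply: phi_ge0; rewrite J0. Qed.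

Let test_admissible u : test_function Omega^° u -> 0 < \int[mu]_(x in Omega^°) (u x) ^+ 2 ->
  admissible Omega u (grad u).
Proof.
move=> tu u2; split; first exact: test_function_W012.
move=> u0; move: u2; rewrite /Rintegral.
suff -> : (\int[mu]_(x in Omega^°) ((u x) ^+ 2)%:E = 0)%E by rewrite ltxx.
transitivity (\int[mu]_(x in Omega^°) (cst 0 x))%E; last exact: integral0.
apply: ae_eq_integral => //.
  apply/measurable_EFinP; apply: measurable_funX.
  by have [] := test_function_bm Omega^° tu.
by apply: filterS u0 => x H0 Ox /=; rewrite H0// expr0n.
Qed.

(** The lower bound of the frequency, already proved, acts as a Poincare inequality and keeps the
    denominators positive. *)
Let frequency_gt0 u : test_function Omega^° u -> 0 < \int[mu]_(x in Omega^°) (u x) ^+ 2 ->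
  0 < \int[mu]_(x in Omega^°) h (grad u x) ^+ 2.
Proof.
move=> tu u2; apply: lt_le_trans (test_function_frequency N_gt0 K_body K_sym Omega_body tu).
by rewrite mulr_gt0// !divr_gt0// ?exprn_gt0// ?pi_gt0// inradius_gt0.
Qed.

(** Below this threshold the lower bound A2 - 2 d A1 of the L^2 norm squared stays positive. *)
Let d1 : R := A2 / (2 * (A1 + 1)).
Let d1_gt0 : 0 < d1.
Proof. by rewrite divr_gt0 ?profile_sqr_gt0// mulr_gt0// ltr_wpDl. Qed.

Let d1_small d : 0 < d < d1 -> 0 < A2 - 2 * d * A1.
Proof.
move=> /andP[d0]; rewrite /d1 ltr_pdivlMr; last by rewrite mulr_gt0// ltr_wpDl.
have := A1_ge0; nra.
Qed.

Let mP_ge0 : 0 <= vol P. Proof. exact: fine_ge0. Qed.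
Let E_ge0 : 0 <= E. Proof. by apply: Rintegral_ge0 => x _; exact: sqr_ge0. Qed.

Lemma torsional_rigidity_web : 0 < E -> 0 < A1 ->
  ((A1 ^+ 2 / (H ^+ 2 * E))%:E <= torsional_rigidity K Omega)%E.
Proof.
move=> E0 A10; have HE : 0 < H ^+ 2 * E by rewrite mulr_gt0 ?exprn_gt0.
pose d2 := Num.min d1 (A1 / (vol P + 1)).
have d20 : 0 < d2 by rewrite lt_min d1_gt0 divr_gt0// ltr_wpDl.
have key d : 0 < d < d2 -> (((A1 - d * vol P) ^+ 2 / (H ^+ 2 * E + d * vol P))%:E <=
    torsional_rigidity K Omega)%E.
  move=> /andP[d0]; rewrite lt_min => /andP[dd1 dd2].
  have [u [tu uA1 uA2 uE]] := web_test d0.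
  have u2 : 0 < \int[mu]_(x in Omega^°) (u x) ^+ 2.
    by apply: lt_le_trans uA2; apply: d1_small; rewrite d0.
  have h2 := frequency_gt0 tu u2.
  apply: (@le_trans _ _ ((\int[mu]_(x in Omega^°) u x) ^+ 2 /
      \int[mu]_(x in Omega^°) h (grad u x) ^+ 2)%:E).
    rewrite lee_fin.
    have dP : 0 <= A1 - d * vol P.
      by move: dd2; rewrite ltr_pdivlMr ?ltr_wpDl//; lra.
    have den : 0 < H ^+ 2 * E + d * vol P by rewrite ltr_wpDr// mulr_ge0// ltW.
    rewrite ler_pM ?invr_ge0 ?sqr_ge0 ?(ltW den)//.
      by rewrite lerXn2r ?nnegrE// (le_trans _ uA1).
    by rewrite lef_pV2 ?posrE.
  by apply: ereal_sup_ubound; exists u, (grad u); split => //; exact: test_admissible.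
(* The supremum is an extended real: +oo is trivial, and -oo is excluded by any one test
   function. *)
case ET : (torsional_rigidity K Omega) key => [T| |] key; last 2 first.
- by rewrite leey.
- have : 0 < d2 / 2 < d2 by lra.
  by move=> /key; rewrite leeNy_eq.
rewrite lee_fin ler_pdivrMr//.
(* The linear terms after clearing the denominator; the square of d times the volume is dropped. *)
apply: (@le_of_le_addM _ _ _ (T * vol P + 2 * A1 * vol P) d2) => // d dd.
have /andP[d0 _] := dd.
have := key d dd; rewrite lee_fin ler_pdivrMr; last by rewrite ltr_wpDr ?mulr_ge0 ?(ltW d0).
have := sqr_ge0 (d * vol P); lra.
Qed.

Lemma principal_frequency_web : (principal_frequency K Omega <= (H ^+ 2 * E / A2)%:E)%E.
Proof.
have A20 := profile_sqr_gt0.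
have key d : 0 < d < d1 -> (principal_frequency K Omega <=
    ((H ^+ 2 * E + d * vol P) / (A2 - 2 * d * A1))%:E)%E.
  move=> dd; have /andP[d0 _] := dd; have [u [tu _ uA2 uE]] := web_test d0.
  have A2d := d1_small dd.
  have u2 : 0 < \int[mu]_(x in Omega^°) (u x) ^+ 2 by apply: lt_le_trans uA2.
  apply: (@le_trans _ _ (\int[mu]_(x in Omega^°) h (grad u x) ^+ 2 /
      \int[mu]_(x in Omega^°) (u x) ^+ 2)%:E).
    by apply: ereal_inf_lbound; exists u, (grad u); split => //; exact: test_admissible.
  rewrite lee_fin ler_pM ?invr_ge0 ?(ltW u2) ?(ltW (frequency_gt0 tu u2))//.
  by rewrite lef_pV2 ?posrE.
case ET : (principal_frequency K Omega) key => [T| |] key.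
- rewrite lee_fin ler_pdivlMr//.
  apply: (@le_of_le_addM _ _ _ (vol P + 2 * A1 * T) d1) => // d dd.
  have := key d dd; rewrite lee_fin ler_pdivlMr ?d1_small//; lra.
- have := key (d1 / 2); rewrite leNgt ltry => H1.
  have : 0 < d1 / 2 < d1 by have := d1_gt0; lra.
  by move=> /H1.
- by rewrite leNye.
Qed.

End profile.

Let J_identity (q dq : R -> R) : (forall s : R, is_derive s 1 q (dq s)) -> continuous dq ->
  q 1 = 0 -> \int[mu]_(x in P) (N%:R * q (J x) + J x * dq (J x)) = 0.
Proof.
by apply: homogeneous_identity => //; [exact: pgauge_continuous|exact: pgauge_hom|exact: pcell_bounded].
Qed.

Let int f : continuous f -> mu.-integrable P (EFin \o (f \o J)).
Proof. by move=> cf; apply: bm_integrable => //; [exact: pcell_lty|exact: bm_profile]. Qed.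

(** For q = 1 - s^2 the homogeneous identity reads (N + 2) X = N |P|, X the integral of J^2. Hence
    the profile (1 - s^2) / 2 has integral |P| / (N + 2), and its squared derivative has integral
    X. *)
Lemma torsional_rigidity_ge_pcell :
  ((vol P / (H ^+ 2 * (N * N.+2)%:R))%:E <= torsional_rigidity K Omega)%E.
Proof.
pose p : {poly R} := 2^-1%:P * (1 - 'X^2).
have pE s : p.[s] = (1 - s ^+ 2) / 2 by rewrite /p !hornerE; ring.
have dp s : derive1 (horner p) s = - s.
  by rewrite -derivE /p derivM derivC derivB derivXn derivC !hornerE /=; field.
have volP : 0 < vol P.
  have : 0 < (1 * t) ^+ N * vol Omega <= vol P by apply: pgauge_level_vol; rewrite ltr01 lexx.
  by case/andP => /lt_le_trans; apply.
have cX : continuous (fun s : R => s ^+ 2) by move=> s; exact: exprn_continuous.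
have cp : continuous (horner p) by move=> s; exact: continuous_horner.
have iX := int cX; have ip := int cp.
have volE : \int[mu]_(x in P) (1 : R) = vol P by rewrite Rintegral_cst// mul1r.
have i1 : mu.-integrable P (EFin \o fun=> 1 : R).
  by apply: bm_integrable => //; [exact: pcell_lty|exact: bm_cst].
have p1 : p.[1] = 0 by rewrite pE expr1n subrr mul0r.
have p0 (s : R) : 0 <= s < 1 -> 0 < p.[s] by move=> s01; rewrite pE; nra.
have := torsional_rigidity_web (diff_on_horner p) p1 p0.
set X := \int[mu]_(x in P) (derive1 (horner p) (J x)) ^+ 2.
have XE : X = \int[mu]_(x in P) (J x) ^+ 2 by apply: eq_Rintegral => x _; rewrite dp sqrrN.
have A1E : \int[mu]_(x in P) p.[J x] = (vol P - X) / 2.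
  rewrite -volE XE -RintegralB// -RintegralZr//; last first.
    by apply: (int (f := fun s => 1 - s ^+ 2)) => s; apply: cvgB; [exact: cvg_cst|exact: cX].
  by apply: eq_Rintegral => x _; rewrite pE.
have XP : N.+2%:R * X = N%:R * vol P.
  have D (s : R) : is_derive s 1 (fun s : R => 1 - s ^+ 2) (- (2 * s)).
    apply: (is_derive_eq (is_deriveB (is_derive_cst (1 : R) s 1) (is_derive_sqr s))).
    by rewrite sub0r.
  have cd : continuous (fun s : R => - (2 * s)).
    by move=> s; apply: cvgN; apply: cvgM; [exact: cvg_cst|exact: cvg_id].
  have := J_identity D cd _; rewrite expr1n subrr => /(_ erefl) I.
  apply/eqP; rewrite eq_sym -subr_eq0; apply/eqP; rewrite -[RHS]I -volE XE.
  rewrite -!RintegralZl// -RintegralB//; [|exact: integrable_realZl|exact: integrable_realZl].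
  by apply: eq_Rintegral => x _; rewrite -[N.+2%:R]natr1 -[N.+1%:R]natr1; ring.
rewrite A1E => H1.
have N2 : (N.+2%:R : R) != 0 by rewrite pnatr_eq0.
have XV : X = N%:R * vol P / N.+2%:R by rewrite -XP mulrAC divff// mul1r.
have A1V : (vol P - X) / 2 = vol P / N.+2%:R.
  rewrite XV -[N.+2%:R]natr1 -[N.+1%:R]natr1 in N2 *; field; exact: N2.
have n0 : 0 < N%:R :> R by rewrite ltr0n.
have n2 : 0 < N.+2%:R :> R by rewrite ltr0n.
move: H1; rewrite A1V XV => H1; apply: le_trans (H1 _ _); rewrite ?divr_gt0 ?mulr_gt0//.
rewrite lee_fin le_eqVlt; apply/orP; left; apply/eqP; rewrite natrM.
by field; rewrite !gt_eqF.
Qed.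

Lemma principal_frequency_le_pcell z : 0 < z -> psum (@bessel_coeff R N) z = 0 ->
  (forall s, 0 <= s < z -> 0 < psum (@bessel_coeff R N) s) ->
  (principal_frequency K Omega <= (H ^+ 2 * z)%:E)%E.
Proof.
move=> z0 Fz Fpos; set F := psum _ in Fz Fpos.
have ea := entire_bessel R N_gt0.
pose F1 := psum (pseries_diffs (@bessel_coeff R N)).
pose F2 := psum (pseries_diffs (pseries_diffs (@bessel_coeff R N))).
have DF (w : R) : is_derive w 1 F (F1 w) by exact: is_derive_psum.
have DF1 (w : R) : is_derive w 1 F1 (F2 w) by apply: is_derive_psum; exact: entire_diffs.
have E1 : derive1 F = F1 by exact: derive1_psum.
have E2 : derive1 F1 = F2 by apply: derive1_psum; exact: entire_diffs.
pose phi (s : R) := F (z * s ^+ 2).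
have Dz (s : R) : is_derive s 1 (fun s => z * s ^+ 2) (2 * z * s).
  apply: (is_derive_eq (is_deriveM (is_derive_cst z s (1 : R)) (is_derive_sqr s))).
  by rewrite /GRing.scale /cst /=; ring.
have Dphi (s : R) : is_derive s 1 phi (F1 (z * s ^+ 2) * (2 * z * s)).
  exact: is_derive_compr (Dz s) (DF _).
have phi_smooth k : diff_on setT k phi.
  have := @diff_on_psum_sqr R _ 1 z k ea.
  by under eq_fun do rewrite hornerC mul1r.
have phi1 : phi 1 = 0 by rewrite /phi expr1n mulr1.
have phi_gt0 (s : R) : 0 <= s < 1 -> 0 < phi s.
  move=> /andP[s0 s1]; apply: Fpos; rewrite mulr_ge0 ?(ltW z0) ?sqr_ge0//=.
  by rewrite gtr_pMr// expr_lt1.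
have cphi : continuous phi by move=> s; exact: is_derive_continuous (Dphi s).
have cF2 : continuous (fun s : R => F2 (z * s ^+ 2)).
  move=> s; apply: (is_derive_continuous (is_derive_compr (Dz s) (is_derive_psum _ _))).
  exact/entire_diffs/entire_diffs.
have cF1 : continuous (fun s : R => F1 (z * s ^+ 2)).
  by move=> s; exact: (is_derive_continuous (is_derive_compr (Dz s) (DF1 _))).
have cdphi : continuous (derive1 phi).
  by move=> s; have [_ c] := phi_smooth 1; exact: c.
have dphi s : derive1 phi s = 2 * z * s * F1 (z * s ^+ 2).
  by rewrite derive1E (@derive_val _ _ _ _ _ _ _ (Dphi s)) mulrC.
(* This is phi phi' / s, written without the division. By the equation of F, N q + s q' = phi'^2 - z
   phi^2, so the homogeneous identity equates the two sides of the Rayleigh quotient. *)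
pose q (s : R) := 2 * z * phi s * F1 (z * s ^+ 2).
pose dq (s : R) := 4 * z ^+ 2 * s * (F1 (z * s ^+ 2) ^+ 2 + phi s * F2 (z * s ^+ 2)).
have Dq (s : R) : is_derive s 1 q (dq s).
  have := is_deriveM (is_deriveM (is_derive_cst (2 * z) s (1 : R)) (Dphi s))
    (is_derive_compr (Dz s) (DF1 _)).
  by move=> D; apply: (is_derive_eq D); rewrite !fctE /dq /GRing.scale /=; ring.
have cdq : continuous dq.
  move=> s; apply: cvgM; first by apply: cvgM; [exact: cvg_cst|exact: cvg_id].
  apply: cvgD; last by apply: cvgM; [exact: cphi|exact: cF2].
  by apply: cvgM; exact: cF1.
have q1 : q 1 = 0 by rewrite /q phi1 mulr0 mul0r.
set A2 := \int[mu]_(x in P) (phi (J x)) ^+ 2.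
have A2E : \int[mu]_(x in P) (derive1 phi (J x)) ^+ 2 = z * A2.
  have i1 : mu.-integrable P (EFin \o (fun x => (derive1 phi (J x)) ^+ 2)).
    by apply: (int (f := fun s => derive1 phi s * derive1 phi s)) => s; apply: cvgM; exact: cdphi.
  have i2 : mu.-integrable P (EFin \o (fun x => (phi (J x)) ^+ 2)).
    by apply: (int (f := fun s => phi s * phi s)) => s; apply: cvgM; exact: cphi.
  apply/eqP; rewrite -subr_eq0; apply/eqP; rewrite -(J_identity Dq cdq q1).
  rewrite -RintegralZl// -RintegralB//; last exact: integrable_realZl.
  apply: eq_Rintegral => x _; rewrite /q /dq dphi.
  have := bessel_ode N_gt0 (z * J x ^+ 2); rewrite -/F E1 E2 natrM -/(phi _).
  move: (J x) (phi (J x)) (F1 _) (F2 _) => s a b c ode.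
  have -> : N%:R * (2 * z * a * b) + s * (4 * z ^+ 2 * s * (b ^+ 2 + a * c)) =
    z * a * (4 * (z * s ^+ 2) * c + 2 * N%:R * b) + (2 * z * s * b) ^+ 2 by ring.
  by rewrite ode; ring.
have A20 := profile_sqr_gt0 phi_smooth phi_gt0.
have := principal_frequency_web phi_smooth phi1 phi_gt0.
by rewrite -/A2 A2E mulrA mulfK// gt_eqF.
Qed.

End web_test.

(** * Optimizing the inner polytope *)

Section inner_polytopes.
Variables (R : realType) (N : nat) (K Omega : set 'rV[R]_N).
Hypotheses (N_gt0 : (0 < N)%N).
Hypotheses (K_body : convex_body K) (K_sym : origin_symmetric K).
Hypothesis Omega_body : convex_body Omega.
Local Notation mu := (@lebesgue_rV R N).
Local Notation h := (support_function K).
Local Notation r := (inradius K Omega).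
Local Notation vol A := (fine (mu A)).

Let r_gt0 : 0 < r. Proof. exact: inradius_gt0. Qed.

(** Centred at the centre x0 of an inscribed copy of K of size s > t r: for k in K attaining h a,
    the point x0 + s k is in Omega, so t s h a <= 1. One factor t comes from the copy of K, the
    other from the polytope. *)
Lemma inner_polytope (t : R) : 0 < t < 1 -> exists (L : seq 'rV[R]_N) (x0 : 'rV[R]_N),
  [/\ forall a, a \in L -> h a <= (t ^+ 2 * r)^-1,
      forall x, (forall a, a \in L -> dotv a (x - x0) <= 1) -> Omega^° x &
      forall a, a \in L -> forall x, Omega x -> t * dotv a (x - x0) <= 1].
Proof.
move=> /andP[t0 t1].
have [|s [x0 [s_gt Ox sK]]] := @inradius_approx R N K Omega N_gt0 K_body K_sym Omega_body (t * r).
  by rewrite mulr_gt0//= gtr_pMl.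
have tr0 : 0 < t * r by rewrite mulr_gt0.
have [|L [_ LT LO]] := @polytope_between R N Omega x0 t Omega_body Ox; first by rewrite (ltW t0).
exists L, x0; split => // a aL.
have [k Kk <-] := support_attained K_body K_sym a.
have := LT a aL (x0 + s *: k) (sK _ (ex_intro2 _ _ k Kk erefl)).
rewrite addrAC subrr add0r dotvZr => H.
rewrite -[leRHS]mul1r ler_pdivlMr ?mulr_gt0 ?exprn_gt0//.
have [d0|d0] := leP (dotv a k) 0.
  by rewrite (le_trans _ ler01)// mulr_le0_ge0// mulr_ge0 ?exprn_ge0 ?ltW.
apply: le_trans H; rewrite expr2 -mulrA mulrC -!mulrA ler_pM2l// mulrA ler_pM2r//.
exact: ltW.
Qed.

Let bernoulli (d : R) M : 0 <= d <= 1 -> 1 - M%:R * d <= (1 - d) ^+ M.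
Proof.
move=> /andP[d0 d1]; elim: M => [|M IH]; first by rewrite mul0r subr0.
have Md : 0 <= M%:R * d * d by rewrite !mulr_ge0.
have := ler_wpM2l (_ : 0 <= 1 - d) IH; rewrite subr_ge0 => /(_ d1); rewrite -exprS.
by apply: le_trans; rewrite -natr1; lra.
Qed.

Lemma torsional_rigidity_ge :
  (((N * N.+2)%:R^-1 * r ^+ 2 * vol Omega)%:E <= torsional_rigidity K Omega)%E.
Proof.
have VO := Omega_vol_gt0 Omega_body.
pose c := (N * N.+2)%:R^-1 * r ^+ 2 * vol Omega.
have n0 : 0 < (N * N.+2)%:R :> R by rewrite ltr0n muln_gt0 N_gt0.
have c0 : 0 <= c by rewrite !mulr_ge0 ?invr_ge0 ?(ltW n0) ?sqr_ge0 ?ltW.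
(* t^N comes from the volume of the polytope, t^4 from the square of the bound on the normals. *)
have key (t : R) : 0 < t < 1 -> ((t ^+ (N + 4) * c)%:E <= torsional_rigidity K Omega)%E.
  move=> t01; have [L [x0 [LH LO LT]]] := inner_polytope t01.
  have /andP[t0 t1] := t01.
  have H0 : 0 < (t ^+ 2 * r)^-1 by rewrite invr_gt0 mulr_gt0 ?exprn_gt0.
  apply: le_trans (torsional_rigidity_ge_pcell N_gt0 K_body K_sym Omega_body t0 H0 LH LO LT).
  have /andP[_ V] : 0 < (1 * t) ^+ N * vol Omega <= vol (pcell L x0).
    by apply: (pgauge_level_vol Omega_body t0 LO LT); rewrite ltr01 lexx.
  rewrite lee_fin mul1r in V *.
  apply: (@le_trans _ _ (t ^+ N * vol Omega / ((t ^+ 2 * r)^-1 ^+ 2 * (N * N.+2)%:R))); last first.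
    by rewrite ler_pM2r// invr_gt0 mulr_gt0// exprn_gt0.
  rewrite le_eqVlt; apply/orP; left; apply/eqP; rewrite /c exprD.
  move: ((N * N.+2)%:R : R) n0 (t ^+ N) => n n0 p; field.
  by rewrite !gt_eqF.
case ET : (torsional_rigidity K Omega) key => [T| |] key; last 2 first.
- by rewrite leey.
- have : 0 < (2^-1 : R) < 1 by lra.
  by move=> /key; rewrite leNgt ltNyr.
rewrite lee_fin; apply: (@le_of_le_addM _ _ _ ((N + 4)%:R * c) 1) => // d /andP[d0 d1].
have t01 : 0 < 1 - d < 1 by lra.
have := key _ t01; rewrite lee_fin.
have := bernoulli (N + 4) (_ : 0 <= d <= 1); rewrite (ltW d0) (ltW d1) => /(_ isT).
move=> /(ler_wpM2r c0); move: (_%:R : R) (_ ^+ _) c0 => a b c0; rewrite -/c; lra.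
Qed.

Lemma principal_frequency_le (z : R) : 0 < z -> psum (@bessel_coeff R N) z = 0 ->
  (forall s, 0 <= s < z -> 0 < psum (@bessel_coeff R N) s) ->
  (principal_frequency K Omega <= (z * r ^- 2)%:E)%E.
Proof.
move=> z0 Fz Fpos.
have key (t : R) : 0 < t < 1 -> (principal_frequency K Omega <= ((t ^+ 2 * r)^-1 ^+ 2 * z)%:E)%E.
  move=> t01; have [L [x0 [LH LO LT]]] := inner_polytope t01.
  have /andP[t0 t1] := t01.
  have H0 : 0 < (t ^+ 2 * r)^-1 by rewrite invr_gt0 mulr_gt0 ?exprn_gt0.
  exact: (principal_frequency_le_pcell N_gt0 K_body K_sym Omega_body t0 H0 LH LO LT).
case ET : (principal_frequency K Omega) key => [T| |] key.
- rewrite lee_fin ler_pdivlMr ?exprn_gt0//.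
  apply: (@le_of_le_addM _ _ _ (4 * (T * r ^+ 2)) 1) => // d /andP[d0 d1].
  have t01 : 0 < 1 - d < 1 by lra.
  (* The sign needed to multiply Bernoulli's inequality; it is supplied by the lower bound of the
     frequency. *)
  have T0 : 0 <= T * r ^+ 2.
    rewrite mulr_ge0 ?exprn_ge0 ?(ltW r_gt0)//.
    have := principal_frequency_ge N_gt0 K_body K_sym Omega_body; rewrite ET lee_fin; apply: le_trans.
    by rewrite !mulr_ge0 ?invr_ge0 ?exprn_ge0 ?pi_ge0 ?(ltW r_gt0).
  have := key _ t01; rewrite lee_fin exprVn mulrC ler_pdivlMr; last first.
    by rewrite exprn_gt0// mulr_gt0// exprn_gt0//; case/andP: t01.
  have := bernoulli 4 (_ : 0 <= d <= 1); rewrite (ltW d0) (ltW d1) => /(_ isT).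
  move=> /(ler_wpM2l T0); rewrite exprMn -exprM; lra.
- have : 0 < (2^-1 : R) < 1 by lra.
  by move=> /key; rewrite leNgt ltry.
- by rewrite leNye.
Qed.

(** The factor r^2 is moved to the other side so that the infimum can be compared eigenvalue by
    eigenvalue; each one provides its own zero z <= l and thereby the test functions. *)
Lemma principal_frequency_le_eigenvalue :
  (principal_frequency K Omega <=
    first_dirichlet_eigenvalue (euclidean_ball R N) * (r ^- 2)%:E)%E.
Proof.
have r2 : 0 < r ^+ 2 by rewrite exprn_gt0.
rewrite lee_pdivlMr//; apply: le_ereal_inf_tmp => _ [l El <-].
have [z [/andP[z0 zl] Fz Fpos]] := eigenvalue_zero N_gt0 El.
rewrite -lee_pdivlMr// (le_trans (principal_frequency_le z0 Fz Fpos))//.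
by rewrite -EFinM lee_fin ler_pM2r ?invr_gt0.
Qed.

End inner_polytopes.

Theorem theorem6p2 (R : realType) (N : nat) (N_gt0 : (0 < N)%N)
    (K Omega : set 'rV[R]_N)
    (K_body : convex_body K) (K_sym : origin_symmetric K)
    (Omega_body : convex_body Omega) :
  let r := inradius K Omega in
  let T_ratio := (torsional_rigidity K Omega / lebesgue_rV R N Omega)%E in
  (((N * N.+2)%:R^-1 * r ^+ 2)%:E <= T_ratio /\
   T_ratio <= (3^-1 * r ^+ 2)%:E)%E /\
  ((pi ^+ 2 / 4 * r ^- 2)%:E <= principal_frequency K Omega /\
   principal_frequency K Omega <=
     first_dirichlet_eigenvalue (euclidean_ball R N) * (r ^- 2)%:E)%E.
Proof.
move=> r T_ratio.
have VO := Omega_vol_gt0 Omega_body.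
have r0 : 0 < r by exact: inradius_gt0.
have VE : lebesgue_rV R N Omega = (fine (lebesgue_rV R N Omega))%:E.
  by rewrite fineK// ge0_fin_numE// Omega_lty.
have TE : T_ratio = (torsional_rigidity K Omega * ((fine (lebesgue_rV R N Omega))^-1)%:E)%E.
  by rewrite /T_ratio {1}VE inver gt_eqF.
split; last split.
- rewrite TE; split.
    by rewrite lee_pdivlMr// -EFinM; exact: torsional_rigidity_ge.
  by rewrite lee_pdivrMr// -EFinM; exact: torsional_rigidity_le.
- exact: principal_frequency_ge.
- exact: principal_frequency_le_eigenvalue.
Qed.
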